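(* Let $M^n$ be a compact connected complex manifold of complex dimension $n$. Suppose there are two smooth Hermitian metrics $g_0$ and $\tilde g$ (possibly different) on $M$ such that $\operatorname{tr}_{\tilde g}R^{(TM,g_0)}$ is quasi-positive. Then there is a smooth Hermitian metric $h$ on $M$ such that (1) $(TM^{\otimes k},h^{\otimes k})$ is RC-positive for every $k\geq 1$; (2) $(\Lambda^p TM,\Lambda^p h)$ is RC-positive for every $1\leq p\leq n$.
   Context: All Hermitian metrics are smooth. $TM$ denotes the holomorphic tangent bundle, and $h^{\otimes k}$, $\Lambda^p h$ denote the Hermitian metrics induced by $h$ on $TM^{\otimes k}$ and $\Lambda^pTM$. For a Hermitian metric $g$ on a complex manifold, the Chern connection has, in local holomorphic coordinates $\{z^i\}$, coefficients $\Gamma_{ij}^k=g^{k\bar l}\partial_i g_{j\bar l}$; the Chern curvature tensor of $g$ is $R_{i\bar jk}{}^l=-\partial_{\bar j}\Gamma_{ik}^l$, and $R_{i\bar jk\bar l}=g_{p\bar l}R_{i\bar jk}{}^p$. For two Hermitian metrics $\tilde g, g$ on $M$, $\operatorname{tr}_{\tilde g}R^{(TM,g)}$ denotes the tensor with components $\tilde g^{k\bar l}R_{k\bar l i\bar j}$, where $R$ is the Chern curvature of $g$ (lowered with $g$). A Hermitian tensor $A_{i\bar j}$ is quasi-positive if the corresponding Hermitian form on $T^{1,0}M$ is positive semidefinite everywhere on $M$ and positive definite at some point of $M$. RC-positivity (Yang): a Hermitian holomorphic vector bundle $(E,h^E)$ over a complex manifold $M$, with Chern curvature $R^E$, is RC-positive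 if for every $q\in M$ and every nonzero $a\in E_q$ there exists a nonzero $v\in T^{1,0}_qM$ such that $R^E(v,\bar v,a,\bar a)>0$. Here, in local holomorphic coordinates and a local holomorphic frame $\{e_\alpha\}$ of $E$, $R^E_{i\bar j\alpha\bar\beta}=-\partial_i\partial_{\bar j}h^E_{\alpha\bar\beta}+(h^E)^{\gamma\bar\delta}\,\partial_i h^E_{\alpha\bar\delta}\,\partial_{\bar j}h^E_{\gamma\bar\beta}$ and $R^E(v,\bar v,a,\bar a)=R^E_{i\bar j\alpha\bar\beta}v^i\overline{v^j}a^\alpha\overline{a^\beta}$. *)

(* Defs.v *)
From HB Require Import structures.
From mathcomp Require Import all_boot all_order all_algebra.
From mathcomp Require Import complex.
From mathcomp Require Import all_classical all_reals all_analysis.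

Set Implicit Arguments.
Unset Strict Implicit.
Unset Printing Implicit Defensive.

Import Order.TTheory GRing.Theory Num.Theory.
Import numFieldNormedType.Exports.

Local Open Scope classical_set_scope.
Local Open Scope ring_scope.

(* The alias keeps the numClosedFieldType visible, which is how the norm
   topology of a numFieldType is inferred; it is not found on R[i] itself.
   Recall that 0 < z (resp. 0 <= z) in Cplx R says that z is real and
   positive (resp. nonnegative). *)
Definition Cplx (R : realType) : numClosedFieldType := R[i].

(* Real directional derivative of a complex-valued function on C^n:
   the derivative at t = 0 of t |-> f (z + t v), for t real. *)
Definition rline (R : realType) (n : nat) (f : 'rV[Cplx R]_n -> Cplx R)
    (v z : 'rV[Cplx R]_n) (t : R) : R[i] :=
  f (z + (real_complex R t : Cplx R) *: v).

Definition rderivable (R : realType) (n : nat) (f : 'rV[Cplx R]_n -> Cplx R)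
    (v z : 'rV[Cplx R]_n) : Prop :=
  derivable (fun t : R => complex.Re (rline f v z t)) 0 1 /\
  derivable (fun t : R => complex.Im (rline f v z t)) 0 1.

Definition rderive (R : realType) (n : nat) (v : 'rV[Cplx R]_n)
    (f : 'rV[Cplx R]_n -> Cplx R) (z : 'rV[Cplx R]_n) : Cplx R :=
  Complex (derive1 (fun t : R => complex.Re (rline f v z t)) 0)
          (derive1 (fun t : R => complex.Im (rline f v z t)) 0).

(* The coordinate directions x^j (b = false) and y^j (b = true), where
   z^j = x^j + i y^j. *)
Definition xydir (R : realType) (n : nat) (b : bool) (j : 'I_n) :
    'rV[Cplx R]_n :=
  (if b then 'i else 1) *: delta_mx 0 j.

Fixpoint Ck (R : realType) (n m : nat) (U : set 'rV[Cplx R]_n)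
    (f : 'rV[Cplx R]_n -> Cplx R) : Prop :=
  (forall z, U z -> {for z, continuous f}) /\
  match m with
  | 0%N => True
  | m'.+1 => forall (b : bool) (j : 'I_n),
      (forall z, U z -> rderivable f (xydir R b j) z) /\
      Ck m' U (rderive (xydir R b j) f)
  end.

(* Intended for U open, as are all the notions below. *)
Definition smooth (R : realType) (n : nat) (U : set 'rV[Cplx R]_n)
    (f : 'rV[Cplx R]_n -> Cplx R) : Prop :=
  forall m : nat, Ck m U f.

(* The Wirtinger operators d/dz^j and d/d\bar z^j. *)
Definition dz (R : realType) (n : nat) (j : 'I_n)
    (f : 'rV[Cplx R]_n -> Cplx R) (z : 'rV[Cplx R]_n) : Cplx R :=
  (rderive (xydir R false j) f z - 'i * rderive (xydir R true j) f z) / 2.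

Definition dzbar (R : realType) (n : nat) (j : 'I_n)
    (f : 'rV[Cplx R]_n -> Cplx R) (z : 'rV[Cplx R]_n) : Cplx R :=
  (rderive (xydir R false j) f z + 'i * rderive (xydir R true j) f z) / 2.

Definition holomorphic (R : realType) (n : nat) (U : set 'rV[Cplx R]_n)
    (f : 'rV[Cplx R]_n -> Cplx R) : Prop :=
  smooth U f /\ forall (j : 'I_n) z, U z -> dzbar j f z = 0.

(* A complex manifold of complex dimension n given by a holomorphic atlas
   (possibly, but not necessarily, the maximal one). The chart c is the
   homeomorphism coord c from the open set dom c onto the open set
   coord c @` dom c of C^n, with inverse param c; the values of coord c and
   param c outside these sets are irrelevant. *)
Record complexManifold (R : realType) (n : nat) := ComplexManifold {
  carrier :> topologicalType;
  carrier_hausdorff : hausdorff_space carrier;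
  carrier_second_countable : @second_countable carrier;
  atlas : Type;
  dom : atlas -> set carrier;
  coord : atlas -> carrier -> 'rV[Cplx R]_n;
  param : atlas -> 'rV[Cplx R]_n -> carrier;
  dom_open : forall c, open (dom c);
  dom_cover : forall q, exists c, dom c q;
  cod_open : forall c, open (coord c @` dom c);
  coordK : forall c q, dom c q -> param c (coord c q) = q;
  coord_continuous : forall c q, dom c q -> {for q, continuous (coord c)};
  param_continuous : forall c z, (coord c @` dom c) z ->
    {for z, continuous (param c)};
  transition_holomorphic : forall c d (k : 'I_n),
    holomorphic (coord c @` (dom c `&` dom d))
                (fun z => coord d (param c z) 0 k)
}.

Definition cod (R : realType) (n : nat) (X : complexManifold R n)
    (c : atlas X) : set 'rV[Cplx R]_n :=
  coord c @` dom c.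

(* k-th component of the change of coordinates from the chart c to d. *)
Definition transition (R : realType) (n : nat) (X : complexManifold R n)
    (c d : atlas X) (k : 'I_n) (z : 'rV[Cplx R]_n) : Cplx R :=
  coord d (param c z) 0 k.

(* A_{k \bar l} v^k \bar{v^l} *)
Definition hform (R : realType) (r : nat) (A : 'M[Cplx R]_r)
    (v : 'rV[Cplx R]_r) : Cplx R :=
  \sum_(k < r) \sum_(l < r) A k l * v 0 k * (v 0 l)^*.

(* A family of matrix-valued functions, one on the image of each chart. It
   represents a Hermitian form on a rank r holomorphic vector bundle E that
   has a distinguished holomorphic frame (e_a) over each chart: the entry
   (a, b) is the value of the form at (e_a, \bar e_b). For TM the frame is
   the coordinate frame d/dz^1, ..., d/dz^n. *)
Definition gram_family (R : realType) (n : nat) (X : complexManifold R n)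
    (r : nat) : Type :=
  atlas X -> 'rV[Cplx R]_n -> 'M[Cplx R]_r.

(* A smooth Hermitian metric on the holomorphic tangent bundle:
   gram g c z k l = g_{k \bar l}(z) in the chart c. *)
Record hermitianMetric (R : realType) (n : nat) (X : complexManifold R n) :=
  HermitianMetric {
  gram :> atlas X -> 'rV[Cplx R]_n -> 'M[Cplx R]_n;
  gram_smooth : forall c (k l : 'I_n),
    smooth (cod c) (fun z => gram c z k l);
  gram_hermitian : forall c z, cod c z ->
    forall k l : 'I_n, gram c z l k = (gram c z k l)^*;
  gram_posdef : forall c z, cod c z ->
    forall v : 'rV[Cplx R]_n, v != 0 -> 0 < hform (gram c z) v;
  gram_transition : forall c d z, (coord c @` (dom c `&` dom d)) z ->
    forall k l : 'I_n,
      gram c z k l =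
      \sum_(a < n) \sum_(b < n)
        gram d (coord d (param c z)) a b
        * dz k (transition c d a) z * (dz l (transition c d b) z)^*
}.

(* With the convention g^{k \bar l} g_{j \bar l} = delta_j^k, the matrix of
   the g^{k \bar l} is the transpose of the inverse of that of the
   g_{k \bar l}. *)
Definition ginv (R : realType) (r : nat) (A : 'M[Cplx R]_r) (k l : 'I_r) :
    Cplx R :=
  invmx A l k.

(* Gamma_{ij}^k = g^{k \bar l} d_i g_{j \bar l} *)
Definition christoffel (R : realType) (n : nat) (X : complexManifold R n)
    (g : hermitianMetric X) (c : atlas X) (i j k : 'I_n)
    (z : 'rV[Cplx R]_n) : Cplx R :=
  \sum_(l < n) ginv (g c z) k l * dz i (fun w => g c w j l) z.

(* R_{i \bar j k}^l = - d_{\bar j} Gamma_{ik}^l *)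
Definition chern_curv_mixed (R : realType) (n : nat) (X : complexManifold R n)
    (g : hermitianMetric X) (c : atlas X) (i j k l : 'I_n)
    (z : 'rV[Cplx R]_n) : Cplx R :=
  - dzbar j (christoffel g c i k l) z.

(* R_{i \bar j k \bar l} = g_{p \bar l} R_{i \bar j k}^p *)
Definition chern_curv (R : realType) (n : nat) (X : complexManifold R n)
    (g : hermitianMetric X) (c : atlas X) (i j k l : 'I_n)
    (z : 'rV[Cplx R]_n) : Cplx R :=
  \sum_(p < n) g c z p l * chern_curv_mixed g c i j k p z.

(* The entry (i, j) is gt^{k \bar l} R_{k \bar l i \bar j}, where R is the
   Chern curvature of g. *)
Definition tr_chern_curv (R : realType) (n : nat) (X : complexManifold R n)
    (gt g : hermitianMetric X) : gram_family X n :=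
  fun c z => \matrix_(i < n, j < n)
    \sum_(k < n) \sum_(l < n) ginv (gt c z) k l * chern_curv g c k l i j z.

Definition quasi_positive (R : realType) (n : nat) (X : complexManifold R n)
    (A : gram_family X n) : Prop :=
  (forall (q : X) c, dom c q ->
     forall v : 'rV[Cplx R]_n, 0 <= hform (A c (coord c q)) v) /\
  (exists q : X, forall c, dom c q ->
     forall v : 'rV[Cplx R]_n, v != 0 -> 0 < hform (A c (coord c q)) v).

(* Chern curvature R^E_{i \bar j a \bar b} of the Hermitian holomorphic vector
   bundle whose metric is given by H. *)
Definition bundle_curv (R : realType) (n : nat) (X : complexManifold R n)
    (r : nat) (H : gram_family X r) (c : atlas X) (i j : 'I_n) (a b : 'I_r)
    (z : 'rV[Cplx R]_n) : Cplx R :=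
  - dz i (dzbar j (fun w => H c w a b)) z
  + \sum_(s < r) \sum_(t < r)
      ginv (H c z) s t
      * dz i (fun w => H c w a t) z * dzbar j (fun w => H c w s b) z.

Definition RC_positive (R : realType) (n : nat) (X : complexManifold R n)
    (r : nat) (H : gram_family X r) : Prop :=
  forall (q : X) c, dom c q -> forall a : 'rV[Cplx R]_r, a != 0 ->
  exists v : 'rV[Cplx R]_n, v != 0 /\
    0 < \sum_(i < n) \sum_(j < n) \sum_(s < r) \sum_(t < r)
          bundle_curv H c i j s t (coord c q)
          * v 0 i * (v 0 j)^* * a 0 s * (a 0 t)^*.

(* TM^{\otimes k} has the frame d_{I 0} \otimes ... \otimes d_{I (k-1)} where I
   ranges over the maps from 'I_k to 'I_n. *)
Definition tensor_rank (k n : nat) : nat := #|{: {ffun 'I_k -> 'I_n}}|.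

Definition tensor_frame (k n : nat) (a : 'I_(tensor_rank k n)) :
    {ffun 'I_k -> 'I_n} :=
  enum_val a.

(* h^{\otimes k}(u_1 \otimes ... \otimes u_k, w_1 \otimes ... \otimes w_k) =
   \prod_s h(u_s, w_s) *)
Definition tensor_metric (R : realType) (n : nat) (X : complexManifold R n)
    (k : nat) (h : hermitianMetric X) : gram_family X (tensor_rank k n) :=
  fun c z => \matrix_(a, b)
    \prod_(s < k) h c z (tensor_frame a s) (tensor_frame b s).

(* \Lambda^p TM has the frame d_{I 0} /\ ... /\ d_{I (p-1)} where I ranges over
   the increasing maps from 'I_p to 'I_n. *)
Definition increasing_maps (p n : nat) : {set {ffun 'I_p -> 'I_n}} :=
  [set I : {ffun 'I_p -> 'I_n} |
    [forall s : 'I_p, forall t : 'I_p, (s < t)%N ==> (I s < I t)%N]]%SET.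

Definition exterior_rank (p n : nat) : nat := #|increasing_maps p n|.

Definition exterior_frame (p n : nat) (a : 'I_(exterior_rank p n)) :
    {ffun 'I_p -> 'I_n} :=
  enum_val a.

(* \Lambda^p h(u_1 /\ ... /\ u_p, w_1 /\ ... /\ w_p) = \det (h(u_s, w_t)) *)
Definition exterior_metric (R : realType) (n : nat) (X : complexManifold R n)
    (p : nat) (h : hermitianMetric X) : gram_family X (exterior_rank p n) :=
  fun c z => \matrix_(a, b)
    \det (\matrix_(s < p, t < p)
            h c z (exterior_frame a s) (exterior_frame b t)).

(* Main.v *)
Require Import Defs.
From HB Require Import structures.
From mathcomp Require Import all_boot all_order all_algebra.
From mathcomp Require Import fingroup perm.
From mathcomp Require Import complex.
From mathcomp Require Import all_classical all_reals all_analysis.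
From mathcomp Require Import ring lra.
Import Order.TTheory GRing.Theory Num.Theory.
Import numFieldNormedType.Exports.
Local Open Scope classical_set_scope.
Local Open Scope ring_scope.

Set Implicit Arguments.
Unset Strict Implicit.
Unset Printing Implicit Defensive.


(** The metric [h] is conformal to [g0]. The Chern curvature of [e^f g0] is
    [e^f (R - ddbar f g0)], where [R] is that of [g0] ([curv_conformal]), so the
    curvature of [e^f g0] traced with [gt] is [e^f (tr R - (Lap f) g0)], where
    [Lap] is the complex Laplacian of [gt] ([trcurv_conformal]). It is positive
    definite as soon as [(Lap f) g0 < tr R]. Quasi-positivity says that [tr R] is
    nonnegative everywhere and, by continuity, exceeds [mu g0] on a nonempty open
    set [N] for some [mu > 0] ([trcurv_lower_bound]). Hence it suffices to find
    [f] with [Lap f < lam], where [lam] is [mu] on [N] and [0] elsewhere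
    ([strict_potential]).

    No elliptic equation has to be solved for this. Call a point reached if some
    [f] satisfies [Lap f <= lam] everywhere, with strict inequality at that
    point. The set of reached points contains [N], by taking [f = 0], and it is
    open because [lam] is lower semicontinuous. It is also closed
    ([reached_closed]), by the argument of the strong maximum principle: the
    barrier [- e^(-s / (rho - |z - y|^2))] of Hopf, extended by zero, has for
    large [s] a Laplacian that is negative in its support outside a small ball
    around [y] ([hopf_barrier]). Centered at a reached point [y] and added with a
    small factor, it makes the inequality strict on the whole ball of squared
    radius [rho], which does not depend on how small the gap at [y] was. By
    connectedness every point is reached, and by compactness an average of
    finitely many functions [f] is strict everywhere.

    It remains to pass from the traced curvature of [h] to RC-positivity. The
    curvature of a tensor power acts as a derivation ([curv_tens]); traced with
    [gt], it is a sum of Kronecker products of positive definite matrices, hence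
    positive definite ([tens_trace_posdef]). Since the inverse of [gt] is a sum of
    terms [v v^*], a positive trace gives a direction [v] of positive curvature
    ([trace_positive]). The exterior power is, through antisymmetrization, a
    subbundle of the tensor power without second fundamental form, so that the
    curvature restricts to it ([curv_subframe]) and RC-positivity is inherited.

    The rest is calculus. Smoothness is a statement about iterated partial
    derivatives along real coordinate lines, so the chain rule and the symmetry
    of second derivatives are first deduced from the mean value theorem; they make
    the curvature and the Laplacian independent of the coordinates
    ([trcurv_change], [lap_change]). *)

Notation Re := complex.Re.
Notation Im := complex.Im.

(** * Complex numbers and real derivatives of complex-valued functions *)

Lemma continuous_near (T S : topologicalType) (f g : T -> S) z :
  (\forall w \near z, f w = g w) -> {for z, continuous f} -> {for z, continuous g}.
Proof.
move=> fg cf; have fgz : f z = g z := nbhs_singleton fg.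
have H : g w @[w --> z] --> f z.
  by apply: cvg_trans cf; exact: near_eq_cvg fg.
by rewrite fgz in H.
Qed.

Section ReIm.
Variable R : realType.
Implicit Types x y : Cplx R.

Lemma ReD x y : Re (x + y) = Re x + Re y. Proof. by case: x y => [? ?] [? ?]. Qed.
Lemma ImD x y : Im (x + y) = Im x + Im y. Proof. by case: x y => [? ?] [? ?]. Qed.
Lemma ReN x : Re (- x) = - Re x. Proof. by case: x. Qed.
Lemma ImN x : Im (- x) = - Im x. Proof. by case: x. Qed.
Lemma ReB x y : Re (x - y) = Re x - Re y. Proof. by rewrite ReD ReN. Qed.
Lemma ImB x y : Im (x - y) = Im x - Im y. Proof. by rewrite ImD ImN. Qed.
Lemma ReM x y : Re (x * y) = Re x * Re y - Im x * Im y.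
Proof. by case: x y => [? ?] [? ?]. Qed.
Lemma ImM x y : Im (x * y) = Re x * Im y + Im x * Re y.
Proof. by case: x y => [? ?] [? ?]. Qed.
Lemma Cplx_ext x y : Re x = Re y -> Im x = Im y -> x = y.
Proof. by case: x y => [? ?] [? ?] /= -> ->. Qed.
Lemma iE : 'i = Complex 0 1 :> Cplx R.
Proof. by symmetry; apply: (@complexiE R). Qed.
Lemma conjE x : x^* = Complex (Re x) (- Im x).
Proof. by case: x => a b. Qed.
Lemma Re_conj x : Re x^* = Re x. Proof. by rewrite conjE. Qed.
Lemma Im_conj x : Im x^* = - Im x. Proof. by rewrite conjE. Qed.
Lemma normE x : `|x| = real_complex R (Num.sqrt (Re x ^+ 2 + Im x ^+ 2)) :> Cplx R.
Proof. exact: (normc_def (x : R[i])). Qed.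
Lemma lecplx x y : (x <= y) = (Im y == Im x) && (Re x <= Re y).
Proof. exact: (@lecE R). Qed.
Lemma ltcplx x y : (x < y) = (Im y == Im x) && (Re x < Re y).
Proof. exact: (@ltcE R). Qed.
Lemma Re_sum (I : Type) (r : seq I) (P : pred I) (F : I -> Cplx R) :
  Re (\sum_(i <- r | P i) F i) = \sum_(i <- r | P i) Re (F i).
Proof. by apply: (big_morph (@complex.Re R)) => //; exact: ReD. Qed.
Lemma Im_sum (I : Type) (r : seq I) (P : pred I) (F : I -> Cplx R) :
  Im (\sum_(i <- r | P i) F i) = \sum_(i <- r | P i) Im (F i).
Proof. by apply: (big_morph (@complex.Im R)) => //; exact: ImD. Qed.

Definition RC (r : R) : Cplx R := real_complex R r.
Lemma ReRC r : Re (RC r) = r. Proof. by []. Qed.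
Lemma ImRC r : Im (RC r) = 0. Proof. by []. Qed.
Lemma RCD r s : RC (r + s) = RC r + RC s.
Proof. by apply: Cplx_ext; rewrite ?ReD ?ImD //= addr0. Qed.
Lemma RCM r s : RC (r * s) = RC r * RC s.
Proof. by apply: Cplx_ext; rewrite ?ReM ?ImM //= ?mulr0 ?mul0r ?subr0 ?addr0. Qed.
Lemma RCN r : RC (- r) = - RC r.
Proof. by apply: Cplx_ext; rewrite ?ReN ?ImN //= oppr0. Qed.
Lemma RC0 : RC 0 = 0. Proof. by []. Qed.
Lemma RC1 : RC 1 = 1. Proof. by []. Qed.
Lemma conjRC r : (RC r)^* = RC r.
Proof. by rewrite conjE; apply: Cplx_ext => //=; rewrite oppr0. Qed.
Lemma cplxE x : x = RC (Re x) + 'i * RC (Im x).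
Proof.
by apply: Cplx_ext; rewrite ?ReD ?ImD ?ReM ?ImM iE /= ?mul0r ?mulr0 ?mul1r ?oppr0 ?addr0 ?add0r.
Qed.
Lemma normRC r : `|RC r| = RC `|r|.
Proof. by rewrite normE /RC /= expr0n /= addr0 sqrtr_sqr. Qed.

Lemma norm_Re x : RC `|Re x| <= `|x|.
Proof.
rewrite normE lecplx /= eqxx /= -sqrtr_sqr ler_wsqrtr // lerDl; exact: sqr_ge0.
Qed.
Lemma norm_Im x : RC `|Im x| <= `|x|.
Proof.
rewrite normE lecplx /= eqxx /= -sqrtr_sqr ler_wsqrtr // lerDr; exact: sqr_ge0.
Qed.

Lemma RC_gt0 r : (0 < RC r) = (0 < r). Proof. by rewrite ltcplx /= eqxx. Qed.
Lemma RC_lt r s : (RC r < RC s) = (r < s). Proof. by rewrite ltcplx /= eqxx. Qed.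
Lemma gt0_RC x : 0 < x -> exists2 r : R, 0 < r & x = RC r.
Proof.
case: x => a b; rewrite ltcplx /= => /andP[/eqP -> a0]; by exists a.
Qed.

Lemma continuous_Re : continuous (@complex.Re R : Cplx R -> R).
Proof.
move=> x; apply/(@cvgrPdist_lt _ _ _ (nbhs x) _) => e e0.
apply/nbhs_ballP; exists (RC e) => [|y]; first by rewrite /= RC_gt0.
by rewrite -ball_normE /= -RC_lt -ReB; apply: le_lt_trans (norm_Re _).
Qed.

Lemma continuous_Im : continuous (@complex.Im R : Cplx R -> R).
Proof.
move=> x; apply/(@cvgrPdist_lt _ _ _ (nbhs x) _) => e e0.
apply/nbhs_ballP; exists (RC e) => [|y]; first by rewrite /= RC_gt0.
by rewrite -ball_normE /= -RC_lt -ImB; apply: le_lt_trans (norm_Im _).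
Qed.

Lemma continuous_RC : continuous RC.
Proof.
move=> x; apply/(@cvgrPdist_lt _ _ _ (nbhs x) _) => e /gt0_RC[r r0 ->].
apply/nbhs_ballP; exists r => // y.
by rewrite -ball_normE /= -RCN -RCD normRC RC_lt.
Qed.

Lemma cvg_ReIm (T : Type) (F : set_system T) (FF : Filter F)
    (f : T -> Cplx R) (a : Cplx R) :
  (fun t => Re (f t)) @ F --> Re a -> (fun t => Im (f t)) @ F --> Im a ->
  f @ F --> a.
Proof.
move=> fr fi; rewrite [a]cplxE.
rewrite (_ : f = fun t => RC (Re (f t)) + 'i * RC (Im (f t))); last first.
  by apply: funext => t; rewrite -cplxE.
apply: cvgD; first exact: (continuous_cvg _ (@continuous_RC _) fr).
by apply: cvgM; [exact: cvg_cst|exact: (continuous_cvg _ (@continuous_RC _) fi)].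
Qed.

Lemma continuous_conj : continuous (fun x : Cplx R => x^*).
Proof.
move=> x; apply: (@cvg_ReIm _ (nbhs x) _ (fun y => y^*) (x^*)).
  rewrite Re_conj (_ : (fun t => Re t^*) = @complex.Re R); last first.
    by apply: funext => y; rewrite Re_conj.
  exact: continuous_Re.
rewrite Im_conj (_ : (fun t => Im t^*) = fun t : Cplx R => - Im t); last first.
  by apply: funext => y; rewrite Im_conj.
by apply: cvgN; exact: continuous_Im.
Qed.

Section Continuity.
Variable T : topologicalType.
Implicit Types (f g : T -> Cplx R) (z : T).

Lemma contD f g z : {for z, continuous f} -> {for z, continuous g} ->
  {for z, continuous (fun w => f w + g w)}.
Proof. by move=> fz gz; exact: (cvgD fz gz). Qed.
Lemma contN f z : {for z, continuous f} -> {for z, continuous (fun w => - f w)}.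
Proof. by move=> fz; exact: (cvgN fz). Qed.
Lemma contM f g z : {for z, continuous f} -> {for z, continuous g} ->
  {for z, continuous (fun w => f w * g w)}.
Proof. by move=> fz gz; exact: (cvgM fz gz). Qed.
Lemma contV f z : f z != 0 -> {for z, continuous f} ->
  {for z, continuous (fun w => (f w)^-1)}.
Proof. by move=> fz0 fz; exact: (cvgV fz0 fz). Qed.
Lemma cont_conj f z : {for z, continuous f} ->
  {for z, continuous (fun w => (f w)^*)}.
Proof. by move=> fz; exact: (continuous_comp fz (@continuous_conj (f z))). Qed.
Lemma cont_RC (u : T -> R) z : {for z, continuous u} ->
  {for z, continuous (fun w => RC (u w))}.
Proof. by move=> uz; exact: (continuous_comp uz (@continuous_RC (u z))). Qed.
Lemma cont_Re f z : {for z, continuous f} -> {for z, continuous (fun w => Re (f w))}.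
Proof. by move=> fz; exact: (continuous_comp fz (@continuous_Re (f z))). Qed.
Lemma cont_Im f z : {for z, continuous f} -> {for z, continuous (fun w => Im (f w))}.
Proof. by move=> fz; exact: (continuous_comp fz (@continuous_Im (f z))). Qed.
Lemma cont_sum (I : Type) (r : seq I) (P : pred I) (F : I -> T -> Cplx R) z :
  (forall i, {for z, continuous (F i)}) ->
  {for z, continuous (fun w => \sum_(i <- r | P i) F i w)}.
Proof.
move=> Fz; rewrite /prop_for; elim: r => [|i r IH].
  rewrite (_ : (fun w => _) = fun=> 0); first exact: cst_continuous.
  by apply: funext => w; rewrite big_nil.
rewrite (_ : (fun w => _) = fun w => if P i then F i w + \sum_(i <- r | P i) F i w
  else \sum_(i <- r | P i) F i w); last by apply: funext => w; rewrite big_cons.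
case: (P i); [exact: (contD (Fz i) IH)|exact: IH].
Qed.

Lemma cont_near (u : T -> R) z (eps : R) : 0 < eps -> {for z, continuous u} ->
  \forall w \near z, `|u z - u w| < eps.
Proof. by move=> e0 uz; exact: ((@cvgrPdist_lt _ _ _ (nbhs z) _ u (u z)).1 uz eps e0). Qed.

End Continuity.

Definition Rder (f : R -> R) (t d : R) : Prop := is_derive t (1 : R) f d.

(** A complex-valued curve is differentiated through its real and imaginary
    parts, since [Cplx R] is only normed over itself. *)
Definition cderiv (g : R -> Cplx R) (t : R) (d : Cplx R) :=
  Rder (fun s => Re (g s)) t (Re d) /\ Rder (fun s => Im (g s)) t (Im d).

Lemma is_derive_eqf (f g : R -> R) (t a b : R) :
  Rder f t a -> f = g -> a = b -> Rder g t b.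
Proof. by move=> ? <- <-. Qed.

Lemma cderiv_cst (a : Cplx R) t : cderiv (fun=> a) t 0.
Proof. by split; apply: (is_derive_eqf (is_derive_cst _ _ _)). Qed.

Lemma cderivD f g t a b :
  cderiv f t a -> cderiv g t b -> cderiv (fun s => f s + g s) t (a + b).
Proof.
move=> [f1 f2] [g1 g2]; split.
  apply: (is_derive_eqf (is_deriveD f1 g1)); last by rewrite ReD.
  by apply: funext => s; rewrite ReD.
apply: (is_derive_eqf (is_deriveD f2 g2)); last by rewrite ImD.
by apply: funext => s; rewrite ImD.
Qed.

Lemma cderivN f t a : cderiv f t a -> cderiv (fun s => - f s) t (- a).
Proof.
move=> [f1 f2]; split.
  apply: (is_derive_eqf (is_deriveN f1)); last by rewrite ReN.
  by apply: funext => s; rewrite ReN.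
apply: (is_derive_eqf (is_deriveN f2)); last by rewrite ImN.
by apply: funext => s; rewrite ImN.
Qed.

Lemma cderivM f g t a b :
  cderiv f t a -> cderiv g t b ->
  cderiv (fun s => f s * g s) t (a * g t + f t * b).
Proof.
move=> [f1 f2] [g1 g2]; split.
  apply: (is_derive_eqf (is_deriveB (is_deriveM f1 g1) (is_deriveM f2 g2))).
    by apply: funext => s; rewrite ReM.
  by rewrite ReD !ReM /GRing.scale /=; ring.
apply: (is_derive_eqf (is_deriveD (is_deriveM f1 g2) (is_deriveM f2 g1))).
  by apply: funext => s; rewrite ImM.
by rewrite ImD !ImM /GRing.scale /=; ring.
Qed.

Lemma cderiv_conj f t a : cderiv f t a -> cderiv (fun s => (f s)^*) t a^*.
Proof.
move=> [f1 f2]; split.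
  apply: (is_derive_eqf f1); last by rewrite conjE.
  by apply: funext => s; rewrite conjE.
apply: (is_derive_eqf (is_deriveN f2)); last by rewrite conjE.
by apply: funext => s; rewrite conjE.
Qed.

Lemma cderiv_RC (f : R -> R) (t a : R) :
  Rder f t a -> cderiv (fun s => RC (f s)) t (RC a).
Proof.
move=> fa; split => //=.
by apply: (is_derive_eqf (is_derive_cst 0 _ _)).
Qed.

Lemma cderiv_uniq f t a b : cderiv f t a -> cderiv f t b -> a = b.
Proof.
move=> [[_ f1] [_ f2]] [[_ g1] [_ g2]].
by apply: Cplx_ext; rewrite -?f1 -?f2 ?g1 ?g2.
Qed.

Lemma cderiv_near f g t a :
  (\forall s \near t, f s = g s) -> cderiv f t a -> cderiv g t a.
Proof.
move=> fg [f1 f2]; split.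
  by apply: near_eq_is_derive f1; apply: filterS fg => s ->.
by apply: near_eq_is_derive f2; apply: filterS fg => s ->.
Qed.

Lemma is_derive_continuous (f : R -> R) (t a : R) :
  Rder f t a -> {for t, continuous f}.
Proof. by move=> [fd _]; apply/differentiable_continuous/derivable1_diffP. Qed.

Lemma cderiv_continuous f t a : cderiv f t a -> {for t, continuous f}.
Proof.
by move=> [/is_derive_continuous f1 /is_derive_continuous f2]; apply: cvg_ReIm.
Qed.

Lemma conj_norm_sqr x : x^* * x = RC (Re x ^+ 2 + Im x ^+ 2).
Proof.
rewrite conjE; apply: Cplx_ext; rewrite ?ReM ?ImM /=; last by ring.
by rewrite /=; ring.
Qed.

Lemma cderivV f t a : f t != 0 -> cderiv f t a ->
  cderiv (fun s => (f s)^-1) t (- a / (f t) ^+ 2).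
Proof.
move=> ft fa.
(* Writing [x^-1] as [x^* / |x|^2] shows that the derivative exists; its value
   then comes from differentiating [f * f^-1 = 1]. *)
pose N s := Re (f s) ^+ 2 + Im (f s) ^+ 2.
have invE s : (f s)^-1 = (f s)^* * RC (N s)^-1.
  have [->|fs0] := eqVneq (f s) 0.
    by rewrite invr0 conjE; apply: Cplx_ext; rewrite ?ReM ?ImM /=; ring.
  have Ns : RC (N s) != 0 by rewrite -conj_norm_sqr mulf_neq0 // conjC_eq0.
  have NV : RC (N s)^-1 = (RC (N s))^-1.
    apply: (mulfI Ns); rewrite divff // -RCM divff //.
    by apply: contraNneq Ns => ->.
  rewrite NV -conj_norm_sqr; field; by rewrite fs0 conjC_eq0 fs0.
have Nt : N t != 0.
  apply/eqP => N0; have := conj_norm_sqr (f t); rewrite -/(N t) N0 RC0 => /eqP.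
  by rewrite mulf_eq0 conjC_eq0 (negbTE ft).
have [f1 f2] := fa.
have dN : Rder N t (Re a * Re (f t) *+ 2 + Im a * Im (f t) *+ 2).
  apply: (is_derive_eqf (is_deriveD (is_deriveM f1 f1) (is_deriveM f2 f2))).
    by apply: funext => s; rewrite /N !expr2.
  by rewrite /GRing.scale /=; ring.
have dV := is_deriveV Nt dN.
have dI : exists b, cderiv (fun s => (f s)^-1) t b.
  exists (a^* * RC (N t)^-1 + (f t)^* * RC (- (N t) ^- 2 *: (Re a * Re (f t) *+ 2 + Im a * Im (f t) *+ 2))).
  rewrite (_ : (fun s => (f s)^-1) = (fun s => (f s)^* * RC (N s)^-1)); last first.
    by apply: funext => s; exact: invE.
  by apply: cderivM; [exact: cderiv_conj|exact: cderiv_RC dV].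
have [b db] := dI; have bE : a * (f t)^-1 + f t * b = 0.
  apply: (cderiv_uniq (cderivM fa db)).
  apply: cderiv_near (cderiv_cst 1 t).
  have H : \forall s \near t, f s != 0.
    exact: cvgr_neq0 (cderiv_continuous fa) ft.
  by apply: filterS H => s fs; rewrite divff.
rewrite (_ : - a / _ = b) //.
apply: (mulfI ft); apply: (addrI (a / f t)); rewrite bE.
by field.
Qed.

End ReIm.

(** * Directional derivatives, Wirtinger operators and smooth functions *)

Section Calculus.
Variables (R : realType) (n : nat).
Notation V := 'rV[Cplx R]_n.
Implicit Types (f g : V -> Cplx R) (z v : V) (U : set V).

Lemma line_cvg z v : z + RC (t : R) *: v @[t --> (0 : R)] --> z.
Proof.
have H : z + RC (t : R) *: v @[t --> (0 : R)] --> z + RC 0 *: v.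
  by apply: cvgD; [exact: cvg_cst|apply: cvgZr_tmp; exact: (@continuous_RC R 0)].
by rewrite RC0 scale0r addr0 in H.
Qed.

Definition isrd f v z (d : Cplx R) := cderiv (rline f v z) 0 d.

Lemma isrd_rderive f v z : rderivable f v z -> isrd f v z (rderive v f z).
Proof.
move=> [f1 f2]; split; rewrite /rderive [X in Rder _ _ X]/= derive1E.
  exact: (derivableP f1).
exact: (derivableP f2).
Qed.

Lemma isrd_rderivable f v z d : isrd f v z d -> rderivable f v z.
Proof. by move=> [[f1 _] [f2 _]]. Qed.

Lemma isrd_val f v z d : isrd f v z d -> rderive v f z = d.
Proof.
by move=> [[_ f1] [_ f2]]; apply: Cplx_ext; rewrite /rderive /= derive1E.
Qed.

Lemma isrd_near f g v z d :
  (\forall w \near z, f w = g w) -> isrd f v z d -> isrd g v z d.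
Proof.
move=> fg; apply: cderiv_near; exact: (@line_cvg z v _ fg).
Qed.

Lemma rline0 f v z : rline f v z 0 = f z.
Proof. by rewrite /rline -/(RC 0) RC0 scale0r addr0. Qed.

Lemma isrd_cst (a : Cplx R) v z : isrd (fun=> a) v z 0.
Proof. exact: cderiv_cst. Qed.

Lemma isrdD f g v z a b :
  isrd f v z a -> isrd g v z b -> isrd (fun w => f w + g w) v z (a + b).
Proof. exact: cderivD. Qed.

Lemma isrdN f v z a : isrd f v z a -> isrd (fun w => - f w) v z (- a).
Proof. exact: cderivN. Qed.

Lemma isrdM f g v z a b : isrd f v z a -> isrd g v z b ->
  isrd (fun w => f w * g w) v z (a * g z + f z * b).
Proof. by move=> fa gb; have := cderivM fa gb; rewrite !rline0. Qed.

Lemma isrd_conj f v z a : isrd f v z a -> isrd (fun w => (f w)^*) v z a^*.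
Proof. exact: cderiv_conj. Qed.

Lemma isrdV f v z a : f z != 0 -> isrd f v z a ->
  isrd (fun w => (f w)^-1) v z (- a / f z ^+ 2).
Proof. by move=> fz fa; have := cderivV (t := 0) _ fa; rewrite rline0; exact. Qed.

Lemma isrd_ucomp (psi : R -> R) (u : V -> R) v z (p : R) a :
  Rder psi (u z) p -> isrd (fun w => RC (u w)) v z a ->
  isrd (fun w => RC (psi (u w))) v z (RC p * a).
Proof.
move=> dpsi [/= u1 u2].
have aE : a = RC (Re a).
  apply: Cplx_ext => //=; have [_ <-] := u2.
  by have [_] := is_derive_cst (0 : R) (0 : R) (1 : R).
have uz : u (z + real_complex R 0 *: v) = u z.
  by rewrite -/(RC 0) RC0 scale0r addr0.
rewrite aE -RCM; apply: cderiv_RC.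
rewrite -uz in dpsi.
by apply: (is_derive_eqf (is_derive1_comp dpsi u1)).
Qed.

(** ** Wirtinger operators *)

Lemma xydirE b j : xydir R b j = (if b then 'i else 1) *: delta_mx 0 j :> V.
Proof. by []. Qed.

Opaque rderive rderivable isrd xydir.

Definition rd f z := forall b j, rderivable f (xydir R b j) z.

Lemma rd_isrd f z b j : rd f z -> isrd f (xydir R b j) z (rderive (xydir R b j) f z).
Proof. by move=> fz; apply: isrd_rderive. Qed.

(** One name for both operators, since their calculus rules are the same and
    conjugation exchanges them. *)
Definition wirt (s : bool) (j : 'I_n) f z :=
  if s then dzbar j f z else dz j f z.

Lemma wirtE s j f z : wirt s j f z =
  (rderive (xydir R false j) f z
   + (if s then 'i else - 'i) * rderive (xydir R true j) f z) / 2.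
Proof. by case: s; rewrite // /wirt /dz mulNr. Qed.

Lemma dzE j f z : dz j f z = wirt false j f z. Proof. by []. Qed.
Lemma dzbarE j f z : dzbar j f z = wirt true j f z. Proof. by []. Qed.

Opaque wirt dz dzbar.

Lemma wirt_isrd s j f z a b :
  isrd f (xydir R false j) z a -> isrd f (xydir R true j) z b ->
  wirt s j f z = (a + (if s then 'i else - 'i) * b) / 2.
Proof. by move=> /isrd_val fa /isrd_val fb; rewrite wirtE fa fb. Qed.

Lemma rd_cst a z : rd (fun=> a) z.
Proof. by move=> b j; apply: isrd_rderivable (isrd_cst _ _ _). Qed.

Lemma rdD f g z : rd f z -> rd g z -> rd (fun w => f w + g w) z.
Proof.
move=> fz gz b j; apply: isrd_rderivable (isrdD (rd_isrd b j fz) (rd_isrd b j gz)).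
Qed.

Lemma rdN f z : rd f z -> rd (fun w => - f w) z.
Proof. by move=> fz b j; apply: isrd_rderivable (isrdN (rd_isrd b j fz)). Qed.

Lemma rdM f g z : rd f z -> rd g z -> rd (fun w => f w * g w) z.
Proof.
move=> fz gz b j; apply: isrd_rderivable (isrdM (rd_isrd b j fz) (rd_isrd b j gz)).
Qed.

Lemma rd_conj f z : rd f z -> rd (fun w => (f w)^*) z.
Proof. by move=> fz b j; apply: isrd_rderivable (isrd_conj (rd_isrd b j fz)). Qed.

Lemma rd_sum (I : Type) (r : seq I) (P : pred I) (F : I -> V -> Cplx R) z :
  (forall i, rd (F i) z) -> rd (fun w => \sum_(i <- r | P i) F i w) z.
Proof.
move=> Fz; elim: r => [|i r IH].
  by under eq_fun do rewrite big_nil; exact: rd_cst.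
under eq_fun do rewrite big_cons; by case: (P i); [exact: rdD|exact: IH].
Qed.

Lemma wirt_near s j f g z : (\forall w \near z, f w = g w) -> rd f z ->
  wirt s j f z = wirt s j g z.
Proof.
move=> fg fz; rewrite (wirt_isrd s (rd_isrd _ _ fz) (rd_isrd _ _ fz)).
by rewrite (wirt_isrd s (isrd_near fg (rd_isrd _ _ fz)) (isrd_near fg (rd_isrd _ _ fz))).
Qed.

Lemma wirt_cst s j a z : wirt s j (fun=> a) z = 0.
Proof.
by rewrite (wirt_isrd s (isrd_cst a _ _) (isrd_cst a _ _)) mulr0 addr0 mul0r.
Qed.

Lemma wirtD s j f g z : rd f z -> rd g z ->
  wirt s j (fun w => f w + g w) z = wirt s j f z + wirt s j g z.
Proof.
move=> fz gz; rewrite (wirt_isrd s (isrdD (rd_isrd _ _ fz) (rd_isrd _ _ gz))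
  (isrdD (rd_isrd _ _ fz) (rd_isrd _ _ gz))) !wirtE.
by rewrite mulrDr addrACA mulrDl.
Qed.

Lemma wirtN s j f z : rd f z -> wirt s j (fun w => - f w) z = - wirt s j f z.
Proof.
move=> fz; rewrite (wirt_isrd s (isrdN (rd_isrd _ _ fz))
  (isrdN (rd_isrd _ _ fz))) !wirtE.
by rewrite mulrN -opprD mulNr.
Qed.

Lemma wirtM s j f g z : rd f z -> rd g z ->
  wirt s j (fun w => f w * g w) z = wirt s j f z * g z + f z * wirt s j g z.
Proof.
move=> fz gz; rewrite (wirt_isrd s (isrdM (rd_isrd _ _ fz) (rd_isrd _ _ gz))
  (isrdM (rd_isrd _ _ fz) (rd_isrd _ _ gz))) !wirtE.
move: (rderive _ f z) (rderive _ f z) (rderive _ g z) (rderive _ g z) => a b c d.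
by move: (if s then _ else _) (f z) (g z) => i x y; field.
Qed.

Lemma conj_i : ('i : Cplx R)^* = - 'i.
Proof. by rewrite iE conjE; apply: Cplx_ext; rewrite /= ?oppr0. Qed.

Lemma wirt_conj s j f z : rd f z ->
  wirt s j (fun w => (f w)^*) z = (wirt (~~ s) j f z)^*.
Proof.
move=> fz; rewrite (wirt_isrd s (isrd_conj (rd_isrd _ _ fz))
  (isrd_conj (rd_isrd _ _ fz))) !wirtE.
move: (rderive _ f z) (rderive _ f z) => a b.
rewrite rmorphM fmorphV rmorph_nat rmorphD rmorphM; congr ((_ + _ * _) / _).
by case: s => /=; rewrite ?rmorphN /= conj_i ?opprK.
Qed.

Lemma wirt_sum (I : Type) (r : seq I) (P : pred I) (F : I -> V -> Cplx R) s j z :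
  (forall i, rd (F i) z) ->
  wirt s j (fun w => \sum_(i <- r | P i) F i w) z
  = \sum_(i <- r | P i) wirt s j (F i) z.
Proof.
move=> Fz; elim: r => [|i r IH].
  by under eq_fun do rewrite big_nil; rewrite wirt_cst big_nil.
under eq_fun do rewrite big_cons; rewrite big_cons; case: (P i); last exact: IH.
by rewrite wirtD ?IH //; exact: rd_sum.
Qed.

Lemma rd_ucomp (psi dpsi : R -> R) (u : V -> R) z :
  (forall t : R, Rder psi t (dpsi t)) -> rd (fun w => RC (u w)) z ->
  rd (fun w => RC (psi (u w))) z.
Proof.
by move=> dp uz b j; apply: isrd_rderivable (isrd_ucomp (dp _) (rd_isrd b j uz)).
Qed.

Lemma wirt_ucomp (psi dpsi : R -> R) (u : V -> R) s j z :
  (forall t : R, Rder psi t (dpsi t)) -> rd (fun w => RC (u w)) z ->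
  wirt s j (fun w => RC (psi (u w))) z
  = RC (dpsi (u z)) * wirt s j (fun w => RC (u w)) z.
Proof.
move=> dp uz; rewrite (wirt_isrd s (isrd_ucomp (dp _) (rd_isrd _ _ uz))
  (isrd_ucomp (dp _) (rd_isrd _ _ uz))) !wirtE.
by rewrite mulrCA -mulrDr mulrA.
Qed.

(** ** Smooth functions *)

Lemma open_near U (P : V -> Prop) z :
  open U -> (forall w, U w -> P w) -> U z -> \forall w \near z, P w.
Proof. by move=> oU UP Uz; apply: filterS (open_nbhs_nbhs (conj oU Uz)). Qed.

Lemma Ck_ext m U f g : open U -> (forall z, U z -> f z = g z) ->
  Ck m U f -> Ck m U g.
Proof.
move=> oU; elim: m f g => [|m IH] f g fg [cf df].
  split; last exact: I.
  by move=> z Uz; apply: continuous_near (cf z Uz); exact: (open_near oU fg Uz).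
split=> [z Uz|b j].
  by apply: continuous_near (cf z Uz); exact: (open_near oU fg Uz).
have [fd fC] := df b j; split=> [z Uz|].
  exact: isrd_rderivable (isrd_near (open_near oU fg Uz) (isrd_rderive (fd _ Uz))).
apply: IH fC => z Uz.
by rewrite (isrd_val (isrd_near (open_near oU fg Uz) (isrd_rderive (fd _ Uz)))).
Qed.

Lemma CkW m U f : Ck m.+1 U f -> Ck m U f.
Proof.
elim: m f => [|m IH] f [cf df]; split=> // b j.
by have [fd fC] := df b j; split=> //; apply: IH.
Qed.

Lemma Ck_cont m U f z : Ck m U f -> U z -> {for z, continuous f}.
Proof. by case: m => [|m] [cf _]; exact: cf. Qed.

Lemma Ck_rd m U f z : Ck m.+1 U f -> U z -> rd f z.
Proof. by move=> [_ df] Uz b j; have [fd _] := df b j; exact: fd. Qed.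

(** The predicate [Ck] speaks of the total functions [rderive v f]; it is enough
    to know them on the open set [U], where any explicit formula will do. *)
Lemma Ck_intro m U f (df : bool -> 'I_n -> V -> Cplx R) : open U ->
  (forall z, U z -> {for z, continuous f}) ->
  (forall b j z, U z -> isrd f (xydir R b j) z (df b j z)) ->
  (forall b j, Ck m U (df b j)) -> Ck m.+1 U f.
Proof.
move=> oU cf fd dfC; split=> // b j; split=> [z Uz|].
  exact: isrd_rderivable (fd b j z Uz).
by apply: Ck_ext (dfC b j) => // z Uz; rewrite (isrd_val (fd b j z Uz)).
Qed.

Lemma Ck_cst m U a : open U -> Ck m U (fun=> a).
Proof.
move=> oU; elim: m a => [|m IH] a; first by split; [move=> z _; exact: cst_continuous|exact: I].
apply: (@Ck_intro _ _ _ (fun _ _ _ => 0) oU).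
- by move=> z _; exact: cst_continuous.
- by move=> b j z _; exact: isrd_cst.
by move=> b j; exact: IH.
Qed.

Lemma CkD m U f g : open U -> Ck m U f -> Ck m U g -> Ck m U (fun w => f w + g w).
Proof.
move=> oU; elim: m f g => [|m IH] f g fC gC.
  split; last exact: I.
  move=> z Uz; apply: contD; [exact: (Ck_cont fC Uz)|exact: (Ck_cont gC Uz)].
apply: (@Ck_intro _ _ _ (fun b j z => rderive (xydir R b j) f z + rderive (xydir R b j) g z) oU).
- by move=> z Uz; apply: contD; [exact: (Ck_cont fC Uz)|exact: (Ck_cont gC Uz)].
- by move=> b j z Uz; apply: isrdD; apply: rd_isrd; [exact: Ck_rd fC Uz|exact: Ck_rd gC Uz].
move=> b j; apply: IH; first by have [_ /(_ b j)[]] := fC.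
by have [_ /(_ b j)[]] := gC.
Qed.

Lemma CkN m U f : open U -> Ck m U f -> Ck m U (fun w => - f w).
Proof.
move=> oU; elim: m f => [|m IH] f fC.
  split; last exact: I.
  move=> z Uz; apply: contN; exact: (Ck_cont fC Uz).
apply: (@Ck_intro _ _ _ (fun b j z => - rderive (xydir R b j) f z) oU).
- by move=> z Uz; apply: contN; exact: (Ck_cont fC Uz).
- by move=> b j z Uz; apply: isrdN; apply: rd_isrd; exact: Ck_rd fC Uz.
by move=> b j; apply: IH; have [_ /(_ b j)[]] := fC.
Qed.

Lemma CkM m U f g : open U -> Ck m U f -> Ck m U g -> Ck m U (fun w => f w * g w).
Proof.
move=> oU; elim: m f g => [|m IH] f g fC gC.
  split; last exact: I.
  move=> z Uz; apply: contM; [exact: (Ck_cont fC Uz)|exact: (Ck_cont gC Uz)].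
apply: (@Ck_intro _ _ _ (fun b j z => rderive (xydir R b j) f z * g z + f z * rderive (xydir R b j) g z) oU).
- by move=> z Uz; apply: contM; [exact: (Ck_cont fC Uz)|exact: (Ck_cont gC Uz)].
- by move=> b j z Uz; apply: isrdM; apply: rd_isrd; [exact: Ck_rd fC Uz|exact: Ck_rd gC Uz].
move=> b j; apply: (CkD oU).
  by apply: IH; [have [_ /(_ b j)[]] := fC|exact: (CkW gC)].
by apply: IH; [exact: (CkW fC)|have [_ /(_ b j)[]] := gC].
Qed.

Lemma Ck_conj m U f : open U -> Ck m U f -> Ck m U (fun w => (f w)^*).
Proof.
move=> oU; elim: m f => [|m IH] f fC.
  split; last exact: I.
  move=> z Uz; apply: cont_conj; exact: (Ck_cont fC Uz).
apply: (@Ck_intro _ _ _ (fun b j z => (rderive (xydir R b j) f z)^*) oU).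
- move=> z Uz; apply: cont_conj; exact: (Ck_cont fC Uz).
- by move=> b j z Uz; apply: isrd_conj; apply: rd_isrd; exact: Ck_rd fC Uz.
by move=> b j; apply: IH; have [_ /(_ b j)[]] := fC.
Qed.

Lemma CkV m U f : open U -> (forall z, U z -> f z != 0) ->
  Ck m U f -> Ck m U (fun w => (f w)^-1).
Proof.
move=> oU f0; elim: m => [|m IH] fC.
  split; last exact: I.
  move=> z Uz; apply: contV; [exact: f0|exact: (Ck_cont fC Uz)].
apply: (@Ck_intro _ _ _ (fun b j z => - rderive (xydir R b j) f z * ((f z)^-1 * (f z)^-1)) oU).
- by move=> z Uz; apply: contV; [exact: f0|exact: (Ck_cont fC Uz)].
- move=> b j z Uz; rewrite -expr2 exprVn; apply: isrdV; first exact: f0.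
  by apply: rd_isrd; exact: Ck_rd fC Uz.
have fC' := CkW fC.
move=> b j; apply: CkM => //; last by apply: CkM => //; exact: IH.
by apply: CkN => //; have [_ /(_ b j)[]] := fC.
Qed.

Lemma Ck_sum m U (I : Type) (r : seq I) (P : pred I) (F : I -> V -> Cplx R) :
  open U -> (forall i, Ck m U (F i)) -> Ck m U (fun w => \sum_(i <- r | P i) F i w).
Proof.
move=> oU FC; elim: r => [|i r IH].
  by under eq_fun do rewrite big_nil; exact: Ck_cst.
under eq_fun do rewrite big_cons; by case: (P i); [exact: CkD|exact: IH].
Qed.

Lemma Ck_prod m U (I : Type) (r : seq I) (P : pred I) (F : I -> V -> Cplx R) :
  open U -> (forall i, Ck m U (F i)) -> Ck m U (fun w => \prod_(i <- r | P i) F i w).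
Proof.
move=> oU FC; elim: r => [|i r IH].
  by under eq_fun do rewrite big_nil; exact: Ck_cst.
under eq_fun do rewrite big_cons; by case: (P i); [exact: CkM|exact: IH].
Qed.

Lemma Ck_wirt m U f s j : open U -> Ck m.+1 U f -> Ck m U (wirt s j f).
Proof.
move=> oU fC.
rewrite (_ : wirt s j f = fun z => (rderive (xydir R false j) f z
   + (if s then 'i else - 'i) * rderive (xydir R true j) f z) * 2^-1).
  apply: CkM => //; last exact: Ck_cst.
  apply: CkD => //; first by have [_ /(_ false j)[]] := fC.
  by apply: CkM => //; [exact: Ck_cst|have [_ /(_ true j)[]] := fC].
by apply: funext => z; rewrite wirtE.
Qed.

(** The derivative is existentially quantified, so that it can be given by a
    closed formula. *)
Fixpoint uCk (m : nat) (psi : R -> R) : Prop :=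
  if m is m'.+1 then
    exists2 dpsi : R -> R, (forall t : R, Rder psi t (dpsi t)) & uCk m' dpsi
  else continuous psi.

Lemma uCk_cont m psi : uCk m psi -> continuous psi.
Proof. by case: m => [//|m] [dpsi dp _] t; exact: is_derive_continuous (dp t). Qed.

Lemma Ck_ucomp m U (psi : R -> R) (u : V -> R) : open U -> uCk m psi ->
  Ck m U (fun w => RC (u w)) -> Ck m U (fun w => RC (psi (u w))).
Proof.
move=> oU; have cont m' psi' : uCk m' psi' -> Ck m' U (fun w => RC (u w)) ->
    forall z, U z -> {for z, continuous (fun w => RC (psi' (u w)))}.
  move=> /uCk_cont pC uC z Uz; apply: cont_RC.
  by apply: (continuous_comp _ (pC _)); exact: (cont_Re (Ck_cont uC Uz)).
elim: m psi => [|m IH] psi pC uC; first by split; [exact: (cont 0%N _ pC uC)|exact: I].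
have [dpsi dp dpC] := pC.
apply: (@Ck_intro _ _ _ (fun b j z => RC (dpsi (u z)) * rderive (xydir R b j) (fun w => RC (u w)) z) oU).
- exact: (cont m.+1 _ pC uC).
- move=> b j z Uz.
  exact: (isrd_ucomp (dp (u z)) (rd_isrd b j (Ck_rd uC Uz))).
move=> b j; apply: (CkM oU); first exact: (IH _ dpC (CkW uC)).
by have [_ /(_ b j)[]] := uC.
Qed.

Lemma smooth_ext U f g : open U -> (forall z, U z -> f z = g z) ->
  smooth U f -> smooth U g.
Proof. by move=> oU fg fC m; exact: Ck_ext (fC m). Qed.
Lemma smooth_cont U f z : smooth U f -> U z -> {for z, continuous f}.
Proof. by move=> fC Uz; exact: (Ck_cont (fC 0%N) Uz). Qed.
Lemma smooth_rd U f z : smooth U f -> U z -> rd f z.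
Proof. by move=> fC; exact: Ck_rd (fC 1%N). Qed.
Lemma smooth_cst U a : open U -> smooth U (fun=> a).
Proof. by move=> oU m; exact: Ck_cst. Qed.
Lemma smoothD U f g : open U -> smooth U f -> smooth U g -> smooth U (fun w => f w + g w).
Proof. by move=> oU fC gC m; exact: CkD. Qed.
Lemma smoothN U f : open U -> smooth U f -> smooth U (fun w => - f w).
Proof. by move=> oU fC m; exact: CkN. Qed.
Lemma smoothM U f g : open U -> smooth U f -> smooth U g -> smooth U (fun w => f w * g w).
Proof. by move=> oU fC gC m; exact: CkM. Qed.
Lemma smooth_conj U f : open U -> smooth U f -> smooth U (fun w => (f w)^*).
Proof. by move=> oU fC m; exact: Ck_conj. Qed.
Lemma smoothV U f : open U -> (forall z, U z -> f z != 0) -> smooth U f ->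
  smooth U (fun w => (f w)^-1).
Proof. by move=> oU f0 fC m; exact: CkV. Qed.
Lemma smooth_sum U (I : Type) (r : seq I) (P : pred I) (F : I -> V -> Cplx R) :
  open U -> (forall i, smooth U (F i)) -> smooth U (fun w => \sum_(i <- r | P i) F i w).
Proof. by move=> oU FC m; apply: Ck_sum => // i; exact: FC. Qed.
Lemma smooth_prod U (I : Type) (r : seq I) (P : pred I) (F : I -> V -> Cplx R) :
  open U -> (forall i, smooth U (F i)) -> smooth U (fun w => \prod_(i <- r | P i) F i w).
Proof. by move=> oU FC m; apply: Ck_prod => // i; exact: FC. Qed.
Lemma smooth_wirt U f s j : open U -> smooth U f -> smooth U (wirt s j f).
Proof. by move=> oU fC m; exact: Ck_wirt. Qed.
Lemma smooth_ucomp U (psi : R -> R) (u : V -> R) : open U -> (forall m, uCk m psi) ->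
  smooth U (fun w => RC (u w)) -> smooth U (fun w => RC (psi (u w))).
Proof. by move=> oU pC uC m; exact: Ck_ucomp. Qed.

End Calculus.

(** * Mean value arguments: chain rule and symmetry of second derivatives *)

Section MeanValue.
Variable R : realType.

(** The increment [h] may have either sign, hence the absolute values. *)
Lemma mean_value (f df : R -> R) (h : R) :
  (forall x, `|x| <= `|h| -> Rder f x (df x)) ->
  exists2 c, `|c| <= `|h| & f h - f 0 = df c * h.
Proof.
move=> fd; have [h0|h0|->] := ltgtP h 0; last first.
- by exists 0; rewrite ?subrr ?mulr0.
- have bnd x : x \in `[0, h] -> `|x| <= `|h|.
    by rewrite in_itv /= => /andP[x0 xh]; rewrite !ger0_norm // ltW.
  have [||c c0h e] := @MVT_segment R f df 0 h (ltW h0).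
  + by move=> x xh; apply: fd; apply: bnd; exact: subset_itv_oo_cc xh.
  + apply: continuous_in_subspaceT => x; rewrite inE => /bnd xh.
    exact: (is_derive_continuous (fd x xh)).
  by exists c; [exact: bnd|rewrite e subr0].
have bnd x : x \in `[h, 0] -> `|x| <= `|h|.
  rewrite in_itv /= => /andP[x0 xh].
  by rewrite ler0_norm // ler0_norm ?lerN2 // ltW.
have [||c c0h e] := @MVT_segment R f df h 0 (ltW h0).
- by move=> x xh; apply: fd; apply: bnd; exact: subset_itv_oo_cc xh.
- apply: continuous_in_subspaceT => x; rewrite inE => /bnd xh.
  exact: (is_derive_continuous (fd x xh)).
exists c; first exact: bnd.
by rewrite -opprB e sub0r mulrN opprK.
Qed.

(** The difference quotient of [chi * c] at a zero of [c] only sees the limit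
    of [chi]. *)
Lemma Rder_mul_zero (chi c F : R -> R) (l c' : R) :
  chi @ (0 : R) --> l -> c 0 = 0 -> Rder c 0 c' ->
  F 0 = 0 -> (\forall t \near (0 : R), F t = chi t * c t) -> Rder F 0 (l * c').
Proof.
move=> chil c0 cd F0 FE.
have [cder cval] := cd.
have quot : (fun h : R => h^-1 *: (F (h *: 1 + 0) - F 0)) @ (0 : R)^' --> l * c'.
  have cq : (fun h : R => h^-1 *: (c (h *: 1 + 0) - c 0)) @ (0 : R)^' --> c'.
    by rewrite -cval; exact: cder.
  have chil' : chi @ (0 : R)^' --> l.
    by move=> A /chil; exact: nbhs_dnbhs.
  have H := cvgM chil' cq.
  have FE' : \forall t \near (0 : R)^', F t = chi t * c t.
    exact: nbhs_dnbhs FE.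
  suff E : \forall t \near (0 : R)^', (chi \* (fun h : R => h^-1 *: (c (h *: 1 + 0) - c 0))) t
      = t^-1 *: (F (t *: 1 + 0) - F 0).
    by move=> A /H HA; apply: filterS2 E HA => t; rewrite /= => ->.
  apply: filterS FE' => t FEt; rewrite /= F0 c0 !subr0 addr0.
  have -> : t *: (1 : R) = t by rewrite /GRing.scale /= mulr1.
  by rewrite FEt /GRing.scale /=; ring.
split; first by apply/cvg_ex; exists (l * c').
exact: (cvg_lim _ quot).
Qed.

End MeanValue.

Section ChainRule.
Variables (R : realType) (n : nat).
Notation V := 'rV[Cplx R]_n.

(** Continuity of [(w, s) |-> w + s e] at [(z, 0)]: moving by a small [s] is
    harmless uniformly over a neighborhood of [z]. *)
Lemma near_box (z e : V) (N : set V) : nbhs z N ->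
  exists2 P : set V, nbhs z P &
  exists2 d : R, 0 < d &
    forall w s, P w -> `|s| <= d -> N (w + RC s *: e).
Proof.
move=> Nz.
have H : (fun p : V * R => p.1 + RC p.2 *: e) @ (z, 0 : R) --> z + RC 0 *: e.
  apply: cvgD; first exact: cvg_fst.
  apply: cvgZr_tmp.
  exact: (continuous_cvg _ (@continuous_RC R 0) cvg_snd).
rewrite RC0 scale0r addr0 in H.
have [[P Q] [/= Pz Q0] PQ] := H _ Nz.
exists P => //; move/nbhs_ballP: Q0 => [d /= d0 dQ].
exists (d / 2) => [|w s Pw sd]; first by rewrite divr_gt0.
apply: (PQ (w, s)); split => //=; apply: dQ.
rewrite -ball_normE /= sub0r normrN; apply: le_lt_trans sd _.
by rewrite ltr_pdivrMr // ltr_pMr // ltr1n.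
Qed.

Definition Dr (phi : V -> R) (v z : V) (d : R) :=
  Rder (fun t => phi (z + RC t *: v)) 0 d.

Lemma Dr_shift phi v z t d : Dr phi v (z + RC t *: v) d ->
  Rder (fun t => phi (z + RC t *: v)) t d.
Proof.
move=> H; have sh : Rder (fun s : R => s - t) t 1.
  apply: (is_derive_eqf (is_deriveB (is_derive_id _ _) (is_derive_cst t _ _))).
    by [].
  by rewrite subr0.
have H' : Rder (fun s => phi (z + RC t *: v + RC s *: v)) (t - t) d by rewrite subrr.
have H2 := @is_derive1_comp R (fun s => phi (z + RC t *: v + RC s *: v))
  (fun s : R => s - t) t d 1 H' sh.
apply: (is_derive_eqf H2); last by rewrite mulr1.
apply: funext => s /=; rewrite -addrA -scalerDl -RCD.
by rewrite [t + _]addrC subrK.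
Qed.

Lemma mean_value_line (phi dphi : V -> R) (v z : V) (h : R) :
  (forall x : R, `|x| <= `|h| -> Dr phi v (z + RC x *: v) (dphi (z + RC x *: v))) ->
  exists2 c : R, `|c| <= `|h| &
    phi (z + RC h *: v) - phi z = dphi (z + RC c *: v) * h.
Proof.
move=> H; have [x xh|c ch e] := @mean_value R (fun x => phi (z + RC x *: v))
    (fun x => dphi (z + RC x *: v)) h; first exact: (Dr_shift (H x xh)).
by exists c => //; rewrite -e RC0 scale0r addr0.
Qed.

Lemma Dr_translate (phi : V -> R) (v z a : V) d :
  Dr phi v (z + a) d -> Dr (fun w => phi (w + a)) v z d.
Proof.
move=> H; apply: (is_derive_eqf H) => //.
by apply: funext => t; rewrite addrAC.
Qed.

(** One step of the chain rule: by the mean value theorem, moving from [p t]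
    by [c t] in the direction [e] changes [phi] by [c t] times the value of the
    partial derivative at a point that tends to [z]. *)
Lemma chain_step (U : set V) (phi psi : V -> R) (e z : V) (p : R -> V)
    (c : R -> R) (c' : R) :
  open U -> U z -> (forall w, U w -> Dr phi e w (psi w)) ->
  {for z, continuous psi} ->
  p @ (0 : R) --> z -> c 0 = 0 -> Rder c 0 c' ->
  Rder (fun t => phi (p t + RC (c t) *: e) - phi (p t)) 0 (psi z * c').
Proof.
move=> oU Uz phid psic pz c0 cd.
have cc := is_derive_continuous cd.
pose diff t := phi (p t + RC (c t) *: e) - phi (p t).
pose chi t := if c t == 0 then psi z else diff t / c t.
have diff0 t : c t = 0 -> diff t = 0.
  by move=> ct; rewrite /diff ct RC0 scale0r addr0 subrr.
have diffE t : diff t = chi t * c t.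
  rewrite /chi; have [ct|ct] := eqVneq (c t) 0; first by rewrite diff0 // ct mulr0.
  by rewrite divfK.
apply: (Rder_mul_zero _ c0 cd (diff0 0 c0) (@nearW _ (nbhs (0 : R)) _ _ diffE)).
apply/(@cvgrPdist_lt _ _ _ (nbhs (0 : R)) _) => eps eps0.
have Npsi : nbhs z (fun w => U w /\ `|psi z - psi w| < eps).
  have psic' := cont_near eps0 psic.
  exact: (@filterI _ (nbhs z) _ _ _ (open_nbhs_nbhs (conj oU Uz)) psic').
have [P Pz [d d0 Pd]] := near_box e Npsi.
have pP : \forall t \near (0 : R), P (p t) := pz _ Pz.
have cP : \forall t \near (0 : R), `|c t| < d.
  by apply: filterS (cont_near d0 cc) => t; rewrite c0 sub0r normrN.
apply: filterS2 pP cP => t Pt ct; rewrite /chi.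
have [_|ct0] := eqVneq (c t) 0; first by rewrite subrr normr0.
have [s sc|xi xic e1] := @mean_value_line phi psi e (p t) (c t).
  by apply: phid; have [] := Pd (p t) s Pt (le_trans sc (ltW ct)).
have [_ close] := Pd (p t) xi Pt (le_trans xic (ltW ct)).
have -> : diff t = psi (p t + RC xi *: e) * c t.
  by rewrite -e1.
by rewrite mulfK.
Qed.

(** The displacements [c i] are added one at a time, each by [chain_step]. *)
Lemma chain_seq (U : set V) (phi : V -> R) (I : Type) (s : seq I)
    (e : I -> V) (psi : I -> V -> R) (z : V) (c : I -> R -> R) (c' : I -> R) :
  open U -> U z -> (forall i w, U w -> Dr phi (e i) w (psi i w)) ->
  (forall i, {for z, continuous (psi i)}) ->
  (forall i, c i 0 = 0) -> (forall i, Rder (c i) 0 (c' i)) ->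
  Rder (fun t => phi (z + \sum_(i <- s) RC (c i t) *: e i)) 0
    (\sum_(i <- s) psi i z * c' i).
Proof.
move=> oU Uz phid psic c0 cd.
have pz (r : seq I) : (fun t => z + \sum_(i <- r) RC (c i t) *: e i) @ (0 : R) --> z.
  elim: r => [|i r IH].
    rewrite (_ : (fun t => _) = fun=> z); first exact: cvg_cst.
    by apply: funext => t; rewrite big_nil addr0.
  rewrite (_ : (fun t => _) = fun t =>
    (z + \sum_(i <- r) RC (c i t) *: e i) + RC (c i t) *: e i); last first.
    by apply: funext => t; rewrite big_cons addrCA addrC.
  have H : RC (c i t) *: e i @[t --> (0 : R)] --> RC (c i 0) *: e i.
    apply: cvgZr_tmp; apply: (cont_RC (is_derive_continuous (cd i))).
  rewrite c0 RC0 scale0r in H.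
  have D := cvgD IH H; rewrite addr0 in D; exact: D.
elim: s => [|i s IH].
  rewrite big_nil; apply: (is_derive_eqf (is_derive_cst (phi z) _ _)); last by [].
  by apply: funext => t; rewrite big_nil addr0.
have St := chain_step oU Uz (phid i) (psic i) (pz s) (c0 i) (cd i).
rewrite big_cons addrC; apply: (is_derive_eqf (is_deriveD IH St)) => //.
apply: funext => t; rewrite big_cons.
by rewrite [X in X + _ = _]/= addrC subrK addrAC -addrA.
Qed.

(** Clairaut--Schwarz: both mixed derivatives are limits of the same second
    difference quotient. *)
Lemma Dr_symmetric (U : set V) (phi phiu phiv phiuv phivu : V -> R) (u v z : V) :
  open U -> U z ->
  (forall w, U w -> Dr phi u w (phiu w)) ->
  (forall w, U w -> Dr phi v w (phiv w)) ->
  (forall w, U w -> Dr phiu v w (phiuv w)) ->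
  (forall w, U w -> Dr phiv u w (phivu w)) ->
  {for z, continuous phiuv} -> {for z, continuous phivu} ->
  phiuv z = phivu z.
Proof.
move=> oU Uz du dv duv dvu cuv cvu.
apply/eqP; rewrite -subr_eq0; apply: contraT => neq.
pose eps := `|phiuv z - phivu z| / 2.
have eps0 : 0 < eps by rewrite divr_gt0 // normr_gt0.
pose N w := U w /\ (`|phiuv z - phiuv w| < eps /\ `|phivu z - phivu w| < eps).
have Nz : nbhs z N.
  exact: (@filterI _ (nbhs z) _ _ _ (open_nbhs_nbhs (conj oU Uz))
    (@filterI _ (nbhs z) _ _ _ (cont_near eps0 cuv) (cont_near eps0 cvu))).
have [P Pz [d d0 Pd]] := near_box v Nz.
have [Q Qz [d' d'0 Qd]] := near_box u Pz.
pose h := Num.min d d'.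
have h0 : 0 < h by rewrite lt_min d0.
have hd (s : R) : `|s| <= `|h| -> `|s| <= d.
  by rewrite (gtr0_norm h0) => /le_trans; apply; rewrite ge_min lexx.
have hd' (s : R) : `|s| <= `|h| -> `|s| <= d'.
  by rewrite (gtr0_norm h0) => /le_trans; apply; rewrite ge_min lexx orbT.
have box (s t : R) : `|s| <= `|h| -> `|t| <= `|h| -> N (z + RC s *: u + RC t *: v).
  by move=> sh th; apply: (Pd _ _ _ (hd _ th)); apply: (Qd _ _ _ (hd' _ sh)); exact: (nbhs_singleton Qz).
have zero0 : `|0 : R| <= `|h| by rewrite normr0 normr_ge0.
have box0 (s : R) : `|s| <= `|h| -> U (z + RC s *: u).
  by move=> sh; have [] := box s 0 sh zero0; rewrite RC0 scale0r addr0.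
have swap s t : z + RC s *: u + RC t *: v = z + RC t *: v + RC s *: u.
  by rewrite addrAC.
have box1 (t : R) : `|t| <= `|h| -> U (z + RC t *: v).
  by move=> th; have [] := box 0 t zero0 th; rewrite RC0 scale0r addr0.
have [x xh|s sh e1] := @mean_value_line (fun w => phi (w + RC h *: v) - phi w)
    (fun w => phiu (w + RC h *: v) - phiu w) u z h.
  apply: is_deriveB; last exact: (du _ (box0 x xh)).
  by apply: Dr_translate; apply: du; have [] := box x h xh (lexx _).
have [x xh|t th e2] := @mean_value_line phiu phiuv v (z + RC s *: u) h.
  by apply: duv; have [] := box s x sh xh.
have [x xh|t' th' e3] := @mean_value_line (fun w => phi (w + RC h *: u) - phi w)
    (fun w => phiv (w + RC h *: u) - phiv w) v z h.
  apply: is_deriveB; last exact: (dv _ (box1 x xh)).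
  by apply: Dr_translate; apply: dv; rewrite -swap; have [] := box h x (lexx _) xh.
have [x xh|s' sh' e4] := @mean_value_line phiv phivu u (z + RC t' *: v) h.
  by apply: dvu; rewrite -swap; have [] := box x t' xh th'.
have hn0 : h != 0 by rewrite gt_eqF.
have exch (a b c e : R) : a - b - (c - e) = a - c - (b - e) by ring.
have E1 := etrans e1 (congr1 (fun x => x * h) e2).
have E3 := etrans e3 (congr1 (fun x => x * h) e4).
have E13 := etrans (congr1 (fun w => phi w - phi (z + RC h *: u) - (phi (z + RC h *: v) - phi z))
  (swap h h)) (exch _ _ _ _).
have key := mulIf hn0 (mulIf hn0 (etrans (esym E1) (etrans E13 E3))).
have [_ [c1 _]] := box s t sh th.
have bx : N (z + RC t' *: v + RC s' *: u) by rewrite -(swap s' t'); exact: box.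
have [_ [_ c2]] := bx.
have : `|phiuv z - phivu z| < eps + eps.
  rewrite -key in c2; apply: le_lt_trans (ltrD c1 c2).
  rewrite -[X in `|X|](subrKA (phiuv (z + RC s *: u + RC t *: v))).
  by rewrite [X in _ <= _ + X]distrC; apply: ler_normD.
by rewrite /eps -splitr ltxx.
Qed.

Lemma isrd_symmetric (U : set V) (f fu fv fuv fvu : V -> Cplx R) (u v z : V) :
  open U -> U z ->
  (forall w, U w -> isrd f u w (fu w)) -> (forall w, U w -> isrd f v w (fv w)) ->
  (forall w, U w -> isrd fu v w (fuv w)) -> (forall w, U w -> isrd fv u w (fvu w)) ->
  {for z, continuous fuv} -> {for z, continuous fvu} -> fuv z = fvu z.
Proof.
move=> oU Uz du dv duv dvu cuv cvu; apply: Cplx_ext.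
  apply: (Dr_symmetric oU Uz (phiu := fun w => Re (fu w)) (phiv := fun w => Re (fv w))
    (phi := fun w => Re (f w)) (u := u) (v := v) (phiuv := fun w => Re (fuv w))
    (phivu := fun w => Re (fvu w))).
  - by move=> w /du[].
  - by move=> w /dv[].
  - by move=> w /duv[].
  - by move=> w /dvu[].
  - exact: cont_Re cuv.
  - exact: cont_Re cvu.
apply: (Dr_symmetric oU Uz (phiu := fun w => Im (fu w)) (phiv := fun w => Im (fv w))
    (phi := fun w => Im (f w)) (u := u) (v := v) (phiuv := fun w => Im (fuv w))
    (phivu := fun w => Im (fvu w))).
- by move=> w /du[].
- by move=> w /dv[].
- by move=> w /duv[].
- by move=> w /dvu[].
- exact: cont_Im cuv.
- exact: cont_Im cvu.
Qed.

Lemma rderive_symmetric (U : set V) (f : V -> Cplx R) (b b' : bool) (j k : 'I_n) z :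
  open U -> U z -> Ck 2 U f ->
  rderive (xydir R b' k) (rderive (xydir R b j) f) z
  = rderive (xydir R b j) (rderive (xydir R b' k) f) z.
Proof.
move=> oU Uz fC; have [_ df] := fC.
have d1 b0 j0 w : U w -> isrd f (xydir R b0 j0) w (rderive (xydir R b0 j0) f w).
  by move=> Uw; apply: isrd_rderive; have [fd _] := df b0 j0; exact: fd.
have d2 b0 j0 b1 j1 w : U w -> isrd (rderive (xydir R b0 j0) f) (xydir R b1 j1) w
    (rderive (xydir R b1 j1) (rderive (xydir R b0 j0) f) w).
  move=> Uw; apply: isrd_rderive; have [_ [_ /(_ b1 j1)[fd _]]] := df b0 j0.
  exact: fd.
have c2 b0 j0 b1 j1 : {for z, continuous (rderive (xydir R b1 j1) (rderive (xydir R b0 j0) f))}.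
  have [_ [_ /(_ b1 j1)[_ [fc _]]]] := df b0 j0; exact: fc.
exact: (isrd_symmetric oU Uz (d1 b j) (d1 b' k) (d2 b j b' k) (d2 b' k b j) (c2 b j b' k) (c2 b' k b j)).
Qed.

Lemma isrd_lin (f g : V -> Cplx R) (c k : Cplx R) (v z : V) a b :
  isrd f v z a -> isrd g v z b ->
  isrd (fun w => (f w + c * g w) * k) v z ((a + c * b) * k).
Proof.
move=> fa gb; have := isrdM (isrdD fa (isrdM (isrd_cst c v z) gb)) (isrd_cst k v z).
by rewrite mul0r add0r mulr0 addr0.
Qed.

Lemma wirt_symmetric (U : set V) (f : V -> Cplx R) s s' (j k : 'I_n) z :
  open U -> U z -> smooth U f ->
  wirt s' k (wirt s j f) z = wirt s j (wirt s' k f) z.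
Proof.
move=> oU Uz fC.
have rdr b i : rd (rderive (xydir R b i) f) z.
  by have [_ /(_ b i)[_ fC']] := fC 2%N; exact: (@Ck_rd R n 0 U _ z fC' Uz).
have E s0 s1 j0 j1 : wirt s1 j1 (wirt s0 j0 f) z =
   (rderive (xydir R false j1) (rderive (xydir R false j0) f) z
    + (if s0 then 'i else - 'i) * rderive (xydir R false j1) (rderive (xydir R true j0) f) z
    + (if s1 then 'i else - 'i) * (rderive (xydir R true j1) (rderive (xydir R false j0) f) z
       + (if s0 then 'i else - 'i) * rderive (xydir R true j1) (rderive (xydir R true j0) f) z)) / 2 / 2.
  have D b : isrd (wirt s0 j0 f) (xydir R b j1) z ((rderive (xydir R b j1) (rderive (xydir R false j0) f) z
    + (if s0 then 'i else - 'i) * rderive (xydir R b j1) (rderive (xydir R true j0) f) z) / 2).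
    have -> : wirt s0 j0 f = fun w => (rderive (xydir R false j0) f w
       + (if s0 then 'i else - 'i) * rderive (xydir R true j0) f w) * 2^-1.
      by apply: funext => w; exact: wirtE.
    exact: (isrd_lin _ _ (rd_isrd b j1 (rdr false j0)) (rd_isrd b j1 (rdr true j0))).
  by rewrite (wirt_isrd s1 (D false) (D true)) mulrA -mulrDl.
have S b b' := rderive_symmetric b b' j k oU Uz (fC 2%N).
have alg (a b c d a' b' c' d' i i' : Cplx R) :
    a = a' -> b = c' -> c = b' -> d = d' ->
    (a + i * b + i' * (c + i * d)) / 2 / 2
    = (a' + i' * b' + i * (c' + i' * d')) / 2 / 2.
  by move=> -> -> -> ->; congr (_ / _ / _); ring.
exact: (etrans (E s s' j k) (etrans (alg _ _ _ _ _ _ _ _ _ _ (S false false) (S true false)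
  (S false true) (S true true)) (esym (E s' s k j)))).
Qed.

End ChainRule.

(** ** Composition with a map into [C^m] *)

Section Composition.
Variable R : realType.

Lemma row_xydir (m : nat) (x : 'rV[Cplx R]_m) :
  x = \sum_(p : bool * 'I_m)
        RC (if p.1 then Im (x 0 p.2) else Re (x 0 p.2)) *: xydir R p.1 p.2.
Proof.
rewrite -(pair_bigA _ (fun (b : bool) j =>
  RC (if b then Im (x 0 j) else Re (x 0 j)) *: xydir R b j)) big_bool /=.
rewrite {1}[x]row_sum_delta -big_split; apply: eq_bigr => j _ /=.
rewrite !xydirE scale1r scalerA -scalerDl; congr (_ *: _).
by rewrite [LHS]cplxE addrC mulrC.
Qed.

Lemma cont_row (m : nat) (T : topologicalType) (phi : T -> 'rV[Cplx R]_m) (z : T) :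
  (forall j, {for z, continuous (fun w => phi w 0 j)}) -> {for z, continuous phi}.
Proof.
move=> H; rewrite /prop_for.
rewrite (_ : phi = fun w => \sum_(j <- index_enum 'I_m) phi w 0 j *: delta_mx 0 j); last first.
  by apply: funext => w; exact: row_sum_delta.
elim: (index_enum 'I_m) => [|j s IH].
  rewrite (_ : (fun w => _) = fun=> 0); first exact: cst_continuous.
  by apply: funext => w; rewrite big_nil.
rewrite (_ : (fun w => _) = fun w => phi w 0 j *: delta_mx 0 j
  + \sum_(j <- s) phi w 0 j *: delta_mx 0 j); last by apply: funext => w; rewrite big_cons.
exact: (cvgD (cvgZr_tmp (a := delta_mx 0 j) (H j)) IH).
Qed.

(** The differential of [f] in the direction [a d/dz^j], in complex and in real
    terms. *)
Lemma wirt_dir_sum (m : nat) (f : 'rV[Cplx R]_m -> Cplx R) (j : 'I_m) (w : 'rV[Cplx R]_m) (a : Cplx R) :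
  wirt false j f w * a + wirt true j f w * a^*
  = rderive (xydir R true j) f w * RC (Im a) + rderive (xydir R false j) f w * RC (Re a).
Proof.
rewrite !wirtE; move: (rderive _ f w) (rderive _ f w) => x y.
have -> : a^* = RC (Re a) - 'i * RC (Im a).
  rewrite conjE iE; apply: Cplx_ext; rewrite ?(ReD, ImD, ReN, ImN, ReM, ImM) /=; ring.
rewrite {1}[a]cplxE; move: (RC (Re a)) (RC (Im a)) => p q.
have ii : 'i * 'i = -1 :> Cplx R by rewrite -expr2 sqrCi.
transitivity (y * p - ('i * 'i) * (x * q)); first by rewrite /=; field.
by rewrite ii mulN1r opprK addrC.
Qed.

Section Comp.
Variables (n m : nat) (phi : 'rV[Cplx R]_n -> 'rV[Cplx R]_m).

(** The real chain rule, along the [2 m] real coordinates of [phi], recombined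
    by [wirt_dir_sum] into the two Wirtinger derivatives of [f]. *)
Lemma isrd_comp (U : set 'rV[Cplx R]_m) (f : 'rV[Cplx R]_m -> Cplx R)
    (v z : 'rV[Cplx R]_n) (a : 'I_m -> Cplx R) :
  open U -> U (phi z) -> Ck 1 U f ->
  (forall j, isrd (fun w => phi w 0 j) v z (a j)) ->
  isrd (fun w => f (phi w)) v z
    (\sum_j (wirt false j f (phi z) * a j + wirt true j f (phi z) * (a j)^*)).
Proof.
move=> oU Uz fC phid.
pose c (p : bool * 'I_m) t := let x := phi (z + RC t *: v) 0 p.2 - phi z 0 p.2 in
  if p.1 then Im x else Re x.
pose c' (p : bool * 'I_m) := if p.1 then Im (a p.2) else Re (a p.2).
have c0 p : c p 0 = 0.
  by rewrite /c RC0 scale0r addr0 subrr; case: p.1.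
have cd p : Rder (c p) 0 (c' p).
  have H := isrdD (phid p.2) (isrd_cst (- phi z 0 p.2) v z).
  rewrite addr0 in H; have [H1 H2] := H.
  by rewrite /c /c'; case: p.1; [exact: H2|exact: H1].
have phiE t : phi (z + RC t *: v)
    = phi z + \sum_(p : bool * 'I_m) RC (c p t) *: xydir R p.1 p.2.
  rewrite -[LHS](subrK (phi z)) addrC [X in _ + X = _]row_xydir.
  by congr (_ + _); apply: eq_bigr => p _; rewrite /c !mxE.
have fd p w : U w -> isrd f (xydir R p.1 p.2) w (rderive (xydir R p.1 p.2) f w).
  by move=> Uw; exact: (rd_isrd _ _ (Ck_rd fC Uw)).
have fc (p : bool * 'I_m) : {for phi z, continuous (rderive (xydir R p.1 p.2) f)}.
  by have [_ /(_ p.1 p.2)[_ [dfc _]]] := fC; exact: (dfc _ Uz).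
have -> : \sum_j (wirt false j f (phi z) * a j + wirt true j f (phi z) * (a j)^*)
    = \sum_(p : bool * 'I_m) rderive (xydir R p.1 p.2) f (phi z) * RC (c' p).
  rewrite -(pair_bigA _ (fun (b : bool) j =>
    rderive (xydir R b j) f (phi z) * RC (c' (b, j)))) big_bool -big_split.
  by apply: eq_bigr => j _; rewrite wirt_dir_sum.
split.
  have H := @chain_seq R m U (fun w => Re (f w)) _ (index_enum (bool * 'I_m)%type)
    (fun p => xydir R p.1 p.2) (fun p w => Re (rderive (xydir R p.1 p.2) f w)) (phi z) c c'
    oU Uz (fun p w Uw => (fd p w Uw).1) (fun p => cont_Re (fc p)) c0 cd.
  apply: (is_derive_eqf H); first by apply: funext => t; rewrite -phiE.
  by rewrite Re_sum; apply: eq_bigr => p _; rewrite ReM ReRC ImRC mulr0 subr0.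
have H := @chain_seq R m U (fun w => Im (f w)) _ (index_enum (bool * 'I_m)%type)
  (fun p => xydir R p.1 p.2) (fun p w => Im (rderive (xydir R p.1 p.2) f w)) (phi z) c c'
  oU Uz (fun p w Uw => (fd p w Uw).2) (fun p => cont_Im (fc p)) c0 cd.
apply: (is_derive_eqf H); first by apply: funext => t; rewrite -phiE.
by rewrite Im_sum; apply: eq_bigr => p _; rewrite ImM ReRC ImRC mulr0 add0r.
Qed.

Lemma rd_comp (U : set 'rV[Cplx R]_m) (f : 'rV[Cplx R]_m -> Cplx R) (z : 'rV[Cplx R]_n) :
  open U -> U (phi z) -> Ck 1 U f -> (forall j, rd (fun w => phi w 0 j) z) ->
  rd (fun w => f (phi w)) z.
Proof.
move=> oU Uz fC phid b k.
exact: (isrd_rderivable (isrd_comp oU Uz fC (fun j => rd_isrd b k (phid j)))).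
Qed.

Lemma wirt_comp (U : set 'rV[Cplx R]_m) (f : 'rV[Cplx R]_m -> Cplx R) (z : 'rV[Cplx R]_n) s k :
  open U -> U (phi z) -> Ck 1 U f -> (forall j, rd (fun w => phi w 0 j) z) ->
  wirt s k (fun w => f (phi w)) z =
  \sum_j (wirt false j f (phi z) * wirt s k (fun w => phi w 0 j) z
          + wirt true j f (phi z) * (wirt (~~ s) k (fun w => phi w 0 j) z)^*).
Proof.
move=> oU Uz fC phid.
rewrite (wirt_isrd s (isrd_comp oU Uz fC (fun j => rd_isrd false k (phid j)))
  (isrd_comp oU Uz fC (fun j => rd_isrd true k (phid j)))).
rewrite mulr_sumr -big_split mulr_suml; apply: eq_bigr => j _.
rewrite (wirtE s) (wirtE (~~ s)).
set A := wirt false j f _; set B := wirt true j f _.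
set x := rderive _ _ z; set y := rderive _ _ z; clearbody A B x y.
have conjhalf (c : Cplx R) : ((x + c * y) / 2)^* = (x^* + c^* * y^*) / 2.
  by rewrite rmorphM fmorphV rmorph_nat rmorphD rmorphM.
have ci : (if ~~ s then 'i else - 'i : Cplx R)^* = if s then 'i else - 'i.
  by case: s; rewrite ?rmorphN /= conj_i ?opprK.
rewrite conjhalf ci.
set i := (if s then _ else _); clearbody i; by move: (x^*) (y^*) => x' y' /=; field.
Qed.

Lemma Ck_comp r (U' : set 'rV[Cplx R]_n) (U : set 'rV[Cplx R]_m) (f : 'rV[Cplx R]_m -> Cplx R) :
  open U -> open U' -> (forall z, U' z -> U (phi z)) -> smooth U f ->
  (forall j, smooth U' (fun w => phi w 0 j)) -> Ck r U' (fun w => f (phi w)).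
Proof.
move=> oU oU' sub fC phiC.
have cf g z : smooth U g -> U' z -> {for z, continuous (fun w => g (phi w))}.
  move=> gC Uz; apply: (continuous_comp (g := g)); last exact: (smooth_cont gC (sub _ Uz)).
  by apply: cont_row => j; exact: (smooth_cont (phiC j) Uz).
elim: r f fC => [|r IH] f fC; first by split; [move=> z; exact: (cf f z fC)|exact: I].
apply: (@Ck_intro _ _ _ _ _ (fun b k z => \sum_j (wirt false j f (phi z) * rderive (xydir R b k) (fun w => phi w 0 j) z
   + wirt true j f (phi z) * (rderive (xydir R b k) (fun w => phi w 0 j) z)^*)) oU').
- by move=> z; exact: (cf f z fC).
- move=> b k z Uz; apply: (isrd_comp oU (sub _ Uz) (fC 1%N)) => j.
  exact: (rd_isrd b k (smooth_rd (phiC j) Uz)).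
move=> b k; apply: (Ck_sum _ _ oU') => j.
have dphi : Ck r U' (rderive (xydir R b k) (fun w => phi w 0 j)).
  by have [_ /(_ b k)[_]] := phiC j r.+1.
apply: (CkD oU'); apply: (CkM oU').
- exact: (IH _ (smooth_wirt false j oU fC)).
- exact: dphi.
- exact: (IH _ (smooth_wirt true j oU fC)).
- exact: (Ck_conj oU' dphi).
Qed.

Lemma smooth_comp (U' : set 'rV[Cplx R]_n) (U : set 'rV[Cplx R]_m) (f : 'rV[Cplx R]_m -> Cplx R) :
  open U -> open U' -> (forall z, U' z -> U (phi z)) -> smooth U f ->
  (forall j, smooth U' (fun w => phi w 0 j)) -> smooth U' (fun w => f (phi w)).
Proof. by move=> oU oU' sub fC phiC r; exact (Ck_comp r oU oU' sub fC phiC). Qed.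

End Comp.
End Composition.

(** * Curvature of matrix-valued metrics *)

(** The matrix identity behind the tensoriality of the curvature under a change
    of frame [H' = A H B]. *)
Lemma frame_change_alg (F : fieldType) r (a b h da dh dbh ddh db : 'M[F]_r) :
  a \in unitmx -> b \in unitmx -> h \in unitmx ->
  - ((da *m dbh + a *m ddh) *m b + (da *m h + a *m dh) *m db)
  + (da *m h + a *m dh) *m b *m invmx (a *m h *m b) *m (a *m dbh *m b + a *m h *m db)
  = a *m (- ddh + dh *m invmx h *m dbh) *m b.
Proof.
move=> au bu hu.
have inv : invmx (a *m h *m b) = invmx b *m invmx h *m invmx a.
  have ahbu : a *m h *m b \in unitmx by rewrite !unitmx_mul au hu bu.
  apply: (can_inj (mulKmx ahbu)); rewrite mulmxV // !mulmxA.
  by rewrite -[a *m h *m b *m _]mulmxA mulmxV // mulmx1 -[a *m h *m _]mulmxA mulmxV // mulmx1 mulmxV.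
rewrite inv.
have -> : (da *m h + a *m dh) *m b *m (invmx b *m invmx h *m invmx a)
    = (da + a *m dh *m invmx h) *m invmx a.
  rewrite !mulmxA -[_ *m b *m invmx b]mulmxA mulmxV // mulmx1.
  by rewrite !mulmxDl -!mulmxA mulKVmx // !mulmxA.
have -> : (da + a *m dh *m invmx h) *m invmx a *m (a *m dbh *m b + a *m h *m db)
    = (da + a *m dh *m invmx h) *m (dbh *m b + h *m db).
  by rewrite -[in LHS]mulmxA mulmxDr !mulmxA mulVmx // !mul1mx.
rewrite !mulmxDl !mulmxDr !mulmxDl !mulmxN !mulNmx !mulmxA.
have -> : a *m dh *m invmx h *m h *m db = a *m dh *m db.
  by rewrite -[_ *m invmx h *m h]mulmxA mulVmx // mulmx1.
set x1 := da *m dbh *m b; set x2 := a *m ddh *m b; set x3 := da *m h *m db.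
set x4 := a *m dh *m db; set x5 := a *m dh *m invmx h *m dbh *m b.
have -> : x1 + x2 + (x3 + x4) = (x1 + x3 + x4) + x2.
  by rewrite -!addrA; congr (_ + _); rewrite addrC -!addrA.
have -> : x1 + x3 + (x5 + x4) = (x1 + x3 + x4) + x5 by rewrite (addrC x5) addrA.
by rewrite opprD addrACA addNr add0r.
Qed.

Lemma frame_alg1 (F : fieldType) r (a b h da x y : 'M[F]_r) : da = 0 ->
  (da *m h + a *m x) *m b + y = a *m x *m b + y.
Proof. by move=> ->; rewrite mul0mx add0r. Qed.

Lemma frame_alg3 (F : fieldType) r (x b y z : 'M[F]_r) : b = 0 ->
  x *m z + y *m b = x *m z.
Proof. by move=> ->; rewrite mulmx0 addr0. Qed.

Section MatrixCalculus.
Variables (R : realType) (n : nat).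
Notation V := 'rV[Cplx R]_n.

Definition mw p q (s : bool) (j : 'I_n) (A : V -> 'M[Cplx R]_(p, q)) (z : V) :
    'M[Cplx R]_(p, q) :=
  \matrix_(a, b) wirt s j (fun w => A w a b) z.

Definition mrd p q (A : V -> 'M[Cplx R]_(p, q)) z := forall a b, rd (fun w => A w a b) z.
Definition msm p q (U : set V) (A : V -> 'M[Cplx R]_(p, q)) :=
  forall a b, smooth U (fun w => A w a b).

Lemma msm_mrd p q U (A : V -> 'M[Cplx R]_(p, q)) z : msm U A -> U z -> mrd A z.
Proof. by move=> AC Uz a b; exact: (smooth_rd (AC a b) Uz). Qed.

Lemma smooth_eqf (U : set V) (f g : V -> Cplx R) : smooth U f -> f = g -> smooth U g.
Proof. by move=> ? <-. Qed.

Lemma msm_mul p q r U (A : V -> 'M[Cplx R]_(p, q)) (B : V -> 'M[Cplx R]_(q, r)) :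
  open U -> msm U A -> msm U B -> msm U (fun w => A w *m B w).
Proof.
move=> oU AC BC a b.
have H : smooth U (fun w => \sum_c A w a c * B w c b).
  by apply: (smooth_sum _ _ oU) => c; exact: (smoothM oU (AC a c) (BC c b)).
by apply: (smooth_eqf H); apply: funext => w; rewrite mxE.
Qed.

Lemma msm_mw p q U s j (A : V -> 'M[Cplx R]_(p, q)) : open U -> msm U A -> msm U (mw s j A).
Proof.
move=> oU AC a b; apply: (smooth_eqf (smooth_wirt s j oU (AC a b))).
by apply: funext => w; rewrite mxE.
Qed.

Lemma msm_det r U (A : V -> 'M[Cplx R]_r) : open U -> msm U A ->
  smooth U (fun w => \det (A w)).
Proof.
move=> oU AC; rewrite /determinant.
apply: (smooth_sum _ _ oU) => s; apply: (smoothM oU); first exact: smooth_cst.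
by apply: (smooth_prod _ _ oU) => i; exact: AC.
Qed.

Lemma msm_inv r U (A : V -> 'M[Cplx R]_r) : open U -> msm U A ->
  (forall z, U z -> A z \in unitmx) -> msm U (fun w => invmx (A w)).
Proof.
move=> oU AC Au a b.
have dC : smooth U (fun w => (\det (A w))^-1).
  apply: (smoothV oU) (msm_det oU AC) => z /Au.
  by rewrite unitmxE unitfE.
have adjC : smooth U (fun w => \adj (A w) a b).
  have H : smooth U (fun w => (-1) ^+ (b + a) * \det (row' b (col' a (A w)))).
    apply: (smoothM oU); first exact: smooth_cst.
    apply: (msm_det oU) => i j; apply: (smooth_eqf (AC (lift b i) (lift a j))).
    by apply: funext => w; rewrite !mxE.
  by apply: (smooth_eqf H); apply: funext => w; rewrite mxE.
apply: (smooth_ext oU _ (smoothM oU dC adjC)) => z Uz.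
by rewrite /invmx (Au z Uz) [RHS]mxE.
Qed.

Lemma rd_eqf (f g : V -> Cplx R) z : rd f z -> f = g -> rd g z.
Proof. by move=> ? <-. Qed.

Lemma mw_mul p q r s j (A : V -> 'M[Cplx R]_(p, q)) (B : V -> 'M[Cplx R]_(q, r)) z :
  mrd A z -> mrd B z ->
  mw s j (fun w => A w *m B w) z = mw s j A z *m B z + A z *m mw s j B z.
Proof.
move=> Ad Bd; apply/matrixP => a b.
rewrite mxE (_ : (fun w => (A w *m B w) a b) = fun w => \sum_c A w a c * B w c b); last first.
  by apply: funext => w; rewrite mxE.
rewrite (@wirt_sum _ _ _ _ _ (fun c w => A w a c * B w c b)) => [|c]; last first.
  exact: (rdM (Ad a c) (Bd c b)).
rewrite !mxE -big_split; apply: eq_bigr => c _.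
by rewrite (wirtM s j (Ad a c) (Bd c b)) !mxE.
Qed.

Lemma mrd_add p q (A B : V -> 'M[Cplx R]_(p, q)) z :
  mrd A z -> mrd B z -> mrd (fun w => A w + B w) z.
Proof.
move=> Ad Bd a b; apply: (rd_eqf (rdD (Ad a b) (Bd a b))).
by apply: funext => w; rewrite mxE.
Qed.

Lemma mw_add p q s j (A B : V -> 'M[Cplx R]_(p, q)) z :
  mrd A z -> mrd B z ->
  mw s j (fun w => A w + B w) z = mw s j A z + mw s j B z.
Proof.
move=> Ad Bd; apply/matrixP => a b; rewrite !mxE.
rewrite (_ : (fun w => (A w + B w) a b) = fun w => A w a b + B w a b); last first.
  by apply: funext => w; rewrite mxE.
exact: (wirtD s j (Ad a b) (Bd a b)).
Qed.

Lemma mw_near p q s j (A B : V -> 'M[Cplx R]_(p, q)) z :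
  (\forall w \near z, A w = B w) -> mrd A z -> mw s j A z = mw s j B z.
Proof.
move=> AB Ad; apply/matrixP => a b; rewrite !mxE.
by apply: (wirt_near s j _ (Ad a b)); apply: filterS AB => w ->.
Qed.

Lemma mw_cst p q s j (C : 'M[Cplx R]_(p, q)) z : mw s j (fun=> C) z = 0.
Proof. by apply/matrixP => a b; rewrite !mxE; exact: wirt_cst. Qed.

Lemma mrd_cst p q (C : 'M[Cplx R]_(p, q)) z : mrd (fun=> C) z.
Proof. by move=> a b; exact: rd_cst. Qed.

Lemma mw_symmetric p q (U : set V) (A : V -> 'M[Cplx R]_(p, q)) s s' j k z :
  open U -> U z -> msm U A -> mw s' k (mw s j A) z = mw s j (mw s' k A) z.
Proof.
move=> oU Uz AC; apply/matrixP => a b; rewrite !mxE.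
have E s0 j0 : (fun w => mw s0 j0 A w a b) = wirt s0 j0 (fun w => A w a b).
  by apply: funext => w; rewrite mxE.
by rewrite !E; exact: (wirt_symmetric s s' j k oU Uz (AC a b)).
Qed.

Lemma mw_inv r s j U (A : V -> 'M[Cplx R]_r) z : open U -> U z -> msm U A ->
  (forall z, U z -> A z \in unitmx) ->
  mw s j (fun w => invmx (A w)) z = - (invmx (A z) *m mw s j A z *m invmx (A z)).
Proof.
move=> oU Uz AC Au.
have Ad := msm_mrd AC Uz; have Id := msm_mrd (msm_inv oU AC Au) Uz.
have H : mw s j (fun w => invmx (A w) *m A w) z = 0.
  have nr : \forall w \near z, 1%:M = invmx (A w) *m A w.
    by apply: (open_near oU _ Uz) => w Uw; rewrite mulVmx // Au.
  by rewrite -(mw_near s j nr (mrd_cst _ z)) mw_cst.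
rewrite (mw_mul s j Id Ad) in H.
rewrite -[LHS](mulmxK (Au z Uz)).
have -> : mw s j (fun w => invmx (A w)) z *m A z = - (invmx (A z) *m mw s j A z).
  by apply/eqP; rewrite -addr_eq0; apply/eqP.
by rewrite mulNmx.
Qed.

Lemma mwE p q s j (A : V -> 'M[Cplx R]_(p, q)) z a b :
  mw s j A z a b = wirt s j (fun w => A w a b) z.
Proof. by rewrite mxE. Qed.

Opaque mw.

(** The formula of [bundle_curv], its sums over frame indices absorbed into
    matrix products. *)
Definition curv r (H : V -> 'M[Cplx R]_r) (i j : 'I_n) (z : V) : 'M[Cplx R]_r :=
  - mw false i (mw true j H) z
  + mw false i H z *m invmx (H z) *m mw true j H z.

(** The curvature is a tensor. In a holomorphic change of frame, [A] is
    holomorphic and [B], its conjugate transpose, antiholomorphic, so that only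
    [dz A] and [dzbar B] occur, and these cancel between the two parts of the
    curvature. *)
Lemma curv_frame r (U : set V) (A H B H' : V -> 'M[Cplx R]_r) i j z :
  open U -> U z -> msm U A -> msm U H -> msm U B ->
  (forall w, U w -> mw true j A w = 0) -> (forall w, U w -> mw false i B w = 0) ->
  A z \in unitmx -> B z \in unitmx -> H z \in unitmx ->
  (forall w, U w -> A w *m H w *m B w = H' w) ->
  curv H' i j z = A z *m curv H i j z *m B z.
Proof.
move=> oU Uz AC HC BC A0 B0 Au Bu Hu HE.
have AHC := msm_mul oU AC HC; have C' := msm_mul oU AHC BC.
have d1 s k w : U w -> mw s k H' w =
    (mw s k A w *m H w + A w *m mw s k H w) *m B w + A w *m H w *m mw s k B w.
  move=> Uw; have nr := open_near oU HE Uw.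
  rewrite -(mw_near s k nr (msm_mrd C' Uw)).
  rewrite (mw_mul s k (msm_mrd AHC Uw) (msm_mrd BC Uw)).
  by rewrite (mw_mul s k (msm_mrd AC Uw) (msm_mrd HC Uw)).
have DB : mw false i (mw true j B) z = 0.
  rewrite (mw_symmetric _ _ _ _ oU Uz BC).
  have nr := open_near oU (fun w Uw => esym (B0 w Uw)) Uz.
  by rewrite -(mw_near true j nr (mrd_cst 0 z)) mw_cst.
have HjC := msm_mw true j oU HC; have BjC := msm_mw true j oU BC.
have P1 := msm_mul oU AC HjC; have P2 := msm_mul oU P1 BC; have P3 := msm_mul oU AHC BjC.
have E w (Uw : U w) : A w *m mw true j H w *m B w + A w *m H w *m mw true j B w = mw true j H' w.
  exact (esym (etrans (d1 true j w Uw) (frame_alg1 _ _ _ _ _ (A0 w Uw)))).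
have d2 : mw false i (mw true j H') z =
    (mw false i A z *m mw true j H z + A z *m mw false i (mw true j H) z) *m B z
    + (mw false i A z *m H z + A z *m mw false i H z) *m mw true j B z.
  have nr := open_near oU E Uz.
  rewrite -(mw_near false i nr (mrd_add (msm_mrd P2 Uz) (msm_mrd P3 Uz))).
  rewrite (mw_add _ _ (msm_mrd P2 Uz) (msm_mrd P3 Uz)).
  have e1 := mw_mul false i (msm_mrd P1 Uz) (msm_mrd BC Uz).
  have e2 := mw_mul false i (msm_mrd AHC Uz) (msm_mrd BjC Uz).
  have e3 := mw_mul false i (msm_mrd AC Uz) (msm_mrd HjC Uz).
  have e4 := mw_mul false i (msm_mrd AC Uz) (msm_mrd HC Uz).
  apply: (etrans (congr2 +%R e1 e2)).
  apply: (congr2 +%R).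
    exact (etrans (frame_alg3 _ _ _ (B0 z Uz)) (congr1 (fun x => x *m B z) e3)).
  exact (etrans (frame_alg3 _ _ _ DB) (congr1 (fun x => x *m mw true j B z) e4)).
have e1 := etrans (d1 false i z Uz) (frame_alg3 _ _ _ (B0 z Uz)).
have e3 := frame_change_alg (mw false i A z) (mw false i H z) (mw true j H z)
  (mw false i (mw true j H) z) (mw true j B z) Au Bu Hu.
rewrite /curv d2 e1 -(E z Uz) -(HE z Uz); exact: e3.
Qed.


End MatrixCalculus.

(** ** Holomorphic change of coordinates *)

Lemma scmxE (F : fieldType) p q (c : F) (A : 'M[F]_(p, q)) i j : (c *: A) i j = c * A i j.
Proof. by rewrite mxE. Qed.

Lemma curv_alg (F : fieldType) (I : finType) r (c d : I -> F) (K : 'M[F]_r)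
    (Z : I -> I -> 'M[F]_r) (X Y : I -> 'M[F]_r) :
  - (\sum_a \sum_b (c a * d b) *: Z a b)
  + (\sum_a c a *: X a) *m K *m (\sum_b d b *: Y b)
  = \sum_a \sum_b (c a * d b) *: (- Z a b + X a *m K *m Y b).
Proof.
rewrite !mulmx_suml -sumrN -big_split; apply: eq_bigr => a _ /=.
rewrite mulmx_sumr -sumrN -big_split; apply: eq_bigr => b _ /=.
by rewrite scalerDr scalerN -!scalemxAl -scalemxAr scalerA.
Qed.

Section Pullback.
Variables (R : realType) (n : nat).
Notation V := 'rV[Cplx R]_n.
Variables (U U' : set V) (phi : V -> V).
Hypotheses (oU : open U) (oU' : open U') (phiU : forall z, U' z -> U (phi z)).
Hypothesis phiC : forall k, smooth U' (fun w => phi w 0 k).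
Hypothesis phihol : forall j k z, U' z -> wirt true j (fun w => phi w 0 k) z = 0.

(** The direction comes first and the component second, so that the Jacobian
    matrix acts on row vectors from the right. *)
Definition jac (phi : V -> V) (k a : 'I_n) : V -> Cplx R := wirt false k (fun w => phi w 0 a).

Lemma jac_smooth k a : smooth U' (jac phi k a).
Proof. exact: (smooth_wirt false k oU' (phiC a)). Qed.

(** Mixed derivatives commute, and [phi] is holomorphic. *)
Lemma jac_hol j k a z : U' z -> wirt true j (jac phi k a) z = 0.
Proof.
move=> Uz; rewrite /jac (wirt_symmetric _ _ _ _ oU' Uz (phiC a)).
have nr := open_near oU' (fun w Uw => esym (phihol j a Uw)) Uz.
by rewrite -(wirt_near false k nr (rd_cst 0 z)) wirt_cst.
Qed.

Lemma dz_comp (f : V -> Cplx R) i z : smooth U f -> U' z ->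
  wirt false i (fun w => f (phi w)) z = \sum_a wirt false a f (phi z) * jac phi i a z.
Proof.
move=> fC Uz.
rewrite (wirt_comp false i oU (phiU Uz) (fC 1%N) (fun k => smooth_rd (phiC k) Uz)).
apply: eq_bigr => a _; rewrite [X in _ + _ * X^*](phihol i a Uz).
by rewrite conjC0 mulr0 addr0.
Qed.

Lemma dzbar_comp (f : V -> Cplx R) j z : smooth U f -> U' z ->
  wirt true j (fun w => f (phi w)) z = \sum_b wirt true b f (phi z) * (jac phi j b z)^*.
Proof.
move=> fC Uz.
rewrite (wirt_comp true j oU (phiU Uz) (fC 1%N) (fun k => smooth_rd (phiC k) Uz)).
apply: eq_bigr => b _; rewrite [X in _ * X + _](phihol j b Uz).
by rewrite mulr0 add0r.
Qed.

(** No first order term of [f] survives, since [dzbar] of a holomorphic map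
    vanishes and so does [dz] of its conjugate. This makes the complex Hessian,
    and hence the Laplacian, independent of the coordinates. *)
Lemma ddbar_comp (f : V -> Cplx R) i j z : smooth U f -> U' z ->
  wirt false i (wirt true j (fun w => f (phi w))) z =
  \sum_a \sum_b jac phi i a z * (jac phi j b z)^* * wirt false a (wirt true b f) (phi z).
Proof.
move=> fC Uz.
have E w : U' w -> \sum_b wirt true b f (phi w) * (jac phi j b w)^*
    = wirt true j (fun w => f (phi w)) w.
  by move=> Uw; rewrite (dzbar_comp j fC Uw).
have gC b : smooth U (wirt true b f) := smooth_wirt true b oU fC.
have gpd b : rd (fun w => wirt true b f (phi w)) z.
  exact: (rd_comp oU (phiU Uz) (gC b 1%N) (fun k => smooth_rd (phiC k) Uz)).
have jd b : rd (jac phi j b) z := smooth_rd (jac_smooth j b) Uz.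
have td b : rd (fun w => wirt true b f (phi w) * (jac phi j b w)^*) z.
  exact: (rdM (gpd b) (rd_conj (jd b))).
have nr := open_near oU' E Uz.
rewrite -(wirt_near false i nr (rd_sum _ _ td)) (wirt_sum _ _ _ _ td).
rewrite [RHS]exchange_big; apply: eq_bigr => b _.
rewrite (wirtM false i (gpd b) (rd_conj (jd b))) (wirt_conj false i (jd b)).
rewrite [X in _ + _ * X^*](jac_hol i j b Uz) conjC0 mulr0 addr0.
rewrite (dz_comp i (gC b) Uz) mulr_suml; apply: eq_bigr => a _.
set x := wirt _ _ _ _; set y := jac _ _ _ _; set w := _^*; clearbody x y w.
by rewrite -mulrA mulrC.
Qed.

Lemma curv_comp r (H : V -> 'M[Cplx R]_r) i j z : msm U H -> U' z ->
  curv (fun w => H (phi w)) i j z =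
  \sum_a \sum_b (jac phi i a z * (jac phi j b z)^*) *: curv H a b (phi z).
Proof.
move=> HC Uz.
have e1 : mw false i (fun w => H (phi w)) z = \sum_a jac phi i a z *: mw false a H (phi z).
  apply/matrixP => s t; rewrite mwE (dz_comp i (HC s t) Uz) summxE.
  by apply: eq_bigr => a _; rewrite scmxE mwE mulrC.
have e2 : mw true j (fun w => H (phi w)) z = \sum_b (jac phi j b z)^* *: mw true b H (phi z).
  apply/matrixP => s t; rewrite mwE (dzbar_comp j (HC s t) Uz) summxE.
  by apply: eq_bigr => b _; rewrite scmxE mwE mulrC.
have e3 : mw false i (mw true j (fun w => H (phi w))) z =
    \sum_a \sum_b (jac phi i a z * (jac phi j b z)^*) *: mw false a (mw true b H) (phi z).
  apply/matrixP => s t; rewrite mwE summxE.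
  have -> : (fun w => mw true j (fun w => H (phi w)) w s t)
      = wirt true j (fun w => H (phi w) s t) by apply: funext => w; exact: mwE.
  rewrite (ddbar_comp i j (HC s t) Uz); apply: eq_bigr => a _; rewrite summxE.
  apply: eq_bigr => b _.
  have E : wirt true b (fun w => H w s t) = (fun w => mw true b H w s t).
    by apply: funext => w; rewrite mwE.
  by rewrite scmxE mwE E.
rewrite {1}/curv e1 e2 e3; exact: curv_alg.
Qed.

End Pullback.

(** ** Hermitian forms *)

Section Hermitian.
Variable R : realType.

Definition adjm p q (A : 'M[Cplx R]_(p, q)) : 'M[Cplx R]_(q, p) :=
  \matrix_(i, j) (A j i)^*.

Lemma adjmE p q (A : 'M[Cplx R]_(p, q)) i j : adjm A i j = (A j i)^*.
Proof. by rewrite mxE. Qed.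

Lemma adjmM p q r (A : 'M[Cplx R]_(p, q)) (B : 'M[Cplx R]_(q, r)) :
  adjm (A *m B) = adjm B *m adjm A.
Proof.
apply/matrixP => i j; rewrite !mxE rmorph_sum; apply: eq_bigr => k _.
by rewrite !mxE rmorphM mulrC.
Qed.

Lemma adjmK p q (A : 'M[Cplx R]_(p, q)) : adjm (adjm A) = A.
Proof. by apply/matrixP => i j; rewrite !mxE conjCK. Qed.

Lemma adjm1 p : adjm (1%:M : 'M[Cplx R]_p) = 1%:M.
Proof. by apply/matrixP => i j; rewrite !mxE eq_sym rmorph_nat. Qed.

Lemma adjm_unit p (A : 'M[Cplx R]_p) : A \in unitmx -> adjm A \in unitmx.
Proof.
move=> Au; have H : adjm A *m adjm (invmx A) = 1%:M by rewrite -adjmM mulVmx // adjm1.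
exact: (mulmx1_unit H).1.
Qed.

Lemma hformE r (A : 'M[Cplx R]_r) (v : 'rV[Cplx R]_r) :
  hform A v = (v *m A *m adjm v) 0 0.
Proof.
rewrite mxE /hform exchange_big; apply: eq_bigr => l _.
rewrite !mxE mulr_suml; apply: eq_bigr => k _.
by rewrite [X in X * _]mulrC.
Qed.

Lemma hform_congr p r (A : 'M[Cplx R]_r) (J : 'M[Cplx R]_(p, r)) v :
  hform (J *m A *m adjm J) v = hform A (v *m J).
Proof. by rewrite !hformE adjmM !mulmxA. Qed.

Lemma hformD r (A B : 'M[Cplx R]_r) v : hform (A + B) v = hform A v + hform B v.
Proof. by rewrite !hformE mulmxDr mulmxDl mxE. Qed.

Lemma hformZ r (c : Cplx R) (A : 'M[Cplx R]_r) v : hform (c *: A) v = c * hform A v.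
Proof. by rewrite !hformE -scalemxAr -scalemxAl mxE. Qed.

Lemma hform_sum (I : Type) (s : seq I) r (A : I -> 'M[Cplx R]_r) v :
  hform (\sum_(i <- s) A i) v = \sum_(i <- s) hform (A i) v.
Proof.
elim: s => [|i s IH]; last by rewrite !big_cons hformD IH.
by rewrite !big_nil hformE mulmx0 mul0mx mxE.
Qed.

Definition posdef r (A : 'M[Cplx R]_r) := forall v : 'rV[Cplx R]_r, v != 0 -> 0 < hform A v.

Lemma posdef_unit r (A : 'M[Cplx R]_r) : posdef A -> A \in unitmx.
Proof.
move=> Ap; rewrite -row_free_unit -kermx_eq0; apply/eqP/row_matrixP => i.
rewrite row0; apply: contraTeq isT => ki.
have := Ap _ ki; rewrite hformE.
have -> : row i (kermx A) *m A = 0 by rewrite -row_mul mulmx_ker row0.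
by rewrite mul0mx mxE ltxx.
Qed.

Lemma hform1 r (v : 'rV[Cplx R]_r) : hform 1%:M v = \sum_i `|v 0 i| ^+ 2.
Proof.
rewrite hformE mulmx1 mxE; apply: eq_bigr => i _.
by rewrite mxE normCK.
Qed.

Lemma hform1_gt0 r (v : 'rV[Cplx R]_r) : v != 0 -> 0 < hform 1%:M v.
Proof.
move=> v0; rewrite hform1 lt_def; apply/andP; split; last first.
  by apply: sumr_ge0 => i _; exact: exprn_ge0.
apply: contra v0; rewrite psumr_eq0; last by move=> i _; exact: exprn_ge0.
move=> /allP H; apply/eqP/rowP => i; rewrite mxE.
have := H i (mem_index_enum i); rewrite implyTb expf_eq0 /= normr_eq0.
by move=> /eqP.
Qed.

End Hermitian.

(** * Tensor powers *)

Section TensorAlgebra.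
Variables (F : fieldType) (k n : nat).
Implicit Types X Y : 'I_k -> 'M[F]_n.

(** Kronecker product of a family of matrices, in the frame of the tensor power. *)
Definition tens X : 'M[F]_(tensor_rank k n) :=
  \matrix_(a, b) \prod_s X s (tensor_frame a s) (tensor_frame b s).

Definition upd X (s : 'I_k) (A : 'M[F]_n) : 'I_k -> 'M[F]_n :=
  fun r => if r == s then A else X r.

Lemma big_tensor_frame (G : {ffun 'I_k -> 'I_n} -> F) :
  \sum_(a < tensor_rank k n) G (tensor_frame a) = \sum_f G f.
Proof.
rewrite [RHS](reindex (@enum_val _ (mem {: {ffun 'I_k -> 'I_n}}))) //.
exact: onW_bij (enum_val_bij _).
Qed.

Lemma eq_tens X Y : X =1 Y -> tens X = tens Y.
Proof. by move=> XY; apply/matrixP => a b; rewrite !mxE; apply: eq_bigr => s _; rewrite XY. Qed.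

Lemma tensM X Y : tens X *m tens Y = tens (fun s => X s *m Y s).
Proof.
apply/matrixP => a b; rewrite !mxE.
transitivity (\sum_(c < tensor_rank k n) \prod_i (X i (tensor_frame a i) (tensor_frame c i)
    * Y i (tensor_frame c i) (tensor_frame b i))).
  by apply: eq_bigr => c _; rewrite !mxE big_split.
rewrite (big_tensor_frame (fun f => \prod_i (X i (tensor_frame a i) (f i) * Y i (f i) (tensor_frame b i)))).
rewrite -(bigA_distr_bigA (fun s m => X s (tensor_frame a s) m * Y s m (tensor_frame b s))).
by apply: eq_bigr => s _; rewrite mxE.
Qed.

Lemma tens1 : tens (fun=> 1%:M) = 1%:M.
Proof.
apply/matrixP => a b; rewrite !mxE.
have [->|ab] := eqVneq a b; first by rewrite big1 // => s _; rewrite mxE eqxx.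
have /existsP[s hs] : [exists s, tensor_frame a s != tensor_frame b s].
  apply: contraT; rewrite negb_exists => /forallP H; case/eqP: ab.
  by apply: enum_val_inj; apply/ffunP => s; have /negPn/eqP := H s.
by rewrite (bigD1 s) //= mxE (negbTE hs) mul0r.
Qed.

Lemma tens_unit X : (forall s, X s \in unitmx) -> tens X \in unitmx.
Proof.
move=> Xu; suff H : tens X *m tens (fun s => invmx (X s)) = 1%:M by exact: (mulmx1_unit H).1.
by rewrite tensM -tens1; apply: eq_tens => s; rewrite mulmxV.
Qed.

Lemma invmx_tens X : (forall s, X s \in unitmx) -> invmx (tens X) = tens (fun s => invmx (X s)).
Proof.
move=> Xu; apply: (can_inj (mulKmx (tens_unit Xu))).
rewrite mulmxV ?tens_unit // tensM -tens1; apply: eq_tens => s.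
by rewrite mulmxV.
Qed.

Lemma tens_updE X s A : tens (upd X s A) =
  \matrix_(a, b) (A (tensor_frame a s) (tensor_frame b s)
    * \prod_(r | r != s) X r (tensor_frame a r) (tensor_frame b r)).
Proof.
apply/matrixP => a b; rewrite !mxE (bigD1 s) //= /upd eqxx; congr (_ * _).
by apply: eq_bigr => r /negbTE ->.
Qed.

Lemma tens_updD X s A B : tens (upd X s (A + B)) = tens (upd X s A) + tens (upd X s B).
Proof. by rewrite !tens_updE; apply/matrixP => a b; rewrite !mxE mulrDl. Qed.

Lemma tens_updN X s A : tens (upd X s (- A)) = - tens (upd X s A).
Proof. by rewrite !tens_updE; apply/matrixP => a b; rewrite !mxE mulNr. Qed.

Lemma tens_updZ X s c A : tens (upd X s (c *: A)) = c *: tens (upd X s A).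
Proof. by rewrite !tens_updE; apply/matrixP => a b; rewrite !mxE mulrA. Qed.

Lemma tens_upd_sum (I : Type) (l : seq I) X s (A : I -> 'M[F]_n) :
  tens (upd X s (\sum_(i <- l) A i)) = \sum_(i <- l) tens (upd X s (A i)).
Proof.
elim: l => [|i l IH]; last by rewrite !big_cons tens_updD IH.
rewrite !big_nil tens_updE; apply/matrixP => a b; by rewrite !mxE mul0r.
Qed.

(** In the curvature of a tensor power, the first order terms that fall on two
    different factors cancel. *)
Lemma tensor_curv_alg (h d db ddb : 'M[F]_n) : h \in unitmx ->
  - (\sum_t \sum_s tens (upd (upd (fun=> h) t db) s (if s == t then ddb else d)))
  + (\sum_s tens (upd (fun=> h) s d)) *m invmx (tens (fun=> h))
     *m (\sum_t tens (upd (fun=> h) t db))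
  = \sum_s tens (upd (fun=> h) s (- ddb + d *m invmx h *m db)).
Proof.
move=> hu; rewrite invmx_tens // mulmx_suml mulmx_suml exchange_big -sumrN -big_split.
apply: eq_bigr => s _ /=; rewrite mulmx_sumr -sumrN -big_split /=.
rewrite (bigD1 s) //= big1 ?addr0 => [|t ts].
  rewrite eqxx tens_updD tens_updN; congr (- _ + _).
    by apply: eq_tens => r; rewrite /upd; case: eqP.
  rewrite !tensM; apply: eq_tens => r; rewrite /upd; case: eqP => // _.
  by rewrite mulmxV // mul1mx.
rewrite !tensM [s == t]eq_sym (negbTE ts).
apply/eqP; rewrite addrC subr_eq0; apply/eqP; apply: eq_tens => r; rewrite /upd.
have [->|rs] := eqVneq r s; first by rewrite [s == t]eq_sym (negbTE ts) -mulmxA mulVmx // mulmx1.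
by case: eqP => _; rewrite mulmxV // mul1mx.
Qed.

End TensorAlgebra.

Section TensorCurvature.
Variables (R : realType) (n k : nat).
Notation V := 'rV[Cplx R]_n.

Lemma smooth_tens U (X : 'I_k -> V -> 'M[Cplx R]_n) : open U ->
  (forall s, msm U (X s)) -> msm U (fun w => tens (fun s => X s w)).
Proof.
move=> oU XC a b.
have H : smooth U (fun w => \prod_s X s w (tensor_frame a s) (tensor_frame b s)).
  by apply: (smooth_prod _ _ oU) => s; exact: XC.
by apply: (smooth_eqf H); apply: funext => w; rewrite mxE.
Qed.

Lemma rd_prod (l : seq 'I_k) (f : 'I_k -> V -> Cplx R) z :
  (forall s, rd (f s) z) -> rd (fun w => \prod_(s <- l) f s w) z.
Proof.
move=> fz; elim: l => [|i l IH].
  by apply: (rd_eqf (rd_cst 1 z)); apply: funext => w; rewrite big_nil.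
by apply: (rd_eqf (rdM (fz i) IH)); apply: funext => w; rewrite big_cons.
Qed.

Lemma wirt_prod_seq sg j (l : seq 'I_k) (f : 'I_k -> V -> Cplx R) z :
  (forall s, rd (f s) z) -> uniq l ->
  wirt sg j (fun w => \prod_(s <- l) f s w) z =
  \sum_(s <- l) \prod_(r <- l) (if r == s then wirt sg j (f s) z else f r z).
Proof.
move=> fz; elim: l => [_|i l IH /= /andP[il ul]].
  rewrite big_nil (_ : (fun w => _) = fun=> 1) ?wirt_cst //.
  by apply: funext => w; rewrite big_nil.
rewrite (_ : (fun w => _) = fun w => f i w * \prod_(s <- l) f s w); last first.
  by apply: funext => w; rewrite big_cons.
rewrite (wirtM sg j (fz i) (rd_prod l fz)) big_cons big_cons eqxx (IH ul) mulr_sumr.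
congr (_ + _).
  congr (_ * _); apply: eq_big_seq => r rl.
  by case: eqP => // ri; rewrite -ri rl in il.
apply: eq_big_seq => s sl; rewrite big_cons; case: eqP => // si.
by rewrite si sl in il.
Qed.

Lemma mw_tens sg j (X : 'I_k -> V -> 'M[Cplx R]_n) z : (forall s, mrd (X s) z) ->
  mw sg j (fun w => tens (fun s => X s w)) z
  = \sum_s tens (upd (fun r => X r z) s (mw sg j (X s) z)).
Proof.
move=> Xd; apply/matrixP => a b; rewrite mwE summxE.
rewrite (_ : (fun w => _) = fun w => \prod_s X s w (tensor_frame a s) (tensor_frame b s)); last first.
  by apply: funext => w; rewrite mxE.
rewrite (wirt_prod_seq sg j (fun s => Xd s _ _) (index_enum_uniq _)).
apply: eq_bigr => s _; rewrite [RHS]mxE; apply: eq_bigr => r _.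
by rewrite /upd; case: eqP => // ->; rewrite mwE.
Qed.

Lemma curv_tens U (H : V -> 'M[Cplx R]_n) i j z : open U -> U z -> msm U H ->
  H z \in unitmx ->
  curv (fun w => tens (fun _ : 'I_k => H w)) i j z
  = \sum_s tens (upd (fun _ : 'I_k => H z) s (curv H i j z)).
Proof.
move=> oU Uz HC Hu.
have HbC := msm_mw true j oU HC.
have e1 sg l w : U w -> mw sg l (fun w => tens (fun _ : 'I_k => H w)) w
    = \sum_s tens (upd (fun _ : 'I_k => H w) s (mw sg l H w)).
  by move=> Uw; exact: (mw_tens sg l (fun _ => msm_mrd HC Uw)).
pose Y (t s : 'I_k) : V -> 'M[Cplx R]_n := if s == t then mw true j H else H.
have YC t s : msm U (Y t s) by rewrite /Y; case: eqP.
have e2 w (Uw : U w) : \sum_t tens (fun s => Y t s w)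
    = mw true j (fun w => tens (fun _ : 'I_k => H w)) w.
  rewrite (e1 true j w Uw); apply: eq_bigr => t _; apply: eq_tens => s.
  by rewrite /Y /upd; case: eqP.
have Yd t : mrd (fun w => tens (fun s => Y t s w)) z := msm_mrd (smooth_tens oU (YC t)) Uz.
have nr := open_near oU e2 Uz.
have sumd : mrd (fun w => \sum_t tens (fun s => Y t s w)) z.
  move=> a b; apply: (rd_eqf (rd_sum _ _ (fun t => Yd t a b))).
  by apply: funext => w; rewrite summxE.
have e3 : mw false i (mw true j (fun w => tens (fun _ : 'I_k => H w))) z
   = \sum_t \sum_s tens (upd (upd (fun=> H z) t (mw true j H z)) s
       (if s == t then mw false i (mw true j H) z else mw false i H z)).
  rewrite -(mw_near false i nr sumd).
  transitivity (\sum_t mw false i (fun w => tens (fun s => Y t s w)) z).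
    apply/matrixP => a b; rewrite mwE summxE.
    rewrite (_ : (fun w => _) = fun w => \sum_t tens (fun s => Y t s w) a b); last first.
      by apply: funext => w; rewrite summxE.
    rewrite (wirt_sum _ _ _ _ (fun t => Yd t a b)).
    by apply: eq_bigr => t _; rewrite mwE.
  apply: eq_bigr => t _; rewrite (mw_tens false i (fun s => msm_mrd (YC t s) Uz)).
  apply: eq_bigr => s _; rewrite /Y.
  have -> : mw false i (if s == t then mw true j H else H) z
     = if s == t then mw false i (mw true j H) z else mw false i H z by case: eqP.
  by apply: eq_tens => r; rewrite /upd; case: eqP => // _; case: eqP.
rewrite /curv e3 (e1 false i z Uz) (e1 true j z Uz).
exact: tensor_curv_alg.
Qed.

End TensorCurvature.

(** * Positivity of the traced curvature *)

Section Positivity.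
Variable R : realType.

Lemma conj_hform r (A : 'M[Cplx R]_r) v : (hform A v)^* = hform (adjm A) v.
Proof.
rewrite !hformE; set M := v *m A *m adjm v.
have -> : v *m adjm A *m adjm v = adjm M by rewrite !adjmM adjmK mulmxA.
by rewrite [RHS]mxE.
Qed.

Lemma Im_hform r (A : 'M[Cplx R]_r) v : adjm A = A -> Im (hform A v) = 0.
Proof.
move=> AA; have := conj_hform A v; rewrite AA => /(congr1 (@complex.Im R)).
by rewrite Im_conj => /eqP; rewrite eqNr => /eqP.
Qed.

(** A positive definite Hermitian matrix is [C C^*] with [C] invertible: take
    the square root of its diagonal form in a unitary basis. *)
Lemma posdef_factor r (A : 'M[Cplx R]_r) : adjm A = A -> posdef A ->
  exists2 C, C \in unitmx & A = C *m adjm C.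
Proof.
move=> AA Ap.
have adjE p q (M : 'M[Cplx R]_(p, q)) : map_mx Num.conj (M^T) = adjm M.
  by apply/matrixP => i j; rewrite !mxE.
have An : A \is normalmx by apply/normalmxP; rewrite adjE AA.
have Su := spectral_unitarymx A; have Ai := orthomx_spectralP An.
rewrite invmx_unitary // adjE in Ai.
set S := spectralmx A in Su Ai; set d := spectral_diag A in Ai.
have SS : S *m adjm S = 1%:M by rewrite -adjE; exact: (unitarymxP Su).
have SA : S *m A *m adjm S = diag_mx d.
  by rewrite Ai !mulmxA SS mul1mx -mulmxA SS mulmx1.
have dp i : 0 < d 0 i.
  have Si : row i S != 0.
    apply: contraTneq isT => Si0; have /matrixP/(_ i i) := SS.
    rewrite !mxE eqxx big1 => [/eqP|j _]; first by rewrite eq_sym oner_eq0.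
    by move/rowP: Si0 => /(_ j); rewrite !mxE => ->; rewrite mul0r.
  have := Ap _ Si; rewrite hformE.
  have -> : adjm (row i S) = col i (adjm S) by apply/matrixP => a b; rewrite !mxE.
  rewrite -row_mul.
  have -> : (row i (S *m A) *m col i (adjm S)) 0 0 = (S *m A *m adjm S) i i.
    by rewrite !mxE; apply: eq_bigr => j _; rewrite !mxE.
  by rewrite SA mxE eqxx.
pose D : 'M[Cplx R]_r := diag_mx (\row_i sqrtC (d 0 i)).
have Dadj : adjm D = D.
  apply/matrixP => i j; rewrite !mxE eq_sym; have [->|ij] := eqVneq i j.
    by rewrite /= !mulr1n; apply: conj_Creal; rewrite ger0_real // sqrtC_ge0 ltW.
  by rewrite /= !mulr0n conjC0.
have DD : D *m D = diag_mx d.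
  rewrite mulmx_diag; congr diag_mx; apply/rowP => i; rewrite !mxE.
  by rewrite -expr2 sqrtCK.
have AC : A = adjm S *m D *m adjm (adjm S *m D).
  by rewrite adjmM Dadj adjmK mulmxA -[_ *m D *m D]mulmxA DD.
exists (adjm S *m D) => //.
have Au := posdef_unit Ap; rewrite AC unitmx_mul in Au.
by have /andP[] := Au.
Qed.

Lemma hform1_posdef_congr r (C : 'M[Cplx R]_r) : C \in unitmx -> posdef (C *m adjm C).
Proof.
move=> Cu v v0; have -> : C *m adjm C = C *m 1%:M *m adjm C by rewrite mulmx1.
rewrite hform_congr.
apply: hform1_gt0; apply: contra v0 => /eqP vC.
by rewrite -(mulmxK Cu v) vC mul0mx.
Qed.

(** Since [G^-1] is a sum of terms [e e^*], the trace is a sum of values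
    of the Hermitian form [B], and one of these is positive. *)
Lemma trace_positive n (G B : 'M[Cplx R]_n) : adjm G = G -> posdef G -> adjm B = B ->
  0 < \sum_k \sum_l ginv G k l * B k l ->
  exists v : 'rV[Cplx R]_n, v != 0 /\ 0 < hform B v.
Proof.
move=> GG Gp BB.
have [C Cu GC] := posdef_factor GG Gp.
pose E := adjm (invmx C).
have Gi : invmx G = E *m adjm E.
  have Gu := posdef_unit Gp; apply: (can_inj (mulKmx Gu)).
  rewrite mulmxV // {1}GC /E adjmK -!mulmxA (mulmxA (adjm C)) -adjmM mulVmx //.
  by rewrite adjm1 mul1mx mulmxV.
clearbody E.
have -> : \sum_k \sum_l ginv G k l * B k l = \sum_m hform B (\row_k (E k m)^*).
  rewrite /hform [RHS]exchange_big; apply: eq_bigr => k _ /=.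
  rewrite [RHS]exchange_big; apply: eq_bigr => l _ /=.
  rewrite /ginv Gi mxE mulr_suml; apply: eq_bigr => m _.
  by rewrite !mxE conjCK; ring.
rewrite ltcplx => /andP[_]; rewrite Re_sum => pos.
have /existsP[m hm] : [exists m, 0 < Re (hform B (\row_k (E k m)^*))].
  apply: contraLR pos; rewrite negb_exists => /forallP H.
  by rewrite -leNgt; apply: sumr_le0 => m _; rewrite leNgt; exact: H.
have Bv : 0 < hform B (\row_k (E k m)^*) by rewrite ltcplx Im_hform // eqxx.
exists (\row_k (E k m)^*); split => //.
by apply: contraTneq Bv => ->; rewrite hformE mul0mx mul0mx mxE ltxx.
Qed.

Section Curvature.
Variable n : nat.
Notation V := 'rV[Cplx R]_n.

Lemma mw_adj p q s j (A : V -> 'M[Cplx R]_(p, q)) z : mrd A z ->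
  mw s j (fun w => adjm (A w)) z = adjm (mw (~~ s) j A z).
Proof.
move=> Ad; apply/matrixP => a b; rewrite mwE [RHS]mxE mwE.
rewrite (_ : (fun w => _) = fun w => (A w b a)^*); last first.
  by apply: funext => w; rewrite mxE.
exact: (wirt_conj s j (Ad b a)).
Qed.

(** Conjugation exchanges [dz] and [dzbar], which commute. *)
Lemma adjm_curv r U (H : V -> 'M[Cplx R]_r) i j z : open U -> U z -> msm U H ->
  (forall w, U w -> adjm (H w) = H w) -> H z \in unitmx ->
  adjm (curv H i j z) = curv H j i z.
Proof.
move=> oU Uz HC HH Hu.
have e1 s k w : U w -> adjm (mw s k H w) = mw (~~ s) k H w.
  move=> Uw; have nr := open_near oU HH Uw.
  have aHd : mrd (fun w => adjm (H w)) w.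
    by move=> a b; apply: (rd_eqf (rd_conj (msm_mrd HC Uw b a))); apply: funext => w'; rewrite mxE.
  rewrite -(mw_near (~~ s) k nr aHd) (mw_adj (~~ s) k (msm_mrd HC Uw)).
  by rewrite negbK.
have e2 : adjm (mw false i (mw true j H) z) = mw false j (mw true i H) z.
  rewrite -[false in LHS]/(~~ true) -(mw_adj true i (msm_mrd (msm_mw true j oU HC) Uz)).
  have nr := open_near oU (e1 true j) Uz.
  have aHd : mrd (fun w => adjm (mw true j H w)) z.
    move=> a b; apply: (rd_eqf (rd_conj (msm_mrd (msm_mw true j oU HC) Uz b a))).
    by apply: funext => w'; rewrite adjmE.
  rewrite (mw_near true i nr aHd).
  exact: (mw_symmetric _ _ _ _ oU Uz HC).
have e3 : adjm (invmx (H z)) = invmx (H z).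
  apply: (can_inj (mulKmx Hu)); rewrite mulmxV // -{1}(HH z Uz) -adjmM mulVmx //.
  exact: adjm1.
have adjD p (A B : 'M[Cplx R]_p) : adjm (- A + B) = - adjm A + adjm B.
  by apply/matrixP => a b; rewrite !mxE rmorphD rmorphN.
rewrite /curv adjD e2 !adjmM e3 (e1 true j z Uz) (e1 false i z Uz) mulmxA.
by [].
Qed.

(** For a fixed [a] the curvature is a Hermitian form in the base directions. Its
    trace is positive, so [trace_positive] gives the direction. *)
Lemma RC_of_trace r (H : V -> 'M[Cplx R]_r) (G : 'M[Cplx R]_n) z :
  adjm G = G -> posdef G ->
  (forall i j, adjm (curv H i j z) = curv H j i z) ->
  posdef (\sum_k \sum_l ginv G k l *: curv H k l z) ->
  forall a : 'rV[Cplx R]_r, a != 0 -> exists v : 'rV[Cplx R]_n, v != 0 /\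
    0 < \sum_i \sum_j (v 0 i * (v 0 j)^*) * hform (curv H i j z) a.
Proof.
move=> GG Gp cH tp a a0.
pose B : 'M[Cplx R]_n := \matrix_(i, j) hform (curv H i j z) a.
have BB : adjm B = B by apply/matrixP => i j; rewrite !mxE conj_hform cH.
have [|v [v0 Bv]] := @trace_positive n G B GG Gp BB.
  have := tp a a0; rewrite hform_sum.
  under eq_bigr do rewrite hform_sum; under eq_bigr do under eq_bigr do rewrite hformZ.
  congr (_ < _); apply: eq_bigr => k _; apply: eq_bigr => l _.
  by rewrite [X in _ = _ * X]mxE.
exists v; split=> //; move: Bv; congr (_ < _).
apply: eq_bigr => i _; apply: eq_bigr => j _; rewrite mxE.
by rewrite -mulrA mulrC.
Qed.

End Curvature.

Section TensorPositive.
Variables k n : nat.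

Lemma adjm_tens (X : 'I_k -> 'M[Cplx R]_n) : adjm (tens X) = tens (fun s => adjm (X s)).
Proof.
apply/matrixP => a b; rewrite !mxE rmorph_prod; apply: eq_bigr => s _.
by rewrite mxE.
Qed.

(** By [posdef_factor], each summand is [T T^*] for an invertible Kronecker
    product [T]. *)
Lemma tens_trace_posdef (h W : 'M[Cplx R]_n) : (0 < k)%N ->
  adjm h = h -> posdef h -> adjm W = W -> posdef W ->
  posdef (\sum_s tens (upd (fun _ : 'I_k => h) s W)).
Proof.
move=> k0 hh hp WW Wp.
have [C Cu hC] := posdef_factor hh hp; have [D Du WD] := posdef_factor WW Wp.
have tp s : posdef (tens (upd (fun _ : 'I_k => h) s W)).
  have -> : tens (upd (fun _ : 'I_k => h) s W)
      = tens (upd (fun _ : 'I_k => C) s D) *m adjm (tens (upd (fun _ : 'I_k => C) s D)).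
    rewrite adjm_tens tensM; apply: eq_tens => r; rewrite /upd.
    by case: eqP.
  by apply: hform1_posdef_congr; apply: tens_unit => r; rewrite /upd; case: eqP.
move=> a a0; rewrite hform_sum (bigD1 (Ordinal k0)) //=.
apply: ltr_wpDr; last exact: tp.
by apply: sumr_ge0 => s _; exact/ltW/tp.
Qed.

End TensorPositive.
End Positivity.

(** * Exterior powers *)

Section Subframe.
Variables (R : realType) (n : nat).
Notation V := 'rV[Cplx R]_n.

Lemma subframe_alg (F : fieldType) r N (P Q' : 'M[F]_(r, N)) (P' Q : 'M[F]_(N, r))
    (h d db ddb : 'M[F]_N) : h \in unitmx -> P *m Q = 1%:M ->
  P *m h = P *m h *m P' *m Q' -> P *m d = P *m d *m P' *m Q' ->
  db *m P' = Q *m P *m db *m P' ->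
  - (P *m ddb *m P') + P *m d *m P' *m invmx (P *m h *m P') *m (P *m db *m P')
  = P *m (- ddb + d *m invmx h *m db) *m P'.
Proof.
move=> hu PQ hP dP dbP.
have H1 : (P *m h *m P') *m (Q' *m invmx h *m Q) = 1%:M.
  by rewrite !mulmxA -hP -!mulmxA mulKVmx.
have [phu _] := mulmx1_unit H1.
have -> : invmx (P *m h *m P') = Q' *m invmx h *m Q.
  by apply: (can_inj (mulKmx phu)); rewrite mulmxV.
rewrite mulmxDr mulmxDl mulmxN mulNmx; congr (_ + _).
rewrite !mulmxA -dP -[RHS]mulmxA dbP !mulmxA.
by [].
Qed.

(** A constant subframe [P], on which [H] restricts without second fundamental
    form, inherits the curvature. *)
Lemma curv_subframe r N (U : set V) (H : V -> 'M[Cplx R]_N) (P Q' : 'M[Cplx R]_(r, N))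
    (P' Q : 'M[Cplx R]_(N, r)) i j z :
  open U -> U z -> msm U H -> H z \in unitmx -> P *m Q = 1%:M ->
  (forall w, U w -> P *m H w = P *m H w *m P' *m Q') ->
  (forall w, U w -> H w *m P' = Q *m P *m H w *m P') ->
  curv (fun w => P *m H w *m P') i j z = P *m curv H i j z *m P'.
Proof.
move=> oU Uz HC Hu PQ hP hP'.
have cC p q (M : 'M[Cplx R]_(p, q)) : msm U (fun=> M) by move=> a b; exact: smooth_cst.
have mwl p q s k (M : 'M[Cplx R]_(p, N)) (X : V -> 'M[Cplx R]_(N, q)) w :
    msm U X -> U w -> mw s k (fun w => M *m X w) w = M *m mw s k X w.
  move=> XC Uw; rewrite (mw_mul s k (mrd_cst M w) (msm_mrd XC Uw)).
  by rewrite mw_cst mul0mx add0r.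
have mwr p o q s k (X : V -> 'M[Cplx R]_(p, o)) (M : 'M[Cplx R]_(o, q)) w :
    msm U X -> U w -> mw s k (fun w => X w *m M) w = mw s k X w *m M.
  move=> XC Uw; rewrite (mw_mul s k (msm_mrd XC Uw) (mrd_cst M w)).
  by rewrite mw_cst mulmx0 addr0.
have PHC : msm U (fun w => P *m H w) := msm_mul oU (cC _ _ P) HC.
have HPC : msm U (fun w => H w *m P') := msm_mul oU HC (cC _ _ P').
have d1 s k w : U w -> mw s k (fun w => P *m H w *m P') w = P *m mw s k H w *m P'.
  by move=> Uw; rewrite (mwr _ _ _ s k _ P' w PHC Uw) (mwl _ _ s k P _ w HC Uw).
have HbC := msm_mw true j oU HC.
have d2 : mw false i (mw true j (fun w => P *m H w *m P')) z
    = P *m mw false i (mw true j H) z *m P'.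
  have nr := open_near oU (fun w Uw => esym (d1 true j w Uw)) Uz.
  have PHbC : msm U (fun w => P *m mw true j H w) := msm_mul oU (cC _ _ P) HbC.
  have C3 := msm_mul oU PHbC (cC _ _ P').
  rewrite -(mw_near false i nr (msm_mrd C3 Uz)).
  by rewrite (mwr _ _ _ false i _ P' z PHbC Uz) (mwl _ _ false i P _ z HbC Uz).
have PHPC : msm U (fun w => P *m H w *m P') := msm_mul oU PHC (cC _ _ P').
have dP : P *m mw false i H z = P *m mw false i H z *m P' *m Q'.
  exact (etrans (esym (mwl _ _ false i P _ z HC Uz))
    (etrans (mw_near false i (open_near oU hP Uz) (msm_mrd PHC Uz))
    (etrans (mwr _ _ _ false i _ Q' z PHPC Uz) (congr1 (mulmx^~ Q') (d1 false i z Uz))))).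
have dP' : mw true j H z *m P' = Q *m P *m mw true j H z *m P'.
  have hP2 w (Uw : U w) : H w *m P' = Q *m P *m (H w *m P') by rewrite mulmxA hP' // !mulmxA.
  exact (etrans (esym (mwr _ _ _ true j _ P' z HC Uz))
    (etrans (mw_near true j (open_near oU hP2 Uz) (msm_mrd HPC Uz))
    (etrans (mwl _ _ true j (Q *m P) _ z HPC Uz)
    (etrans (congr1 (mulmx (Q *m P)) (mwr _ _ _ true j _ P' z HC Uz)) (mulmxA _ _ _))))).
rewrite /curv d2 (d1 false i z Uz) (d1 true j z Uz).
exact: (subframe_alg _ Hu PQ (hP z Uz) dP dP').
Qed.

End Subframe.

Section Alternating.
Variables (F : numFieldType) (p n : nat).
Local Notation idx := {ffun 'I_p -> 'I_n}.
Implicit Types (f g I J : idx) (s t : 'S_p) (u : idx -> F).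

Definition pact f s : idx := [ffun i => f (s i)].

Lemma pactM f s t : pact (pact f s) t = pact f (t * s)%g.
Proof. by apply/ffunP => i; rewrite !ffunE permM. Qed.

Lemma pact1 f : pact f 1%g = f.
Proof. by apply/ffunP => i; rewrite !ffunE perm1. Qed.

Lemma pactK s : cancel (pact^~ s) (pact^~ s^-1%g).
Proof. by move=> f; rewrite pactM mulVg pact1. Qed.

Definition antisym u := forall f s, u (pact f s) = (-1) ^+ s * u f.

(** The coordinates of [e_{I 0} /\ ... /\ e_{I (p-1)}] in the frame of the tensor power. *)
Definition alt I f : F := \sum_(s : 'S_p) (-1) ^+ s * (f == pact I s)%:R.

(** A transposition fixes a non-injective index and changes the sign. *)
Lemma antisym0 u f : antisym u -> ~~ injectiveb f -> u f = 0.
Proof.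
move=> ua /injectivePn[i [j ij fij]].
have e : pact f (tperm i j) = f.
  apply/ffunP => k; rewrite ffunE; case: tpermP => [->|->|//]; by rewrite fij.
have := ua f (tperm i j); rewrite e odd_tperm ij expr1 mulN1r => /eqP.
by rewrite -addr_eq0 -mulr2n mulrn_eq0 => /eqP.
Qed.

Lemma alt_antisym I : antisym (alt I).
Proof.
move=> f t; rewrite /alt mulr_sumr (reindex_inj (mulgI t)).
apply: eq_bigr => s _; rewrite odd_permM signr_addb -mulrA.
rewrite -pactM (inj_eq (can_inj (pactK t))).
by [].
Qed.

Lemma sum_alt u I : antisym u -> \sum_f u f * alt I f = p`!%:R * u I.
Proof.
move=> ua; rewrite /alt; under eq_bigr do rewrite mulr_sumr.
rewrite exchange_big /= (eq_bigr (fun _ => u I)).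
  by rewrite sumr_const card_Sn mulr_natl.
move=> s _; rewrite (bigD1 (pact I s)) //= eqxx mulr1 big1 => [|f /negbTE ->].
  by rewrite addr0 ua mulrAC -expr2 sqrr_sign mul1r.
by rewrite !mulr0.
Qed.

Lemma incr_id (s : 'S_p) : (forall i j : 'I_p, (i < j)%N -> (s i < s j)%N) -> s = 1%g.
Proof.
have le_id (t : 'S_p) : (forall i j : 'I_p, (i < j)%N -> (t i < t j)%N) ->
    forall i : 'I_p, (i <= t i)%N.
  move=> ti [m mp]; elim: m mp => [//|m IH] mp.
  by apply: leq_ltn_trans (IH (ltnW mp)) _; apply: ti.
move=> si; apply/permP => i; rewrite perm1; apply/val_inj/eqP.
rewrite eqn_leq le_id // andbT -{2}(permK s i); apply: le_id => k l kl.
rewrite ltnNge leq_eqVlt negb_or; apply/andP; split.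
  by apply: contraTneq kl => /val_inj/perm_inj ->; rewrite ltnn.
by apply: contraTN kl => /si; rewrite !permKV -leqNgt => /ltnW.
Qed.

Lemma increasingP I : reflect (forall i j : 'I_p, (i < j)%N -> (I i < I j)%N)
  (I \in increasing_maps p n).
Proof.
rewrite inE; apply: (iffP forallP) => [H i j ij|H i].
  by have /forallP/(_ j)/implyP/(_ ij) := H i.
by apply/forallP => j; apply/implyP; exact: H.
Qed.

(** Only the identity is an increasing permutation, so that distinct increasing
    indices lie in distinct orbits. *)
Lemma increasing_uniq I J s : I \in increasing_maps p n -> J \in increasing_maps p n ->
  J = pact I s -> s = 1%g.
Proof.
move=> /increasingP Ii /increasingP Ji e; apply: incr_id => i j ij.
have := Ji _ _ ij; rewrite e !ffunE => IJ.
rewrite ltnNge; apply: contraTN IJ; rewrite leq_eqVlt => /orP[/eqP/val_inj -> |/Ii/ltnW].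
  by rewrite ltnn.
by rewrite leqNgt.
Qed.

Lemma alt_increasing I J : I \in increasing_maps p n -> J \in increasing_maps p n ->
  alt I J = (I == J)%:R.
Proof.
move=> Ii Ji; rewrite /alt (bigD1 1%g) //= big1 => [|s s1].
  by rewrite odd_perm1 expr0 mul1r addr0 pact1 eq_sym.
have [e|] := eqVneq J (pact I s); last by rewrite mulr0.
by rewrite (increasing_uniq Ii Ji e) eqxx in s1.
Qed.

Lemma sort_injective f : injectiveb f ->
  exists I s, I \in increasing_maps p n /\ f = pact I s.
Proof.
move=> /injectiveP fi.
pose c := codom f; pose r := sort (fun i j : 'I_n => (i <= j)%N) c.
have sr : size r == p by rewrite size_sort size_codom card_ord.
have cr : perm_eq c (Tuple sr) by rewrite perm_sym /= perm_sort.
have /tuple_permP[s cs] := cr.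
pose I : idx := [ffun i => tnth (Tuple sr) i].
have fE : f = pact I s.
  apply/ffunP => i; rewrite !ffunE.
  have sc : size c = p by rewrite size_codom card_ord.
  have i1 : nth (f i) c i = f i.
    by rewrite /c /codom (nth_map i) ?size_enum_ord // nth_ord_enum.
  rewrite -{1}i1 cs.
  by rewrite (nth_map i) ?size_enum_ord // nth_ord_enum.
exists I, s; split=> //; apply/increasingP => i j ij.
rewrite !ffunE !(tnth_nth (f i)) /=.
have so : sorted ltn (map val r).
  rewrite ltn_sorted_uniq_leq map_inj_uniq; last exact: val_inj.
  rewrite sort_uniq map_inj_uniq ?enum_uniq //=.
  rewrite sorted_map; apply: sort_sorted => x y; exact: leq_total.
have := sorted_ltn_nth ltn_trans 0%N so.
move=> /(_ i j); rewrite !inE size_map (eqP sr) !ltn_ord => /(_ isT isT ij).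
by rewrite !(nth_map (f i)) ?(eqP sr).
Qed.

(** Increasing indices represent the orbits of the injective ones. Both sides are
    antisymmetric, so it is enough to compare them there. *)
Lemma antisym_decomp u f : antisym u ->
  u f = \sum_(I in increasing_maps p n) u I * alt I f.
Proof.
move=> ua; have [fi|fni] := boolP (injectiveb f); last first.
  rewrite antisym0 // big1 // => I _.
  by rewrite (antisym0 (alt_antisym I) fni) mulr0.
have [J [s [Ji ->]]] := sort_injective fi.
rewrite ua (bigD1 J) //= alt_antisym alt_increasing // eqxx mulr1 big1 => [|I /andP[Ii IJ]].
  by rewrite addr0 mulrC.
by rewrite alt_antisym alt_increasing // (negbTE IJ) !mulr0.
Qed.

Lemma big_exterior_frame (G : idx -> F) :
  \sum_(a < exterior_rank p n) G (exterior_frame a) = \sum_(I in increasing_maps p n) G I.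
Proof. by rewrite [RHS]big_enum_val. Qed.

Definition altmx : 'M[F]_(exterior_rank p n, tensor_rank p n) :=
  \matrix_(a, f) alt (exterior_frame a) (tensor_frame f).

Lemma exterior_frameP a : exterior_frame a \in increasing_maps p n.
Proof. exact: enum_valP. Qed.

Lemma fact_neq0 : p`!%:R != 0 :> F.
Proof. by rewrite pnatr_eq0 -lt0n fact_gt0. Qed.

Lemma altmx_inv : altmx *m (p`!%:R^-1 *: altmx^T) = 1%:M.
Proof.
rewrite -scalemxAr; apply/matrixP => a b; rewrite !mxE.
transitivity (p`!%:R^-1 * \sum_f alt (exterior_frame a) f * alt (exterior_frame b) f).
  rewrite -big_tensor_frame; congr (_ * _); apply: eq_bigr => c _.
  by rewrite !mxE.
rewrite (sum_alt _ (alt_antisym _)) mulKf ?fact_neq0 //.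
rewrite alt_increasing ?exterior_frameP //; congr (_%:R).
by congr nat_of_bool; rewrite (inj_eq enum_val_inj).
Qed.

Lemma prod_pact (h : 'M[F]_n) f g s :
  \prod_i h (pact f s i) (pact g s i) = \prod_i h (f i) (g i).
Proof.
rewrite [RHS](reindex_inj (@perm_inj _ s)).
by apply: eq_bigr => i _; rewrite !ffunE.
Qed.

(** A tensor power commutes with the permutations of the factors, so it maps
    antisymmetric tensors to antisymmetric ones; these are fixed by the
    antisymmetrization [p!^-1 altmx^T altmx]. *)
Lemma altmx_proj (h : 'M[F]_n) :
  altmx *m tens (fun=> h) = altmx *m tens (fun=> h) *m (p`!%:R^-1 *: altmx^T) *m altmx.
Proof.
set M := altmx *m _.
apply/matrixP => a b.
pose u (g : idx) := \sum_(f : idx) alt (exterior_frame a) f * \prod_i h (f i) (g i).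
have ME c : M a c = u (tensor_frame c).
  rewrite /u -big_tensor_frame mxE; apply: eq_bigr => d _.
  by rewrite !mxE.
have ua : antisym u.
  move=> g s; rewrite /u (reindex_inj (can_inj (pactK s))) mulr_sumr.
  by apply: eq_bigr => f _; rewrite alt_antisym prod_pact mulrA.
rewrite ME mxE (antisym_decomp _ ua) -big_exterior_frame; apply: eq_bigr => c _.
rewrite [altmx c b]mxE; congr (_ * _).
rewrite -scalemxAr mxE mxE.
transitivity (p`!%:R^-1 * \sum_f u f * alt (exterior_frame c) f).
  by rewrite (sum_alt _ ua) mulKf // fact_neq0.
rewrite -big_tensor_frame; congr (_ * _); apply: eq_bigr => d _.
by rewrite ME !mxE.
Qed.

Lemma altmx_proj' (h : 'M[F]_n) :
  tens (fun=> h) *m (p`!%:R^-1 *: altmx^T)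
  = p`!%:R^-1 *: altmx^T *m altmx *m tens (fun=> h) *m (p`!%:R^-1 *: altmx^T).
Proof.
have tT : (tens (fun _ : 'I_p => h))^T = tens (fun=> h^T).
  by apply/matrixP => a b; rewrite !mxE; apply: eq_bigr => s _; rewrite mxE.
apply: trmx_inj; rewrite !trmx_mul !linearZ /= !trmxK tT.
rewrite -!scalemxAl; congr (_ *: _).
rewrite {1}altmx_proj -!scalemxAr -!scalemxAl !mulmxA.
by [].
Qed.

(** The Leibniz formula: the metric of the exterior power is the restriction of
    that of the tensor power, up to the constant [p!]. *)
Lemma altmx_det (h : 'M[F]_n) a b :
  (altmx *m tens (fun=> h) *m (p`!%:R^-1 *: altmx^T)) a b
  = \det (\matrix_(s < p, t < p) h (exterior_frame a s) (exterior_frame b t)).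
Proof.
rewrite -mulmxA mxE.
pose v (f : idx) := \sum_(g : idx) (\prod_i h (f i) (g i)) * alt (exterior_frame b) g.
have va : antisym v.
  move=> g s; rewrite /v (reindex_inj (can_inj (pactK s))) mulr_sumr.
  by apply: eq_bigr => f _; rewrite alt_antisym prod_pact mulrCA.
have E c : (tens (fun=> h) *m (p`!%:R^-1 *: altmx^T)) c b = p`!%:R^-1 * v (tensor_frame c).
  rewrite -scalemxAr mxE; congr (_ * _); rewrite /v -big_tensor_frame mxE.
  by apply: eq_bigr => d _; rewrite !mxE.
transitivity (p`!%:R^-1 * \sum_f v f * alt (exterior_frame a) f).
  rewrite -big_tensor_frame mulr_sumr; apply: eq_bigr => c _.
  by rewrite E [altmx a c]mxE mulrC mulrA.
rewrite (sum_alt _ va) mulKf ?fact_neq0 // /v /alt.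
under eq_bigr do rewrite mulr_sumr.
rewrite exchange_big /=; apply: eq_bigr => s _.
rewrite (bigD1 (pact (exterior_frame b) s)) //= eqxx mulr1 [X in _ + X]big1; last first.
  by move=> g gb; rewrite (negbTE gb) !mulr0.
rewrite addr0 mulrC; congr (_ * _); apply: eq_bigr => i _.
by rewrite mxE ffunE.
Qed.

End Alternating.

(** * Curvature on a complex manifold *)

Local Notation coord := Defs.coord.

Lemma opmxE (F : fieldType) p q (A : 'M[F]_(p, q)) i j : (- A) i j = - A i j.
Proof. by rewrite mxE. Qed.

Lemma trace_exchange (F : fieldType) (I : finType) r (x : I -> I -> F) (p q : I -> I -> F)
    (K : I -> I -> 'M[F]_r) :
  \sum_k \sum_l \sum_a \sum_b (x k l * (p k a * q l b)) *: K a b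
  = \sum_a \sum_b (\sum_k \sum_l x k l * (p k a * q l b)) *: K a b.
Proof.
transitivity (\sum_k \sum_a \sum_b \sum_l (x k l * (p k a * q l b)) *: K a b).
  apply: eq_bigr => k _; rewrite exchange_big; apply: eq_bigr => a _.
  by rewrite exchange_big.
rewrite exchange_big; apply: eq_bigr => a _; rewrite exchange_big; apply: eq_bigr => b _ /=.
rewrite scaler_suml; apply: eq_bigr => k _.
by rewrite scaler_suml.
Qed.

Lemma chern_alg (F : fieldType) r (x d b G : 'M[F]_r) : G \in unitmx ->
  (x *m invmx G + d *m (- (invmx G *m b *m invmx G))) *m G
  = - (- x + d *m invmx G *m b).
Proof.
move=> Gu; rewrite mulmxDl mulmxKV // mulmxN mulNmx !mulmxA mulmxKV //.
by rewrite opprD opprK.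
Qed.

Lemma congr_inv (F : fieldType) r (J G K : 'M[F]_r) : J \in unitmx -> G \in unitmx ->
  J *m G *m K \in unitmx -> invmx G = K *m invmx (J *m G *m K) *m J.
Proof.
move=> Ju Gu JGu; apply: (can_inj (mulKmx Gu)); rewrite mulmxV // !mulmxA.
by apply: (can_inj (mulKmx Ju)); rewrite !mulmxA mulmxV // mulmx1 mul1mx.
Qed.

Section Manifold.
Variables (R : realType) (n : nat) (M : complexManifold R n).
Notation V := 'rV[Cplx R]_n.
Implicit Types (c d : atlas M) (q : M) (z : V).

Definition overlap c d : set V := coord c @` (dom c `&` dom d).
Definition trans c d : V -> V := fun z => coord d (param c z).

Lemma cod_coord c q : dom c q -> cod c (coord c q).
Proof. by move=> cq; exists q. Qed.

Lemma param_dom c z : cod c z -> dom c (param c z).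
Proof. by move=> [q cq <-]; rewrite coordK. Qed.

Lemma paramK c z : cod c z -> coord c (param c z) = z.
Proof. by move=> [q cq <-]; rewrite coordK. Qed.

Lemma overlap_coord c d q : dom c q -> dom d q -> overlap c d (coord c q).
Proof. by move=> cq dq; exists q. Qed.

Lemma overlap_cod c d z : overlap c d z -> cod c z.
Proof. by move=> [q [cq _] <-]; exists q. Qed.

Lemma overlap_param c d z : overlap c d z -> dom d (param c z).
Proof. by move=> [q [cq dq] <-]; rewrite coordK. Qed.

Lemma overlapE c d z : cod c z -> dom d (param c z) -> overlap c d z.
Proof. by move=> zc zd; exists (param c z); [split=> //; exact: param_dom|exact: paramK]. Qed.

Lemma open_overlap c d : open (overlap c d).
Proof.
rewrite openE => z zo; have zc := overlap_cod zo.
have H1 : nbhs z (cod c) := open_nbhs_nbhs (conj (@cod_open _ _ M c) zc).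
have H2 : nbhs z (param c @^-1` dom d).
  by apply: (param_continuous zc); apply: open_nbhs_nbhs; split; [exact: dom_open|exact: overlap_param zo].
apply: (filterS _ (@filterI _ (nbhs z) _ _ _ H1 H2)) => w [wc wd].
exact: overlapE.
Qed.

Lemma trans_cod c d z : overlap c d z -> cod d (trans c d z).
Proof. by move=> zo; apply: cod_coord; exact: overlap_param zo. Qed.

Lemma trans_smooth c d k : smooth (overlap c d) (fun z => trans c d z 0 k).
Proof. by have [] := transition_holomorphic c d k. Qed.

Lemma trans_hol c d j k z : overlap c d z -> wirt true j (fun w => trans c d w 0 k) z = 0.
Proof. by have [_ H] := transition_holomorphic c d k; exact: H. Qed.

Section Metric.
Variable g : hermitianMetric M.

Lemma gram_msm c : msm (cod c) (g c).
Proof. by move=> k l; exact: gram_smooth. Qed.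

Lemma gram_adjm c z : cod c z -> adjm (g c z) = g c z.
Proof.
move=> zc; apply/matrixP => k l; rewrite adjmE.
by rewrite -(gram_hermitian g zc).
Qed.

Lemma gram_posdefP c z : cod c z -> posdef (g c z).
Proof. by move=> zc v; exact: (gram_posdef g zc). Qed.

Lemma gram_unit c z : cod c z -> g c z \in unitmx.
Proof. by move=> zc; exact: posdef_unit (gram_posdefP zc). Qed.

Definition jacmx c d z : 'M[Cplx R]_n := \matrix_(k, a) jac (trans c d) k a z.

Lemma jacmxE c d z k a : jacmx c d z k a = jac (trans c d) k a z.
Proof. by rewrite mxE. Qed.

Lemma gram_change c d z : overlap c d z ->
  jacmx c d z *m g d (trans c d z) *m adjm (jacmx c d z) = g c z.
Proof.
move=> zo; apply/matrixP => k l; rewrite (gram_transition g zo).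
rewrite mxE exchange_big; apply: eq_bigr => b _ /=.
rewrite mxE mulr_suml; apply: eq_bigr => a _.
by rewrite adjmE !jacmxE [X in X * _ = _]mulrC.
Qed.

Lemma jacmx_unit c d z : overlap c d z -> jacmx c d z \in unitmx.
Proof.
move=> zo; have := gram_unit (overlap_cod zo); rewrite -(gram_change zo).
by rewrite !unitmx_mul => /andP[/andP[]].
Qed.

(** The inverse metric is a tensor as well. *)
Lemma ginv_change c d z a b : overlap c d z ->
  \sum_k \sum_l ginv (g c z) k l * (jac (trans c d) k a z * (jac (trans c d) l b z)^*)
  = ginv (g d (trans c d z)) a b.
Proof.
move=> zo; set J := jacmx c d z; set G := g d (trans c d z).
have Ju : J \in unitmx := jacmx_unit zo.
have Gu : G \in unitmx := gram_unit (trans_cod zo).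
have JGu : J *m G *m adjm J \in unitmx by rewrite (gram_change zo) gram_unit //; exact: overlap_cod zo.
have e := congr_inv Ju Gu JGu.
rewrite /ginv e -(gram_change zo) -/J -/G; set K := invmx _; clearbody K.
rewrite mxE exchange_big /= exchange_big /=; apply: eq_bigr => k _.
rewrite mxE mulr_suml; apply: eq_bigr => l _.
by rewrite adjmE !jacmxE; ring.
Qed.

(** The Chern curvature differentiates the product of [dz g] with the inverse of
    [g]. The derivative of the inverse matrix gives the second term of [curv],
    and the mixed derivatives commute. *)
Lemma chern_curvE c i j k l z : cod c z -> chern_curv g c i j k l z = curv (g c) i j z k l.
Proof.
move=> zc; have oU := @cod_open _ _ M c.
have GC := gram_msm c; have IC := msm_inv oU GC (@gram_unit c).
have DC := msm_mw false i oU GC.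
have chE p r : christoffel g c i p r = fun w => (mw false i (g c) w *m invmx (g c w)) p r.
  apply: funext => w; rewrite /christoffel [RHS]mxE; apply: eq_bigr => m _.
  by rewrite /ginv mwE mulrC.
have mixE p r : chern_curv_mixed g c i j p r z
    = - mw true j (fun w => mw false i (g c) w *m invmx (g c w)) z p r.
  by rewrite /chern_curv_mixed chE mwE.
have e1 := mw_mul true j (msm_mrd DC zc) (msm_mrd IC zc).
have e2 := mw_inv true j oU zc GC (@gram_unit c).
have e3 : mw true j (fun w => mw false i (g c) w *m invmx (g c w)) z *m g c z
    = - curv (g c) i j z.
  rewrite e1 e2 /curv (mw_symmetric true false j i oU zc GC).
  exact: (chern_alg _ _ _ (gram_unit zc)).
have e4 : curv (g c) i j z k l
    = - (mw true j (fun w => mw false i (g c) w *m invmx (g c w)) z *m g c z) k l.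
  by rewrite e3 opmxE opprK.
rewrite e4 mxE -sumrN /chern_curv.
by apply: eq_bigr => p _; rewrite mixE mulrN mulrC.
Qed.

End Metric.

Section Trace.
Variables gt g : hermitianMetric M.

(** [tr_chern_curv] with [curv] in place of the Chern curvature: the two agree
    on the images of the charts, where all derivatives exist. *)
Definition trcurv c z : 'M[Cplx R]_n :=
  \sum_k \sum_l ginv (gt c z) k l *: curv (g c) k l z.

Lemma tr_chern_curvE c z : cod c z -> tr_chern_curv gt g c z = trcurv c z.
Proof.
move=> zc; apply/matrixP => i j; rewrite mxE summxE; apply: eq_bigr => k _.
rewrite summxE; apply: eq_bigr => l _; rewrite scmxE.
by rewrite chern_curvE.
Qed.

(** A change of chart changes both the frame, by the Jacobian matrix, and the
    coordinates. *)
Lemma curv_change c d k l z : overlap c d z ->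
  curv (g c) k l z = jacmx c d z *m (\sum_a \sum_b
    (jac (trans c d) k a z * (jac (trans c d) l b z)^*) *: curv (g d) a b (trans c d z))
    *m adjm (jacmx c d z).
Proof.
move=> zo.
have oU := @open_overlap c d.
have jC a b : smooth (overlap c d) (jac (trans c d) a b).
  exact: (jac_smooth oU (@trans_smooth c d)).
have jh j a b w : overlap c d w -> wirt true j (jac (trans c d) a b) w = 0.
  exact: (jac_hol oU (@trans_smooth c d) (@trans_hol c d)).
have JC : msm (overlap c d) (jacmx c d).
  by move=> a b; apply: (smooth_eqf (jC a b)); apply: funext => w; rewrite jacmxE.
have GC : msm (overlap c d) (fun w => g d (trans c d w)).
  move=> a b.
  apply: (smooth_comp (@cod_open _ _ M d) oU _ (gram_msm g d a b) (@trans_smooth c d)).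
  exact: trans_cod.
have BC : msm (overlap c d) (fun w => adjm (jacmx c d w)).
  move=> a b; apply: (smooth_eqf (smooth_conj oU (jC b a))).
  by apply: funext => w; rewrite adjmE jacmxE.
have J0 w : overlap c d w -> mw true l (jacmx c d) w = 0.
  move=> wo; apply/matrixP => a b; rewrite mwE [RHS]mxE.
  rewrite (_ : (fun w => _) = jac (trans c d) a b) ?jh //.
  by apply: funext => w'; rewrite jacmxE.
have B0 w : overlap c d w -> mw false k (fun w => adjm (jacmx c d w)) w = 0.
  move=> wo; rewrite (mw_adj false k (msm_mrd JC wo)).
  apply/matrixP => a b; rewrite adjmE mwE [RHS]mxE.
  rewrite (_ : (fun w => _) = jac (trans c d) b a) ?jh ?conjC0 //.
  by apply: funext => w'; rewrite jacmxE.
have Ju := jacmx_unit g zo.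
rewrite (curv_frame oU zo JC GC BC J0 B0 Ju (adjm_unit Ju) (gram_unit g (trans_cod zo))
  (@gram_change g c d)).
by rewrite (curv_comp (@cod_open _ _ M d) oU (@trans_cod c d) (@trans_smooth c d) (@trans_hol c d)
  k l (gram_msm g d) zo).
Qed.

Lemma trcurv_change c d z : overlap c d z ->
  trcurv c z = jacmx c d z *m trcurv d (trans c d z) *m adjm (jacmx c d z).
Proof.
move=> zo; rewrite /trcurv.
transitivity (jacmx c d z *m (\sum_k \sum_l \sum_a \sum_b
   (ginv (gt c z) k l * (jac (trans c d) k a z * (jac (trans c d) l b z)^*))
     *: curv (g d) a b (trans c d z)) *m adjm (jacmx c d z)).
  rewrite mulmx_sumr mulmx_suml; apply: eq_bigr => k _.
  rewrite mulmx_sumr mulmx_suml; apply: eq_bigr => l _.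
  rewrite (curv_change k l zo) scalemxAl scalemxAr; congr (_ *m _ *m _).
  rewrite scaler_sumr; apply: eq_bigr => a _; rewrite scaler_sumr.
  by apply: eq_bigr => b _; rewrite scalerA.
congr (_ *m _ *m _).
rewrite trace_exchange; apply: eq_bigr => a _; apply: eq_bigr => b _.
by rewrite (ginv_change gt a b zo).
Qed.

End Trace.
End Manifold.

(** * A flat function *)

Section Flat.
Variable R : realType.

Lemma RderX (f : R -> R) k (t a : R) : Rder f t a ->
  Rder (fun x => f x ^+ k) t (k%:R * f t ^+ k.-1 * a).
Proof.
move=> fa; apply: (is_derive_eqf (is_deriveX k fa)) => //.
by elim: k => [|k IH]; apply: funext => x; rewrite ?expr0 // exprS [LHS]/= IH exprS.
Qed.

Lemma Rder_near (f g : R -> R) (t a : R) :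
  (\forall s \near t, f s = g s) -> Rder f t a -> Rder g t a.
Proof. by move=> fg; exact: near_eq_is_derive. Qed.

(** What the differentiability of [flat] at [0] reduces to. *)
Lemma Rder_quadratic (f : R -> R) (C : R) : (forall t, `|f t| <= C * t ^+ 2) -> Rder f 0 0.
Proof.
move=> fC; have f0 : f 0 = 0.
  by apply/eqP; rewrite -normr_le0; have := fC 0; rewrite expr0n mulr0.
pose chi t := f t / t.
have chi0 : chi @ (0 : R) --> (0 : R).
  have chiC t : `|chi t| <= C * `|t|.
    rewrite /chi; have [->|t0] := eqVneq t 0; first by rewrite invr0 mulr0 normr0 mulr0.
    rewrite normrM normfV ler_pdivrMr ?normr_gt0 // -mulrA -expr2 real_normK ?num_real //.
  have C1 : 0 < `|C| + 1 by rewrite ltr_wpDl.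
  apply/(@cvgrPdist_lt _ _ _ (nbhs (0 : R)) _) => e e0.
  have d0 : 0 < e / (`|C| + 1) by rewrite divr_gt0.
  have idc : {for (0 : R), continuous (fun x : R => x)} by exact: cvg_id.
  apply: filterS (cont_near d0 idc) => t; rewrite !sub0r !normrN => td.
  apply: le_lt_trans (chiC t) _.
  apply: (@le_lt_trans _ _ ((`|C| + 1) * `|t|)).
    by apply: ler_wpM2r; [exact: normr_ge0|rewrite (le_trans (ler_norm C)) // lerDl].
  by rewrite mulrC -ltr_pdivlMr.
have idd : Rder (fun x : R => x) 0 1 by exact: is_derive_id.
have fE t : f t = chi t * t.
  by rewrite /chi; have [->|t0] := eqVneq t 0; [rewrite f0 mulr0|rewrite divfK].
have H := Rder_mul_zero chi0 (erefl : (fun x : R => x) 0 = 0) idd f0 (@nearW _ (nbhs (0 : R)) _ _ fE).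
by rewrite mul0r in H; apply: H.
Qed.

(** The standard flat function [e^(-s/t)], with the powers of [t^-1] that its
    derivatives produce: the family over [k] is stable under differentiation. *)
Definition flat (s : R) (k : nat) (t : R) : R :=
  if 0 < t then t^-1 ^+ k * expR (- s * t^-1) else 0.

Lemma flat_gt0 s k t : 0 < t -> 0 < flat s k t.
Proof. by move=> t0; rewrite /flat t0 mulr_gt0 ?expR_gt0 // exprn_gt0 // invr_gt0. Qed.

Lemma flat_le0 s k t : t <= 0 -> flat s k t = 0.
Proof. by rewrite /flat leNgt => /negbTE ->. Qed.

Lemma flat_ge0 s k t : 0 <= flat s k t.
Proof. by have [t0|t0] := ltP 0 t; [exact/ltW/flat_gt0|rewrite flat_le0]. Qed.

Lemma flatS s k t : flat s k t = t * flat s k.+1 t.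
Proof.
rewrite /flat; case: ifP => t0; last by rewrite mulr0.
by rewrite exprS !mulrA mulfV ?mul1r // gt_eqF.
Qed.

(** [e^x >= x^m / m!] with [m = k + 2]. *)
Lemma flat_quadratic s k : 0 < s -> exists C, forall t, `|flat s k t| <= C * t ^+ 2.
Proof.
move=> s0; exists ((k.+2)`!%:R / s ^+ k.+2) => t.
rewrite ger0_norm ?flat_ge0 //; have [t0|t0] := ltP 0 t; last first.
  by rewrite flat_le0 // mulr_ge0 ?sqr_ge0 // divr_ge0 // exprn_ge0 // ltW.
have st : 0 < s * t^-1 by rewrite mulr_gt0 // invr_gt0.
have e1 : (s * t^-1) ^+ k.+2 / (k.+2)`!%:R <= expR (s * t^-1).
  by apply: le_trans (expR_ge1Dxn k.+1 (ltW st)); rewrite lerDr.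
have f0 : 0 < (k.+2)`!%:R :> R by rewrite ltr0n fact_gt0.
have e2 : expR (- s * t^-1) <= (k.+2)`!%:R / (s * t^-1) ^+ k.+2.
  rewrite mulNr expRN -[X in _ <= X]invrK invf_div lef_pV2 ?posrE ?expR_gt0 //.
  by rewrite divr_gt0 // exprn_gt0.
rewrite /flat t0; apply: (le_trans (ler_wpM2l _ e2)).
  by rewrite exprn_ge0 // invr_ge0 ltW.
rewrite exprMn le_eqVlt; apply/orP; left; apply/eqP.
have tn : t != 0 by rewrite gt_eqF.
have -> : t^-1 ^+ k.+2 = (t^-1 ^+ k) * t ^- 2 by rewrite -[t ^- 2]exprVn -exprD addn2.
have tk : t^-1 ^+ k != 0 by rewrite expf_neq0 // invr_eq0.
have sk : s ^+ k.+2 != 0 by rewrite expf_neq0 // gt_eqF.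
move: (t^-1 ^+ k) tk (s ^+ k.+2) sk (_`!%:R) => a a0 b b0 c.
by field; rewrite a0 b0 tn.
Qed.

Lemma Rder_flat s k t : 0 < s ->
  Rder (flat s k) t (- k%:R * flat s k.+1 t + s * flat s k.+2 t).
Proof.
move=> s0; have [t0|t0|t0] := ltgtP t 0.
- rewrite !flat_le0 ?(ltW t0) // !mulr0 addr0.
  apply: Rder_near (is_derive_cst 0 _ _).
  apply: filterS (lt_nbhsl t0) => r r0.
  by rewrite flat_le0 // ltW.
- have dV : Rder (fun x : R => x^-1) t (- t ^- 2).
    apply: (is_derive_eqf (is_deriveV (lt0r_neq0 t0) (is_derive_id t 1))) => //.
    by rewrite /GRing.scale /= mulr1.
  have dE : Rder (fun x : R => expR (- s * x^-1)) t (expR (- s * t^-1) * (- s * (- t ^- 2))).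
    have dl : Rder (fun x : R => - s * x^-1) t (- s * (- t ^- 2)).
      apply: (is_derive_eqf (is_deriveM (is_derive_cst (- s) _ _) dV)) => //.
      by rewrite scaler0 addr0.
    exact: (is_derive_eqf (is_derive1_comp (is_derive_expR _) dl)).
  have dF := is_deriveM (RderX k dV) dE.
  apply: (@Rder_near (fun x => x^-1 ^+ k * expR (- s * x^-1))).
    by apply: filterS (lt_nbhsr t0) => r r0; rewrite /flat r0.
  apply: (is_derive_eqf dF) => //.
  rewrite /flat t0 /GRing.scale /= -exprVn.
  case: k {dF} => [|k] /=; first by rewrite !expr0; ring.
  by rewrite !exprS; ring.
rewrite t0 !flat_le0 // !mulr0 addr0.
by have [C hC] := flat_quadratic k s0; exact: (Rder_quadratic hC).
Qed.

Lemma uCkD m (f g : R -> R) : uCk m f -> uCk m g -> uCk m (fun t => f t + g t).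
Proof.
elim: m f g => [|m IH] f g fC gC.
  by move=> t; exact: (cvgD (fC t) (gC t)).
have [df fd dfC] := fC; have [dg gd dgC] := gC.
exists (fun t => df t + dg t); last exact: IH.
by move=> t; exact: (is_deriveD (fd t) (gd t)).
Qed.

Lemma uCkZ m (a : R) (f : R -> R) : uCk m f -> uCk m (fun t => a * f t).
Proof.
elim: m f => [|m IH] f fC.
  by move=> t; exact: (cvgM (cvg_cst a) (fC t)).
have [df fd dfC] := fC; exists (fun t => a * df t); last exact: IH.
move=> t; apply: (is_derive_eqf (is_deriveM (is_derive_cst a _ _) (fd t))) => //.
by rewrite scaler0 addr0.
Qed.

Lemma uCk_flat m s k : 0 < s -> uCk m (flat s k).
Proof.
move=> s0; elim: m k => [|m IH] k.
  by move=> t; exact: (is_derive_continuous (Rder_flat k t s0)).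
exists (fun t => - k%:R * flat s k.+1 t + s * flat s k.+2 t).
  by move=> t; exact: Rder_flat.
by apply: uCkD; apply: uCkZ; exact: IH.
Qed.

Lemma uCk_expR m : uCk m (expR : R -> R).
Proof.
elim: m => [|m IH]; first exact: continuous_expR.
by exists expR => // t; exact: is_derive_expR.
Qed.

End Flat.

(** * The Laplacian of a Hermitian metric *)

Section Coordinates.
Variables (R : realType) (n : nat).
Notation V := 'rV[Cplx R]_n.
Implicit Types (U : set V) (z : V).

Lemma smooth_local (U : set V) (f : V -> Cplx R) :
  (forall z, U z -> exists2 U' : set V, U' z & smooth U' f) -> smooth U f.
Proof.
move=> H m; have {}H z : U z -> exists2 U' : set V, U' z & Ck m U' f.
  by move=> /H[U' U'z fC]; exists U'.
elim: m f H => [|m IH] f H.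
  split; last exact: I.
  by move=> z /H[U' U'z fC]; exact: (Ck_cont fC U'z).
split=> [z /H[U' U'z fC]|b j]; first exact: (Ck_cont fC U'z).
split=> [z /H[U' U'z fC]|]; first by have [_ /(_ b j)[fd _]] := fC; exact: fd.
apply: IH => z /H[U' U'z fC]; exists U' => //.
by have [_ /(_ b j)[_]] := fC.
Qed.

Lemma isrd_coord a v z : isrd (fun w : V => w 0 a) v z (v 0 a).
Proof.
have H : cderiv (fun t => z 0 a + RC t * v 0 a) 0 (0 + (RC 1 * v 0 a + RC 0 * 0)).
  apply: cderivD; first exact: cderiv_cst.
  apply: cderivM; last exact: cderiv_cst.
  by apply: cderiv_RC; exact: is_derive_id.
rewrite mulr0 addr0 add0r RC1 mul1r in H.
rewrite (_ : (fun t => z 0 a + RC t * v 0 a) = rline (fun w : V => w 0 a) v z) in H.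
  exact: H.
by apply: funext => t; rewrite /rline !mxE.
Qed.

Lemma rd_coord a z : rd (fun w : V => w 0 a) z.
Proof. by move=> b j; exact: (isrd_rderivable (isrd_coord a (xydir R b j) z)). Qed.

Lemma smooth_coord U a : open U -> smooth U (fun w : V => w 0 a).
Proof.
move=> oU m; have cc z : {for z, continuous (fun w : V => w 0 a)} by exact: coord_continuous.
case: m => [|m]; first by split; [move=> z _; exact: cc|exact: I].
apply: (@Ck_intro _ _ _ _ _ (fun b j _ => xydir R b j 0 a) oU).
- by move=> z _; exact: cc.
- by move=> b j z _; exact: isrd_coord.
by move=> b j; exact: Ck_cst.
Qed.

Lemma wirt_coord s k a z : wirt s k (fun w : V => w 0 a) z = (~~ s && (a == k))%:R.
Proof.
rewrite (wirt_isrd s (isrd_coord a _ z) (isrd_coord a _ z)) !xydirE !mxE eqxx /=.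
have ii : 'i * 'i = -1 :> Cplx R by rewrite -expr2 sqrCi.
have two : 2 != 0 :> Cplx R by rewrite pnatr_eq0.
case: s => /=; last rewrite mulNr; rewrite mul1r mulrA ii mulN1r.
  by rewrite subrr mul0r.
move: ((a == k)%:R : Cplx R) => x.
by rewrite opprK (_ : x + x = x * 2) ?mulfK // mulr_natr mulr2n.
Qed.

Variable y : V.

Definition sqdist (w : V) : R :=
  \sum_a (Re (w 0 a - y 0 a) ^+ 2 + Im (w 0 a - y 0 a) ^+ 2).

Lemma RC_sqdist w : RC (sqdist w) = \sum_a (w 0 a - y 0 a) * (w 0 a - y 0 a)^*.
Proof.
rewrite /sqdist (big_morph (@RC R) (@RCD R) (RC0 R)); apply: eq_bigr => a _.
by rewrite -conj_norm_sqr mulrC.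
Qed.

Lemma rd_shift a z : rd (fun w : V => w 0 a - y 0 a) z.
Proof. by apply: rdD; [exact: rd_coord|exact: rd_cst]. Qed.

Lemma wirt_shift s k a z : wirt s k (fun w : V => w 0 a - y 0 a) z = (~~ s && (a == k))%:R.
Proof.
by rewrite (wirtD s k (rd_coord a z) (rd_cst (- y 0 a) z)) wirt_cst addr0 wirt_coord.
Qed.

Lemma smooth_sqdist U : open U -> smooth U (fun w => RC (sqdist w)).
Proof.
move=> oU; under eq_fun do rewrite RC_sqdist.
apply: (smooth_sum _ _ oU) => a.
have aC : smooth U (fun w : V => w 0 a - y 0 a).
  by apply: (smoothD oU); [exact: smooth_coord|exact: smooth_cst].
exact: (smoothM oU aC (smooth_conj oU aC)).
Qed.

Lemma wirt_sqdist s k z : wirt s k (fun w => RC (sqdist w)) z =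
  if s then z 0 k - y 0 k else (z 0 k - y 0 k)^*.
Proof.
have ad a := rd_shift a z; have td a := rdM (ad a) (rd_conj (ad a)).
rewrite (_ : (fun w => RC (sqdist w)) = fun w => \sum_a (w 0 a - y 0 a) * (w 0 a - y 0 a)^*); last first.
  by apply: funext => w; exact: RC_sqdist.
rewrite (wirt_sum _ _ _ _ td) (bigD1 k) //= big1 => [|a ak].
  rewrite (wirtM s k (ad k) (rd_conj (ad k))) (wirt_conj s k (ad k)) !wirt_shift eqxx.
  by case: s => /=; rewrite ?conjC0 ?conjC1 ?mul0r ?mul1r ?mulr0 ?mulr1 ?addr0 ?add0r.
rewrite (wirtM s k (ad a) (rd_conj (ad a))) (wirt_conj s k (ad a)) !wirt_shift (negbTE ak).
by rewrite !andbF conjC0 mul0r mulr0 addr0.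
Qed.

End Coordinates.

Lemma trace_exchange_scalar (F : fieldType) (I : finType) (x p q : I -> I -> F)
    (K : I -> I -> F) :
  \sum_k \sum_l x k l * (\sum_a \sum_b p k a * q l b * K a b)
  = \sum_a \sum_b (\sum_k \sum_l x k l * (p k a * q l b)) * K a b.
Proof.
transitivity (\sum_k \sum_a \sum_b \sum_l (x k l * (p k a * q l b)) * K a b).
  apply: eq_bigr => k _; under eq_bigr do rewrite mulr_sumr.
  rewrite exchange_big; apply: eq_bigr => a _ /=.
  under eq_bigr do rewrite mulr_sumr.
  by rewrite exchange_big; apply: eq_bigr => b _; apply: eq_bigr => l _; rewrite mulrA.
rewrite exchange_big; apply: eq_bigr => a _; rewrite exchange_big; apply: eq_bigr => b _ /=.
rewrite mulr_suml; apply: eq_bigr => k _.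
by rewrite mulr_suml.
Qed.

Section Laplacian.
Variables (R : realType) (n : nat) (M : complexManifold R n) (gt : hermitianMetric M).
Notation V := 'rV[Cplx R]_n.
Implicit Types (c d : atlas M) (q : M) (z : V).

Definition lap c (F : V -> Cplx R) z : Cplx R :=
  \sum_k \sum_l ginv (gt c z) k l * wirt false k (wirt true l F) z.

Lemma lap_ext c (U : set V) (F G : V -> Cplx R) z : open U -> U z -> smooth U F ->
  (forall w, U w -> F w = G w) -> lap c F z = lap c G z.
Proof.
move=> oU Uz FC FG; rewrite /lap.
have E l w : U w -> wirt true l F w = wirt true l G w.
  by move=> Uw; apply: (wirt_near true l (open_near oU FG Uw)); exact: (smooth_rd FC Uw).
have H k l : wirt false k (wirt true l F) z = wirt false k (wirt true l G) z.
  apply: (wirt_near false k (open_near oU (E l) Uz)).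
  exact: (smooth_rd (smooth_wirt true l oU FC) Uz).
by apply: eq_bigr => k _; apply: eq_bigr => l _; rewrite H.
Qed.

Lemma lap_cst c (a : Cplx R) z : lap c (fun=> a) z = 0.
Proof.
have E l : wirt true l (fun=> a) = fun=> 0 by apply: funext => w; exact: wirt_cst.
rewrite /lap big1 // => k _; rewrite big1 // => l _.
by rewrite E wirt_cst mulr0.
Qed.

Lemma lapD c (U : set V) F G z : open U -> U z -> smooth U F -> smooth U G ->
  lap c (fun w => F w + G w) z = lap c F z + lap c G z.
Proof.
move=> oU Uz FC GC.
have E l w : U w -> wirt true l F w + wirt true l G w = wirt true l (fun w => F w + G w) w.
  by move=> Uw; rewrite (wirtD true l (smooth_rd FC Uw) (smooth_rd GC Uw)).
have H k l : wirt false k (wirt true l (fun w => F w + G w)) z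
    = wirt false k (wirt true l F) z + wirt false k (wirt true l G) z.
  have Fd := smooth_rd (smooth_wirt true l oU FC) Uz.
  have Gd := smooth_rd (smooth_wirt true l oU GC) Uz.
  by rewrite -(wirt_near false k (open_near oU (E l) Uz) (rdD Fd Gd)) (wirtD false k Fd Gd).
rewrite /lap -big_split; apply: eq_bigr => k _ /=.
rewrite -big_split; apply: eq_bigr => l _ /=.
by rewrite -[RHS]mulrDr -H.
Qed.

Lemma lapZ c (U : set V) F a z : open U -> U z -> smooth U F ->
  lap c (fun w => a * F w) z = a * lap c F z.
Proof.
move=> oU Uz FC.
have Z s j (G : V -> Cplx R) w : rd G w -> wirt s j (fun w => a * G w) w = a * wirt s j G w.
  by move=> Gd; rewrite (wirtM s j (rd_cst a w) Gd) wirt_cst mul0r add0r.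
have E l w : U w -> a * wirt true l F w = wirt true l (fun w => a * F w) w.
  by move=> Uw; rewrite (Z _ _ _ _ (smooth_rd FC Uw)).
have H k l : wirt false k (wirt true l (fun w => a * F w)) z
    = a * wirt false k (wirt true l F) z.
  have Fd := smooth_rd (smooth_wirt true l oU FC) Uz.
  by rewrite -(wirt_near false k (open_near oU (E l) Uz) (rdM (rd_cst a z) Fd)) (Z _ _ _ _ Fd).
rewrite /lap mulr_sumr; apply: eq_bigr => k _; rewrite mulr_sumr; apply: eq_bigr => l _.
by rewrite H mulrCA.
Qed.

Lemma smooth_lap c F : smooth (cod c) F -> smooth (cod c) (lap c F).
Proof.
move=> FC; have oU := @cod_open _ _ M c.
have IC := msm_inv oU (gram_msm gt c) (@gram_unit _ _ _ gt c).
apply: (smooth_sum _ _ oU) => k; apply: (smooth_sum _ _ oU) => l.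
apply: (smoothM oU); first exact: IC.
exact: (smooth_wirt false k oU (smooth_wirt true l oU FC)).
Qed.

(** The complex Hessian and the inverse metric are both tensors. *)
Lemma lap_change c d F z : smooth (cod c) F -> overlap d c z ->
  lap d (fun w => F (trans d c w)) z = lap c F (trans d c z).
Proof.
move=> FC zo; have oU := @cod_open _ _ M c; have oU' := @open_overlap _ _ M d c.
rewrite /lap.
have H k l := ddbar_comp oU oU' (@trans_cod _ _ M d c) (@trans_smooth _ _ M d c)
  (@trans_hol _ _ M d c) k l FC zo.
apply: etrans (eq_bigr _ (fun k _ => eq_bigr _ (fun l _ =>
  congr1 (fun x => ginv (gt d z) k l * x) (H k l)))) _.
rewrite trace_exchange_scalar; apply: eq_bigr => a _; apply: eq_bigr => b _.
by rewrite (ginv_change gt a b zo).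
Qed.

(** Recording the Laplacian [L] as a function on [M] builds its independence of
    the chart into the definition, and lets functions be combined and compared
    without reference to coordinates. *)
Definition potential (f L : M -> R) : Prop :=
  [/\ forall c, smooth (cod c) (fun w => RC (f (param c w))),
      continuous L
    & forall c z, cod c z -> lap c (fun w => RC (f (param c w))) z = RC (L (param c z))].

Lemma potential0 : potential (fun=> 0) (fun=> 0).
Proof.
split=> [c|q|c z _]; first exact: (smooth_cst _ (@cod_open _ _ M c)).
  exact: cst_continuous.
exact: lap_cst.
Qed.

Lemma potential_comb (a b : R) f L f' L' : potential f L -> potential f' L' ->
  potential (fun q => a * f q + b * f' q) (fun q => a * L q + b * L' q).
Proof.
move=> [fC Lc fL] [fC' Lc' fL'].
have E c : (fun w => RC (a * f (param c w) + b * f' (param c w)))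
    = fun w => RC a * RC (f (param c w)) + RC b * RC (f' (param c w)).
  by apply: funext => w; rewrite RCD !RCM.
have sZ c (k : R) F : smooth (cod c) F -> smooth (cod c) (fun w => RC k * F w).
  move=> FC; have oU := @cod_open _ _ M c.
  by apply: (smoothM oU); [exact: smooth_cst|exact: FC].
split=> [c|q|c z zc]; have oU c := @cod_open _ _ M c.
- by rewrite E; apply: (smoothD (oU c)); apply: sZ.
- exact: (cvgD (cvgM (cvg_cst a) (Lc q)) (cvgM (cvg_cst b) (Lc' q))).
rewrite E (lapD c (oU c) zc (sZ c a _ (fC c)) (sZ c b _ (fC' c))).
by rewrite (lapZ c _ (oU c) zc (fC c)) (lapZ c _ (oU c) zc (fC' c)) fL // fL' // RCD !RCM.
Qed.

Lemma open_param c (A : set M) : open A -> open [set w | cod c w /\ A (param c w)].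
Proof.
move=> oA; rewrite openE => z [zc zA].
have H1 : nbhs z (cod c) := open_nbhs_nbhs (conj (@cod_open _ _ M c) zc).
have H2 : nbhs z (param c @^-1` A).
  by apply: (param_continuous zc); apply: open_nbhs_nbhs.
exact: (filterS _ (@filterI _ (nbhs z) _ _ _ H1 H2)).
Qed.

(** Extension by zero. Since [K] is closed, every point of [M] lies in the chart
    [c] or in the open complement of [K], where the extension vanishes. *)
Lemma potential_extend c (K : set M) (F LF : V -> R) : closed K -> K `<=` dom c ->
  smooth (cod c) (fun w => RC (F w)) ->
  (forall z, cod c z -> lap c (fun w => RC (F w)) z = RC (LF z)) ->
  (forall q, dom c q -> ~ K q -> F (coord c q) = 0) ->
  potential (fun q => if `[< dom c q >] then F (coord c q) else 0)
            (fun q => if `[< dom c q >] then LF (coord c q) else 0).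
Proof.
move=> cK Kc FC FL F0; set f := fun q => _; set L := fun q => _.
have oU := @cod_open _ _ M c; have oK : open (~` K) by exact: closed_openC.
have fE q : dom c q -> f q = F (coord c q) by move=> cq; rewrite /f asboolT.
have f0 q : ~ K q -> f q = 0.
  by move=> Kq; rewrite /f; case: asboolP => // cq; exact: F0.
have LE q : dom c q -> L q = LF (coord c q) by move=> cq; rewrite /L asboolT.
have LF0 z : cod c z -> ~ K (param c z) -> LF z = 0.
  move=> zc zK; have oW := @open_param c _ oK.
  have E w : [set w | cod c w /\ (~` K) (param c w)] w -> RC 0 = RC (F w).
    by move=> [wc wK]; have := F0 _ (param_dom wc) wK; rewrite (paramK wc) => ->.
  have e := lap_ext c oW (conj zc zK) (smooth_cst (RC 0) oW) E.
  by have := FL z zc; rewrite -e lap_cst => /(congr1 (@complex.Re R)).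
have L0 q : ~ K q -> L q = 0.
  move=> Kq; rewrite /L; case: asboolP => // cq.
  by apply: LF0; [exact: cod_coord|rewrite coordK].
have fover d w : overlap d c w -> RC (F (trans d c w)) = RC (f (param d w)).
  by move=> wo; rewrite fE //; exact: overlap_param wo.
have Cover d : smooth (overlap d c) (fun w => RC (F (trans d c w))).
  exact: (smooth_comp oU (@open_overlap _ _ M d c) (@trans_cod _ _ M d c) FC
    (@trans_smooth _ _ M d c)).
have case_z d z : cod d z -> overlap d c z \/ ~ K (param d z).
  move=> zd; have [zc|zc] := pselect (dom c (param d z)).
    by left; exact: overlapE.
  by right => /Kc.
have fout d w : [set w | cod d w /\ (~` K) (param d w)] w -> RC 0 = RC (f (param d w)).
  by move=> [wd wK]; rewrite f0.
split=> [d|q|d z zd].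
- apply: smooth_local => z zd; have [zo|zK] := case_z d z zd.
    exists (overlap d c) => //.
    exact: (smooth_ext (@open_overlap _ _ M d c) (fover d) (Cover d)).
  exists [set w | cod d w /\ (~` K) (param d w)] => //.
  have oW := @open_param d _ oK.
  exact: (smooth_ext oW (fout d) (smooth_cst (RC 0) oW)).
- have [cq|cq] := pselect (dom c q).
    have Lq : {for q, continuous (fun q => Re (lap c (fun w => RC (F w)) (coord c q)))}.
      apply: cont_Re; exact: (continuous_comp (@Defs.coord_continuous _ _ M c q cq)
        (smooth_cont (smooth_lap FC) (cod_coord cq))).
    have nr : \forall p \near q, Re (lap c (fun w => RC (F w)) (coord c p)) = L p.
      apply: filterS (open_nbhs_nbhs (conj (@dom_open _ _ M c) cq)) => p cp.
      by rewrite FL ?LE //; exact: cod_coord.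
    exact: (continuous_near nr Lq).
  have Kq : ~ K q by move=> /Kc.
  have nr : \forall p \near q, (0 : R) = L p.
    by apply: filterS (open_nbhs_nbhs (conj oK Kq)) => p pK; rewrite L0.
  by apply: (continuous_near nr); exact: cst_continuous.
have [zo|zK] := case_z d z zd.
  rewrite -(lap_ext d (@open_overlap _ _ M d c) zo (Cover d) (fover d)).
  rewrite (lap_change FC zo) FL; last exact: trans_cod.
  by rewrite LE //; exact: overlap_param zo.
have oW := @open_param d _ oK.
rewrite -(lap_ext d oW (conj zd zK) (smooth_cst (RC 0) oW) (fout d)) lap_cst.
by rewrite L0.
Qed.

End Laplacian.

(** * The Hopf barrier *)

Section Ball.
Variables (R : realType) (n : nat).
Notation V := 'rV[Cplx R]_n.

Lemma sqdist_ge0 (y w : V) : 0 <= sqdist y w.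
Proof. by apply: sumr_ge0 => a _; rewrite addr_ge0 // sqr_ge0. Qed.

Lemma sqdistxx (y : V) : sqdist y y = 0.
Proof. by apply: big1 => a _; rewrite subrr /= expr0n addr0. Qed.

Lemma sqdistC (y w : V) : sqdist y w = sqdist w y.
Proof.
apply: eq_bigr => a _; rewrite -[y 0 a - w 0 a]opprB ReN ImN.
by rewrite !sqrrN.
Qed.

Lemma sqdist_cont (y w : V) : {for w, continuous (sqdist y)}.
Proof.
have := smooth_cont (smooth_sqdist y (@openT V)) (I : setT w).
by move=> /cont_Re.
Qed.

Lemma sqdist_coord (y w : V) a :
  Re (w 0 a - y 0 a) ^+ 2 + Im (w 0 a - y 0 a) ^+ 2 <= sqdist y w.
Proof.
rewrite /sqdist (bigD1 a) //= lerDl; apply: sumr_ge0 => b _.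
by rewrite addr_ge0 // sqr_ge0.
Qed.

Lemma abs_le_sqrD1 (r e : R) : r ^+ 2 <= e -> `|r| <= e + 1.
Proof.
move=> re; have : 0 <= (`|r| - 1) ^+ 2 by exact: sqr_ge0.
have : `|r| ^+ 2 = r ^+ 2 by rewrite real_normK ?num_real.
have := normr_ge0 r; move: (`|r|) => x x0 xr; nra.
Qed.

(** A closed subset of a product of compact squares. *)
Lemma compact_sqdist_ball (y : V) (e : R) : compact [set w : V | sqdist y w <= e].
Proof.
pose D (a : 'I_n) : set (Cplx R) := (fun p : R * R => y 0 a + (RC p.1 + 'i * RC p.2)) @`
  (`[- (e + 1), e + 1]%classic `*` `[- (e + 1), e + 1]%classic).
have Dc a : compact (D a).
  apply: continuous_compact.
    apply: continuous_subspaceT => p.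
    apply: (cvgD (cvg_cst _)); apply: cvgD.
      by apply: (continuous_cvg _ (@continuous_RC R p.1)); exact: cvg_fst.
    apply: (cvgM (cvg_cst _)).
    by apply: (continuous_cvg _ (@continuous_RC R p.2)); exact: cvg_snd.
  by apply: compact_setX; exact: segment_compact.
apply: (subclosed_compact _ (rV_compact Dc)).
  rewrite -[X in closed X]/((sqdist y) @^-1` [set t | t <= e]).
  apply: (closed_comp _ (@closed_le R e)) => w _; exact: sqdist_cont.
move=> w /= we a.
have wa := le_trans (sqdist_coord y w a) we.
exists (Re (w 0 a - y 0 a), Im (w 0 a - y 0 a)).
  split; rewrite /= in_itv /= -ler_norml; apply: abs_le_sqrD1; apply: le_trans wa.
    by rewrite lerDl sqr_ge0.
  by rewrite lerDr sqr_ge0.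
by rewrite /= -cplxE addrC subrK.
Qed.

(** The topology is that of the sup norm, but Euclidean balls also form a basis
    of neighborhoods. *)
Lemma nbhs_sqdist (y : V) (A : set V) : nbhs y A ->
  exists2 e : R, 0 < e & forall w, sqdist y w < e -> A w.
Proof.
move=> /nbhs_ballP[e' /= /gt0_RC[e e0 ->] eA].
exists (e ^+ 2); first by rewrite exprn_gt0.
move=> w we; apply: eA; split; first by rewrite RC_gt0.
move=> i j; rewrite (ord1 i) -ball_normE /=.
have wa := le_lt_trans (sqdist_coord y w j) we.
rewrite distrC normE RC_lt -ltr_sqr ?nnegrE ?sqrtr_ge0 ?(ltW e0) // sqr_sqrtr //.
by rewrite addr_ge0 // sqr_ge0.
Qed.

Lemma sqdist_nbhs (y : V) (e : R) : 0 < e -> nbhs y [set w | sqdist y w < e].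
Proof.
move=> e0; apply: filterS (cont_near e0 (@sqdist_cont y y)) => w.
by rewrite sqdistxx sub0r normrN ger0_norm // sqdist_ge0.
Qed.

(** The parallelogram inequality [|a + b|^2 <= 2 |a|^2 + 2 |b|^2] stands in for
    the triangle inequality, as distances are squared. *)
Lemma sqdist_triangle (x y w : V) (e : R) :
  sqdist x y < e -> sqdist y w <= e -> sqdist x w < 4 * e.
Proof.
move=> xy yw.
have par (a b : R) : (a + b) ^+ 2 <= 2 * a ^+ 2 + 2 * b ^+ 2.
  by have := sqr_ge0 (a - b); nra.
suff H : sqdist x w <= 2 * sqdist x y + 2 * sqdist y w by lra.
rewrite /sqdist !mulr_sumr -big_split; apply: ler_sum => a _ /=.
have -> : w 0 a - x 0 a = (y 0 a - x 0 a) + (w 0 a - y 0 a) by rewrite [RHS]addrC subrKA.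
move: (y 0 a - x 0 a) (w 0 a - y 0 a) => p q; rewrite ReD ImD.
have := par (Re p) (Re q); have := par (Im p) (Im q).
move: (Re p) (Re q) (Im p) (Im q) => p1 q1 p2 q2 h1 h2; lra.
Qed.

End Ball.

Section Hopf.
Variables (R : realType) (n : nat) (M : complexManifold R n) (gt : hermitianMetric M).
Notation V := 'rV[Cplx R]_n.
Implicit Types (c d : atlas M) (q : M) (z : V).

Lemma invmx_herm r (G : 'M[Cplx R]_r) : adjm G = G -> posdef G ->
  adjm (invmx G) = invmx G /\ posdef (invmx G).
Proof.
move=> GG Gp; have Gu := posdef_unit Gp.
have Ih : adjm (invmx G) = invmx G.
  by apply: (can_inj (mulKmx Gu)); rewrite mulmxV // -{1}GG -adjmM mulVmx // adjm1.
split=> // v v0.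
have -> : invmx G = invmx G *m G *m adjm (invmx G) by rewrite Ih mulVmx // mul1mx.
rewrite hform_congr; apply: Gp; apply: contra v0 => /eqP vI.
by rewrite -(mulmxKV Gu v) vI mul0mx.
Qed.

Lemma RC_Re (x : Cplx R) : Im x = 0 -> RC (Re x) = x.
Proof. by move=> x0; apply: Cplx_ext. Qed.

Section Barrier.
Variables (c : atlas M) (y : V) (rho s : R).
Hypothesis s0 : 0 < s.

Let u (w : V) : R := rho - sqdist y w.
Let F (w : V) : R := - flat s 0 (u w).
Let T z : R := Re (\sum_k ginv (gt c z) k k).
Let Q z : R := Re (hform (invmx (gt c z)) (z - y)).

Lemma smooth_barrier U : open U -> smooth U (fun w => RC (F w)).
Proof.
move=> oU; have uC : smooth U (fun w => RC (u w)).
  have H := smoothD oU (smooth_cst (RC rho) oU) (smoothN oU (smooth_sqdist y oU)).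
  by apply: (smooth_eqf H); apply: funext => w; rewrite /u RCD RCN.
have H := smoothN oU (smooth_ucomp oU (fun m => uCk_flat m 0 s0) uC).
by apply: (smooth_eqf H); apply: funext => w; rewrite /F RCN.
Qed.

Lemma ddbar_barrier k l z : wirt false k (wirt true l (fun w => RC (F w))) z =
  RC (s * flat s 2 (u z)) * (l == k)%:R
  - RC (s * (s * flat s 4 (u z) - 2 * flat s 3 (u z))) * ((z - y) 0 l * ((z - y) 0 k)^*).
Proof.
have uE : (fun w => RC (u w)) = fun w => RC rho + - RC (sqdist y w).
  by apply: funext => w; rewrite /u RCD RCN.
have sqd w : rd (fun w => RC (sqdist y w)) w := smooth_rd (smooth_sqdist y (@openT V)) (I : setT w).
have ud w : rd (fun w => RC (u w)) w by rewrite uE; exact: (rdD (rd_cst (RC rho) w) (rdN (sqd w))).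
have wu b k' w : wirt b k' (fun w => RC (u w)) w = - (if b then w 0 k' - y 0 k' else (w 0 k' - y 0 k')^*).
  rewrite uE (wirtD b k' (rd_cst (RC rho) w) (rdN (sqd w))) wirt_cst add0r (wirtN b k' (sqd w)).
  by rewrite wirt_sqdist.
pose p1 t := s * flat s 2 t; pose p2 t := s * (s * flat s 4 t - 2 * flat s 3 t).
have dp0 t : Rder (flat s 0) t (p1 t).
  by apply: (is_derive_eqf (Rder_flat 0 t s0)) => //; rewrite /p1 oppr0 mul0r add0r.
have dp1 t : Rder p1 t (p2 t).
  apply: (is_derive_eqf (is_deriveM (is_derive_cst s _ _) (Rder_flat 2 t s0))) => //.
  rewrite scaler0 addr0 /p2 /GRing.scale /=; ring.
have fd w : rd (fun w => RC (flat s 0 (u w))) w := rd_ucomp dp0 (ud w).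
have e1 : wirt true l (fun w => RC (F w)) = fun w => RC (p1 (u w)) * (w 0 l - y 0 l).
  apply: funext => w.
  rewrite (_ : (fun w => RC (F w)) = fun w => - RC (flat s 0 (u w))); last first.
    by apply: funext => w'; rewrite /F RCN.
  by rewrite (wirtN true l (fd w)) (wirt_ucomp true l dp0 (ud w)) wu mulrN opprK.
rewrite e1 (wirtM false k (rd_ucomp dp1 (ud z)) (rd_shift y l z)) (wirt_ucomp false k dp1 (ud z)).
rewrite wu wirt_shift /= addrC; congr (_ + _).
by rewrite -/(p2 (u z)) !mxE mulrN mulNr -mulrA [(_)^* * _]mulrC.
Qed.

(** With [u = rho - |z - y|^2] and [chi = e^(-s/t)], the Laplacian of [- chi(u)]
    is [chi'(u) tr gt^-1 - chi''(u) |du|^2], the norm being that of [gt]. Here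
    [chi' = s flat 2] and [chi'' = s (s flat 4 - 2 flat 3)]. *)
Lemma lap_barrier z : cod c z -> lap gt c (fun w => RC (F w)) z =
  RC (s * (flat s 2 (u z) * T z - (s * flat s 4 (u z) - 2 * flat s 3 (u z)) * Q z)).
Proof.
move=> zc.
have [Ih Ip] := invmx_herm (gram_adjm gt zc) (gram_posdefP gt zc).
have Qr : RC (Q z) = hform (invmx (gt c z)) (z - y) by apply: RC_Re; exact: Im_hform.
have Tr : RC (T z) = \sum_k ginv (gt c z) k k.
  apply: RC_Re; rewrite Im_sum big1 // => k _.
  have := congr1 (fun A : 'M[Cplx R]_n => Im (A k k)) Ih.
  by rewrite adjmE Im_conj => /eqP; rewrite eqNr => /eqP.
rewrite mulrBr RCD RCN !mulrA !RCM -!RCM.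
set a := RC (s * flat s 2 (u z)).
set b := RC (s * (s * flat s 4 (u z) - 2 * flat s 3 (u z))).
have -> : RC (s * flat s 2 (u z) * T z) = a * \sum_k ginv (gt c z) k k.
  by rewrite -Tr -RCM.
have -> : RC (s * (s * flat s 4 (u z) - 2 * flat s 3 (u z)) * Q z) = b * hform (invmx (gt c z)) (z - y).
  by rewrite -Qr -RCM.
rewrite /lap.
have H k l := ddbar_barrier k l z.
apply: etrans (eq_bigr _ (fun k _ => eq_bigr _ (fun l _ =>
  congr1 (fun x => ginv (gt c z) k l * x) (H k l)))) _.
rewrite -/a -/b; clear H Tr Qr; clearbody a b; move: (z - y) => zeta.
have alg (G : 'M[Cplx R]_n) : \sum_k \sum_l ginv G k l * (a * (l == k)%:R - b * (zeta 0 l * (zeta 0 k)^*))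
    = a * (\sum_k ginv G k k) - b * hform (invmx G) zeta.
  transitivity (\sum_k (a * ginv G k k - b * \sum_l invmx G l k * zeta 0 l * (zeta 0 k)^*)).
    apply: eq_bigr => k _.
    have dg : \sum_l ginv G k l * (l == k)%:R = ginv G k k.
      rewrite (bigD1 k) //= eqxx mulr1 big1 ?addr0 // => l /negbTE ->.
      by rewrite mulr0.
    rewrite -dg !mulr_sumr -sumrB; apply: eq_bigr => l _.
    by rewrite /ginv; ring.
  by rewrite sumrB -!mulr_sumr /hform exchange_big.
exact: alg.
Qed.

End Barrier.

End Hopf.

Section HopfLemma.
Variables (R : realType) (n : nat) (M : complexManifold R n) (gt : hermitianMetric M).
Notation V := 'rV[Cplx R]_n.
Implicit Types (c d : atlas M) (q : M) (z : V).

Lemma compact_lower_bound (T : topologicalType) (A : set T) (f : T -> R) :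
  compact A -> (forall x, A x -> {for x, continuous f}) -> (forall x, A x -> 0 < f x) ->
  exists2 k : R, 0 < k & forall x, A x -> k <= f x.
Proof.
move=> Ac fc fp; have [[x0 Ax0]|A0] := pselect (A !=set0); last first.
  by exists 1 => // x Ax; exfalso; apply: A0; exists x.
have fw : {within A, continuous f}.
  by apply: continuous_in_subspaceT => x; rewrite inE; exact: fc.
have [x xA xm] := compact_EVT_min (ex_intro _ x0 Ax0) Ac fw.
exists (f x); first by apply: fp; rewrite inE in xA.
by move=> t At; apply: xm; rewrite inE.
Qed.

Lemma compact_upper_bound (T : topologicalType) (A : set T) (f : T -> R) :
  compact A -> (forall x, A x -> {for x, continuous f}) ->
  exists2 k : R, 0 < k & forall x, A x -> f x <= k.
Proof.
move=> Ac fc; have [[x0 Ax0]|A0] := pselect (A !=set0); last first.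
  by exists 1 => // x Ax; exfalso; apply: A0; exists x.
have fw : {within A, continuous f}.
  by apply: continuous_in_subspaceT => x; rewrite inE; exact: fc.
have [x xA xm] := compact_EVT_max (ex_intro _ x0 Ax0) Ac fw.
exists (`|f x| + 1); first by rewrite ltr_wpDl.
move=> t At; apply: (le_trans (xm t _)); first by rewrite inE.
by rewrite (le_trans (ler_norm _)) // lerDl.
Qed.

(** The barrier is [- e^(-s / (rho - |z - y|^2))]. Away from the center [y] the
    gradient of [|z - y|^2] does not vanish, so for large [s] the second
    derivative of the exponential, of order [s^2], dominates the first, of order
    [s]. Flatness makes the extension by zero smooth. *)
Lemma hopf_barrier c (y : V) (rho delta : R) : 0 < delta ->
  [set w : V | sqdist y w <= rho] `<=` cod c ->
  exists f L, [/\ potential gt f L,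
    (forall q, (dom c q -> delta <= sqdist y (coord c q)) -> L q <= 0)
  & (forall q, dom c q -> delta <= sqdist y (coord c q) -> sqdist y (coord c q) < rho ->
      L q < 0)].
Proof.
move=> d0 Bc; set B := [set w : V | _] in Bc.
have oU := @cod_open _ _ M c.
have Bcomp : compact B := @compact_sqdist_ball _ _ y rho.
pose T z : R := Re (\sum_k ginv (gt c z) k k).
pose Q z : R := Re (hform (invmx (gt c z)) (z - y)).
have IC := msm_inv oU (gram_msm gt c) (@gram_unit _ _ _ gt c).
have Tc z : cod c z -> {for z, continuous T}.
  move=> zc; apply: cont_Re; apply: (smooth_cont _ zc).
  by apply: (smooth_sum _ _ oU) => k; exact: IC.
have sC a : smooth (cod c) (fun z : V => (z - y) 0 a).
  have H := smoothD oU (smooth_coord a oU) (smooth_cst (- y 0 a) oU).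
  by apply: (smooth_eqf H); apply: funext => w; rewrite !mxE.
have Qc z : cod c z -> {for z, continuous Q}.
  move=> zc; apply: cont_Re; apply: (smooth_cont _ zc).
  apply: (smooth_sum _ _ oU) => k; apply: (smooth_sum _ _ oU) => l.
  exact: (smoothM oU (smoothM oU (IC k l) (sC k)) (smooth_conj oU (sC l))).
pose A := B `&` [set w : V | delta <= sqdist y w].
have Acomp : compact A.
  apply: (subclosed_compact _ Bcomp); last by move=> w [].
  apply: closedI; first exact: (compact_closed (@norm_hausdorff _ _) Bcomp).
  rewrite -[X in closed X]/((sqdist y) @^-1` [set t | delta <= t]).
  by apply: (closed_comp _ (@closed_ge R delta)) => w _; exact: sqdist_cont.
have [kap kap0 Qk] : exists2 k : R, 0 < k & forall w, A w -> k <= Q w.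
  apply: (compact_lower_bound Acomp) => w [wB wd]; first exact: (Qc w (Bc w wB)).
  have wc := Bc w wB.
  have [_ Ip] := invmx_herm (gram_adjm gt wc) (gram_posdefP gt wc).
  have wy : w - y != 0.
    apply/eqP => /eqP; rewrite subr_eq0 => /eqP wy.
    by move: wd; rewrite /= wy sqdistxx leNgt d0.
  by have := Ip _ wy; rewrite ltcplx => /andP[].
have [Tm Tm0 Tb] := compact_upper_bound Bcomp (fun w wB => Tc w (Bc w wB)).
pose r : R := `|rho| + 1.
(* Up to the positive factor [s flat 4 u], the Laplacian is
   [u^2 T - (s - 2 u) Q], where [u <= r], [T <= Tm] on the ball and [kap <= Q]
   off the center; this value of [s] makes it negative. *)
pose s : R := 2 * r + r ^+ 2 * Tm / kap + 1.
have r1 : 1 <= r by rewrite /r lerDr.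
have s0 : 0 < s.
  rewrite /s; apply: ltr_wpDl => //; apply: addr_ge0; first lra.
  by rewrite divr_ge0 ?(ltW kap0) // mulr_ge0 ?sqr_ge0 // ltW.
pose K := param c @` B.
have Kcomp : compact K.
  apply: (continuous_compact _ Bcomp); apply: continuous_in_subspaceT => w.
  by rewrite inE => /Bc wc; exact: (param_continuous wc).
have Kcl : closed K := compact_closed (@carrier_hausdorff _ _ M) Kcomp.
have Kdom : K `<=` dom c by move=> q [w /Bc wc <-]; exact: param_dom.
pose u (w : V) : R := rho - sqdist y w.
have uK q : dom c q -> ~ K q -> u (coord c q) <= 0.
  move=> cq Kq; rewrite /u subr_le0 leNgt; apply/negP => lt; apply: Kq.
  by exists (coord c q); [exact: ltW|rewrite coordK].
have pot := potential_extend (gt := gt) Kcl Kdom (smooth_barrier y rho s0 oU)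
  (lap_barrier (c := c) gt y rho s0) (fun q cq Kq => etrans (congr1 -%R (flat_le0 s 0 (uK q cq Kq))) (oppr0 R)).
have neg w : cod c w -> delta <= sqdist y w ->
    s * (flat s 2 (u w) * T w - (s * flat s 4 (u w) - 2 * flat s 3 (u w)) * Q w) <= 0 /\
    (sqdist y w < rho ->
    s * (flat s 2 (u w) * T w - (s * flat s 4 (u w) - 2 * flat s 3 (u w)) * Q w) < 0).
  move=> wc wd; have [wr|wr] := ltP (sqdist y w) rho; last first.
    have u0 : u w <= 0 by rewrite /u subr_le0.
    rewrite !(flat_le0 _ _ u0) !mulr0 subrr !mul0r subrr mulr0; split; first exact: lexx.
    by [].
  suff H : s * (flat s 2 (u w) * T w - (s * flat s 4 (u w) - 2 * flat s 3 (u w)) * Q w) < 0.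
    by split=> //; exact: ltW.
  have t0 : 0 < u w by rewrite /u subr_gt0.
  have tr : u w <= r.
    rewrite /u /r; have := sqdist_ge0 y w; have := ler_norm rho; lra.
  have Bw : B w by exact: ltW.
  have Qw := Qk w (conj Bw wd); have Tw := Tb w Bw.
  rewrite (flatS s 2) (flatS s 3); have f4 := flat_gt0 s 4 t0.
  have -> : s * (u w * (u w * flat s 4 (u w)) * T w - (s * flat s 4 (u w) - 2 * (u w * flat s 4 (u w))) * Q w)
    = (s * flat s 4 (u w)) * (u w ^+ 2 * T w - (s - 2 * u w) * Q w) by ring.
  rewrite pmulr_rlt0 ?mulr_gt0 // subr_lt0.
  move: (u w) (T w) (Q w) t0 tr Qw Tw => t a b t0 tr bk aT.
  apply: (@le_lt_trans _ _ (r ^+ 2 * Tm)).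
    apply: (@le_trans _ _ (t ^+ 2 * Tm)); first by rewrite ler_wpM2l // sqr_ge0.
    by rewrite ler_wpM2r ?(ltW Tm0) // ler_sqr ?nnegrE ?(ltW t0) // (le_trans (ltW t0)).
  apply: (@lt_le_trans _ _ ((s - 2 * r) * kap)).
    have -> : (s - 2 * r) * kap = r ^+ 2 * Tm + kap.
      by rewrite /s; field; rewrite gt_eqF.
    by rewrite ltrDl.
  have s2 : 0 <= s - 2 * r.
    have X0 : 0 <= r ^+ 2 * Tm / kap.
      by rewrite divr_ge0 ?(ltW kap0) // mulr_ge0 ?sqr_ge0 // ltW.
    rewrite /s; move: (r ^+ 2 * Tm / kap) X0 => X X0; lra.
  apply: (@le_trans _ _ ((s - 2 * r) * b)); first by rewrite ler_wpM2l.
  by rewrite ler_wpM2r ?(le_trans (ltW kap0)) //; lra.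
pose f (q : M) : R := if `[< dom c q >] then - flat s 0 (u (coord c q)) else 0.
pose LF w := s * (flat s 2 (u w) * T w - (s * flat s 4 (u w) - 2 * flat s 3 (u w)) * Q w).
pose L (q : M) : R := if `[< dom c q >] then LF (coord c q) else 0.
exists f, L; split; first exact pot.
- move=> q qd; rewrite /L; case: asboolP => // cq.
  by have [] := neg (coord c q) (cod_coord cq) (qd cq).
move=> q cq qd qr; rewrite /L asboolT //.
have [_] := neg (coord c q) (cod_coord cq) qd; exact.
Qed.

End HopfLemma.

(** * Propagation of strict superharmonicity *)

Section Propagation.
Variables (R : realType) (n : nat) (M : complexManifold R n) (gt : hermitianMetric M).
Variables (N : set M) (mu : R).
Notation V := 'rV[Cplx R]_n.
Hypotheses (oN : open N) (mu0 : 0 < mu).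
Hypotheses (Mcompact : compact [set: M]) (Mconn : connected [set: M]).

Definition lam (q : M) : R := if `[< N q >] then mu else 0.

Lemma lam_ge0 q : 0 <= lam q.
Proof. by rewrite /lam; case: ifP => // _; exact: ltW. Qed.

(** The function [lam] is lower semicontinuous, because [N] is open. *)
Lemma near_lt_lam (L : M -> R) q (m : R) : {for q, continuous L} -> L q + m < lam q ->
  \forall p \near q, L p + m < lam p.
Proof.
move=> Lc lt; pose e : R := lam q - (L q + m).
have e0 : 0 < e by rewrite subr_gt0.
have H := cont_near e0 Lc.
have close p : `|L q - L p| < e -> L p + m < lam q.
  by rewrite distrC => /ltr_normlW; rewrite /e; lra.
have [Nq|Nq] := pselect (N q).
  apply: (filterS2 _ _ H (open_nbhs_nbhs (conj oN Nq))) => p /close pl Np.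
  by apply: (lt_le_trans pl); rewrite /lam !asboolT.
apply: (filterS _ H) => p /close pl; apply: (lt_le_trans pl).
by rewrite {1}/lam asboolF // lam_ge0.
Qed.

Definition admissible (f L : M -> R) := potential gt f L /\ forall q, L q <= lam q.

Definition reached : set M := [set x | exists f L, admissible f L /\ L x < lam x].

Lemma reached_open : open reached.
Proof.
rewrite openE => x [f [L [[pot le] lt]]].
have [_ Lc _] := pot.
have lt0 : L x + 0 < lam x by rewrite addr0.
apply: filterS (near_lt_lam (Lc x) lt0) => p; rewrite addr0 => plt.
by exists f, L.
Qed.

(** Hopf's argument. A limit [x] of reached points lies in a small ball around a
    reached point [q]. The barrier centered at [q] is added with a small factor:
    near [q] the strict inequality absorbs it, elsewhere it does not increase the
    Laplacian, and at [x] it decreases it. *)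
Lemma reached_closed : closed reached.
Proof.
move=> x clx; have [c cx] := dom_cover x.
have xc := cod_coord cx; set zx := coord c x in xc.
have [e e0 eU] := nbhs_sqdist (open_nbhs_nbhs (conj (@cod_open _ _ M c) xc)).
(* A ball of squared radius [e / 4] around a point of the same ball around [x]
   stays inside the chart. *)
pose rho : R := e / 4; have rho0 : 0 < rho by rewrite divr_gt0.
have near_x : \forall q \near x, dom c q /\ sqdist zx (coord c q) < rho.
  have H1 : nbhs x (dom c) := open_nbhs_nbhs (conj (@dom_open _ _ M c) cx).
  have H2 : nbhs x (coord c @^-1` [set w | sqdist zx w < rho]).
    exact: (@Defs.coord_continuous _ _ M c x cx _ (sqdist_nbhs zx rho0)).
  exact: (@filterI _ (nbhs x) _ _ _ H1 H2).
have [q [[f1 [L1 [[pot1 le1] lt1]]] [cq qx]]] := clx _ near_x.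
set y := coord c q in qx; have yc : cod c y := cod_coord cq.
have Bc : [set w : V | sqdist y w <= rho] `<=` cod c.
  move=> w /= wy; apply: eU; have := sqdist_triangle qx wy.
  by rewrite /rho mulrC divfK.
(* Half of the gap at [q]: a gap of at least this size remains on a ball around
     [q], and the barrier has to stay below it. *)
pose m : R := (lam q - L1 q) / 2.
have m0 : 0 < m by rewrite divr_gt0 // subr_gt0.
have [_ L1c _] := pot1.
have lt1m : L1 q + m < lam q by rewrite /m; lra.
have H := near_lt_lam (L1c q) lt1m.
have Hy : nbhs y (param c @^-1` [set p | L1 p + m < lam p]).
  apply: (param_continuous yc); rewrite coordK //; exact: H.
have [dl dl0 dlU] := nbhs_sqdist Hy.
have inner p : dom c p -> sqdist y (coord c p) < dl -> L1 p + m < lam p.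
  by move=> cp /dlU /=; rewrite coordK.
have [f2 [L2 [pot2 le2 lt2]]] := hopf_barrier gt dl0 Bc.
have [_ L2c _] := pot2.
have [b b0 L2b] := compact_upper_bound Mcompact (fun p _ => L2c p).
(* [L2] is bounded by [b] on the compact [M], so that [ep * L2 < m] everywhere. *)
pose ep : R := m / (b + 1).
have b1 : 0 < b + 1 by rewrite addr_gt0.
have ep0 : 0 < ep by rewrite divr_gt0.
have epm p : ep * L2 p < m.
  apply: (@le_lt_trans _ _ (ep * b)); first by rewrite ler_pM2l //; exact: L2b.
  by rewrite /ep mulrAC ltr_pdivrMr // ltr_pM2l // ltrDl.
exists (fun p => 1 * f1 p + ep * f2 p), (fun p => 1 * L1 p + ep * L2 p).
have inner' p : dom c p -> sqdist y (coord c p) < dl -> 1 * L1 p + ep * L2 p < lam p.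
  move=> cp pd; apply: lt_trans (inner p cp pd); rewrite mul1r ltrD2l; exact: epm.
have outer p : (dom c p -> dl <= sqdist y (coord c p)) -> 1 * L1 p + ep * L2 p <= L1 p.
  by move=> pd; rewrite mul1r gerDl pmulr_rle0 //; exact: le2.
split.
  split; first exact: potential_comb.
  move=> p; have [[cp pd]|np] := pselect (dom c p /\ sqdist y (coord c p) < dl).
    by apply/ltW/inner'.
  apply: (le_trans (outer p _) (le1 p)) => cp; rewrite leNgt; apply/negP => pd.
  exact: np.
have [xd|xd] := ltP (sqdist y zx) dl; first exact: inner'.
apply: (lt_le_trans _ (le1 x)); rewrite mul1r gtrDl pmulr_rlt0 //.
by apply: lt2 => //; rewrite sqdistC.
Qed.

Lemma reached_all x : N !=set0 -> reached x.
Proof.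
move=> [q0 Nq0].
have ne : reached !=set0.
  exists q0, (fun=> 0), (fun=> 0); split; last by rewrite /lam asboolT.
  split; first exact: potential0.
  by move=> q; exact: lam_ge0.
have -> : reached = [set: M]; last by [].
apply: (Mconn ne); [exists reached|exists reached]; rewrite ?setTI //.
  exact: reached_open.
exact: reached_closed.
Qed.

(** Compactness: admissible pairs can be averaged, and an average is strict
    wherever one of its terms is. *)
Lemma strict_potential : N !=set0 ->
  exists f L, potential gt f L /\ forall q, L q < lam q.
Proof.
move=> N0.
pose good (U : set M) := exists f L, admissible f L /\ forall q, U q -> L q < lam q.
have good0 : good set0.
  exists (fun=> 0), (fun=> 0); split=> //; split; first exact: potential0.
  by move=> q; exact: lam_ge0.
have goodU U U' : good U -> good U' -> good (U `|` U').
  move=> [f [L [[pot le] lt]]] [f' [L' [[pot' le'] lt']]].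
  exists (fun q => 2^-1 * f q + 2^-1 * f' q), (fun q => 2^-1 * L q + 2^-1 * L' q).
  split; first split; first exact: potential_comb.
    by move=> q; have := le q; have := le' q; lra.
  by move=> q [/lt|/lt'] lq; have := le q; have := le' q; lra.
(* If [M] is not good, the complements of the good sets generate a proper
   filter, and it has a cluster point. But every point has a good neighborhood. *)
suff [f [L [[pot _] lt]]] : good [set: M] by exists f, L; split=> // q; exact: lt.
apply: contrapT => ngood.
pose F : set_system M := [set A | exists2 U, good U & ~` U `<=` A].
have FF : ProperFilter F.
  split.
    move=> [U gU sub]; apply: ngood.
    suff -> : [set: M] = U by [].
    by apply/seteqP; split=> // q _; apply: contrapT => /sub.
  split.
  - by exists set0.
  - move=> A B [U gU UA] [U' gU' UB]; exists (U `|` U'); first exact: goodU.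
    by move=> q nq; split; [apply: UA|apply: UB] => Uq; apply: nq; [left|right].
  by move=> A B AB [U gU UA]; exists U => // q /UA /AB.
have [x [_ clx]] := Mcompact FF (filterT : F setT).
have [f [L [[pot le] lt]]] := reached_all x N0.
have [_ Lc _] := pot.
have lt0 : L x + 0 < lam x by rewrite addr0.
have nx := near_lt_lam (Lc x) lt0.
have FU : F (~` [set p | L p + 0 < lam p]).
  exists [set p | L p + 0 < lam p] => //; exists f, L; split=> // q /=.
  by rewrite addr0.
by have [p [np lp]] := clx _ _ FU nx.
Qed.

End Propagation.

(** * Conformal change and conclusion *)

Section PosdefNear.
Variable R : realType.

Definition sqn (x : Cplx R) : R := Re x ^+ 2 + Im x ^+ 2.

(** From [|w_i w_j| <= (|w_i|^2 + |w_j|^2) / 2]. *)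
Lemma Re_hform_bound r (E : 'M[Cplx R]_r) (w : 'rV[Cplx R]_r) (e : R) :
  (forall i j, `|Re (E i j)| <= e /\ `|Im (E i j)| <= e) ->
  - (e * r%:R * 2 * \sum_i sqn (w 0 i)) <= Re (hform E w).
Proof.
move=> Ee; rewrite /hform Re_sum.
have alg (f : 'I_r -> R) : - (e * r%:R * 2 * \sum_i f i)
    = \sum_(i < r) \sum_(j < r) - (e * (f i + f j)).
  have cst (x : R) : \sum_(i < r) x = x *+ r by rewrite sumr_const card_ord.
  rewrite [RHS](eq_bigr (fun i => - (e * (f i *+ r + \sum_j f j)))) => [|i _].
    rewrite sumrN -mulr_sumr big_split /= cst sumrMnl.
    by move: (\sum_i _) => S; rewrite -mulr_natr; ring.
  by rewrite sumrN -mulr_sumr big_split /= cst.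
rewrite (alg (fun i => sqn (w 0 i))).
apply: ler_sum => i _; rewrite Re_sum; apply: ler_sum => j _.
have [] := Ee i j; rewrite !ler_norml => /andP[p1 p2] /andP[q1 q2].
rewrite -mulrA ReM ReM ImM Re_conj Im_conj /sqn.
move: (Re (E i j)) (Im (E i j)) (Re (w 0 i)) (Im (w 0 i)) (Re (w 0 j)) (Im (w 0 j)) p1 p2 q1 q2.
move=> p q a b c d p1 p2 q1 q2.
have h1 : `|a * c + b * d| <= (a ^+ 2 + b ^+ 2 + (c ^+ 2 + d ^+ 2)) / 2.
  rewrite ler_norml; apply/andP; split.
    by have := sqr_ge0 (a + c); have := sqr_ge0 (b + d); nra.
  by have := sqr_ge0 (a - c); have := sqr_ge0 (b - d); nra.
have h2 : `|b * c - a * d| <= (a ^+ 2 + b ^+ 2 + (c ^+ 2 + d ^+ 2)) / 2.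
  rewrite ler_norml; apply/andP; split.
    by have := sqr_ge0 (b + c); have := sqr_ge0 (a - d); nra.
  by have := sqr_ge0 (b - c); have := sqr_ge0 (a + d); nra.
have pe : `|p| <= e by rewrite ler_norml p1.
have qe : `|q| <= e by rewrite ler_norml q1.
have g1 : `|p * (a * c + b * d)| <= e * ((a ^+ 2 + b ^+ 2 + (c ^+ 2 + d ^+ 2)) / 2).
  by rewrite normrM ler_pM.
have g2 : `|q * (b * c - a * d)| <= e * ((a ^+ 2 + b ^+ 2 + (c ^+ 2 + d ^+ 2)) / 2).
  by rewrite normrM ler_pM.
move: g1 g2; rewrite !ler_norml => /andP[g1 _] /andP[_ g2].
have -> : p * (a * c - b * - d) - q * (a * - d + b * c)
  = p * (a * c + b * d) - q * (b * c - a * d) by ring.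
move: (p * _) (q * _) (a ^+ 2 + b ^+ 2 + (c ^+ 2 + d ^+ 2)) g1 g2 => x y S g1 g2.
have -> : e * S = e * (S / 2) + e * (S / 2) by field.
by rewrite opprD lerD // lerNl opprK.
Qed.

(** Positive definiteness is an open condition: once [A t0] is normalized to the
    identity, the nearby values differ from it by small entries. *)
Lemma posdef_near (T : topologicalType) r (A : T -> 'M[Cplx R]_r) (t0 : T) :
  (forall i j, {for t0, continuous (fun t => A t i j)}) ->
  adjm (A t0) = A t0 -> posdef (A t0) ->
  \forall t \near t0, forall v : 'rV[Cplx R]_r, v != 0 -> 0 < Re (hform (A t) v).
Proof.
move=> Ac AA Ap; have [C Cu AC] := posdef_factor AA Ap.
pose D := invmx C; pose S t := D *m A t *m adjm D.
have S0 : S t0 = 1%:M.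
  by rewrite /S AC mulmxA mulVmx // mul1mx -adjmM /D mulVmx // adjm1.
have Sc i j : {for t0, continuous (fun t => S t i j)}.
  rewrite (_ : (fun t => S t i j) = fun t => \sum_l (\sum_k D i k * A t k l) * adjm D l j).
    apply: cont_sum => l; apply: contM; last exact: cst_continuous.
    by apply: cont_sum => k; apply: contM; [exact: cst_continuous|exact: Ac].
  by apply: funext => t; rewrite mxE; apply: eq_bigr => l _; rewrite mxE.
(* Chosen so that the bound of [Re_hform_bound] is less than [|w|^2]. *)
pose e : R := (r%:R * 2 + 1)^-1.
have e0 : 0 < e by rewrite invr_gt0 ltr_wpDl // mulr_ge0.
have nr : \forall t \near t0, forall p : 'I_r * 'I_r,
    `|Re ((S t - 1%:M) p.1 p.2)| <= e /\ `|Im ((S t - 1%:M) p.1 p.2)| <= e.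
  apply: filter_forall => -[i j] /=.
  have H1 := cont_near e0 (cont_Re (Sc i j)).
  have H2 := cont_near e0 (cont_Im (Sc i j)).
  apply: (filterS2 _ _ H1 H2) => t; rewrite S0 => h1 h2.
  have -> : (S t - 1%:M) i j = S t i j - (1%:M : 'M[Cplx R]_r) i j by rewrite !mxE.
  by rewrite ReB ImB; split; rewrite distrC ltW.
apply: filterS nr => t bnd v v0.
have AE : A t = C *m S t *m adjm C.
  rewrite /S /D !mulmxA mulmxV // mul1mx -mulmxA -adjmM mulmxV // adjm1.
  by rewrite mulmx1.
rewrite AE hform_congr; set w := v *m C.
have w0 : w != 0 by apply: contra v0 => /eqP wz; rewrite -(mulmxK Cu v) -/w wz mul0mx.
have e2 : hform (S t) w = hform 1%:M w + hform (S t - 1%:M) w.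
  by rewrite -hformD [1%:M + _]addrC subrK.
have H1 : Re (hform 1%:M w) = \sum_i sqn (w 0 i).
  rewrite hformE mulmx1 mxE Re_sum; apply: eq_bigr => i _.
  by rewrite adjmE mulrC conj_norm_sqr.
have := hform1_gt0 w0; rewrite ltcplx H1 => /andP[_ sp].
have H2 := Re_hform_bound w (fun i j => bnd (i, j)).
rewrite e2 ReD H1; apply: (lt_le_trans _ (lerD (lexx _) H2)).
have {sp} : 0 < \sum_i sqn (w 0 i) by exact: sp.
move: (\sum_i sqn (w 0 i)) => s sp.
have e1 : e * r%:R * 2 = 1 - e.
  have n0 : r%:R * 2 + 1 != 0 :> R by rewrite gt_eqF // ltr_wpDl // mulr_ge0.
  by rewrite /e; field.
by rewrite e1 subr_gt0 mulrBl mul1r gtrBl mulr_gt0.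
Qed.

End PosdefNear.

Section Conformal.
Variables (R : realType) (n : nat).
Notation V := 'rV[Cplx R]_n.

Lemma msm_curv r (U : set V) (H : V -> 'M[Cplx R]_r) i j : open U -> msm U H ->
  (forall z, U z -> H z \in unitmx) -> msm U (curv H i j).
Proof.
move=> oU HC Hu a b.
have C1 := msm_mw false i oU (msm_mw true j oU HC).
have C2 := msm_mul oU (msm_mul oU (msm_mw false i oU HC) (msm_inv oU HC Hu)) (msm_mw true j oU HC).
apply: (smooth_eqf (smoothD oU (smoothN oU (C1 a b)) (C2 a b))).
by apply: funext => w; rewrite /curv [RHS]mxE opmxE.
Qed.

Lemma conformal_alg (F : fieldType) r (e d db ddb : F) (h dh dbh ddh : 'M[F]_r) :
  e != 0 -> h \in unitmx ->
  - ((e * d * db + e * ddb) *: h + (e * db) *: dh + (e * d) *: dbh + e *: ddh)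
  + ((e * d) *: h + e *: dh) *m invmx (e *: h) *m ((e * db) *: h + e *: dbh)
  = e *: (- ddh + dh *m invmx h *m dbh - ddb *: h).
Proof.
move=> e0 hu.
have -> : invmx (e *: h) = e^-1 *: invmx h.
  have ehu : e *: h \in unitmx by rewrite unitmxZ // unitfE.
  apply: (can_inj (mulKmx ehu)); rewrite mulmxV // -scalemxAl -scalemxAr scalerA.
  by rewrite mulfV // scale1r mulmxV.
have -> : ((e * d) *: h + e *: dh) *m (e^-1 *: invmx h) = d%:M + dh *m invmx h.
  rewrite -scalemxAr mulmxDl -!scalemxAl scalerDr !scalerA mulmxV //.
  by rewrite mulrA mulVf // mul1r scale1r scalemx1.
rewrite mulmxDl mul_scalar_mx mulmxDr -!scalemxAr mulmxKV //.
rewrite !scalerDr !scalerA !scalerN !opprD.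
apply/matrixP => a b; rewrite !mxE; ring.
Qed.

Lemma conformal_sum (F : fieldType) r (a a' b b' : F) (h k x y : 'M[F]_r) :
  a = a' -> b = b' -> a *: h + x + (b *: k + y) = a' *: h + x + b' *: k + y.
Proof. by move=> -> ->; rewrite addrA. Qed.

(** The first order terms of [F] cancel between the two parts of the curvature,
    and only its complex Hessian remains. *)
Lemma curv_conformal r (U : set V) (H : V -> 'M[Cplx R]_r) (F : V -> R) i j z :
  open U -> U z -> msm U H -> smooth U (fun w => RC (F w)) -> H z \in unitmx ->
  curv (fun w => RC (expR (F w)) *: H w) i j z
  = RC (expR (F z)) *: (curv H i j z - wirt false i (wirt true j (fun w => RC (F w))) z *: H z).
Proof.
move=> oU Uz HC FC Hu.
pose E w := RC (expR (F w)).
have EC : smooth U E := smooth_ucomp oU (@uCk_expR R) FC.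
have wE s k w : U w -> wirt s k E w = E w * wirt s k (fun w => RC (F w)) w.
  by move=> Uw; exact: (wirt_ucomp s k (fun t => is_derive_expR t) (smooth_rd FC Uw)).
have mwZ s k (f : V -> Cplx R) (A : V -> 'M[Cplx R]_r) w : rd f w -> mrd A w ->
    mw s k (fun w => f w *: A w) w = wirt s k f w *: A w + f w *: mw s k A w.
  move=> fd Ad; apply/matrixP => a b; rewrite mwE.
  have -> : (fun w => (f w *: A w) a b) = fun w => f w * A w a b.
    by apply: funext => w'; rewrite scmxE.
  by rewrite (wirtM s k fd (Ad a b)) [RHS]mxE !scmxE mwE.
have smZ (f : V -> Cplx R) (A : V -> 'M[Cplx R]_r) : smooth U f -> msm U A ->
    msm U (fun w => f w *: A w).
  move=> fC AC a b; apply: (smooth_eqf (smoothM oU fC (AC a b))).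
  by apply: funext => w; rewrite scmxE.
have d1 s k w : U w -> mw s k (fun w => E w *: H w) w
    = (E w * wirt s k (fun w => RC (F w)) w) *: H w + E w *: mw s k H w.
  by move=> Uw; rewrite (mwZ s k E H w (smooth_rd EC Uw) (msm_mrd HC Uw)) wE.
have GC : smooth U (wirt true j (fun w => RC (F w))) := smooth_wirt true j oU FC.
have EGC := smoothM oU EC GC; have HbC := msm_mw true j oU HC.
have S1 := smZ _ _ EGC HC; have S2 := smZ _ _ EC HbC.
have d2 : mw false i (mw true j (fun w => E w *: H w)) z
   = (E z * wirt false i (fun w => RC (F w)) z * wirt true j (fun w => RC (F w)) z
      + E z * wirt false i (wirt true j (fun w => RC (F w))) z) *: H z
     + (E z * wirt true j (fun w => RC (F w)) z) *: mw false i H z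
     + (E z * wirt false i (fun w => RC (F w)) z) *: mw true j H z
     + E z *: mw false i (mw true j H) z.
  have nr := open_near oU (fun w Uw => esym (d1 true j w Uw)) Uz.
  have e1 := mw_add false i (msm_mrd S1 Uz) (msm_mrd S2 Uz).
  have e2 := mwZ false i _ H z (smooth_rd EGC Uz) (msm_mrd HC Uz).
  have e3 := mwZ false i E _ z (smooth_rd EC Uz) (msm_mrd HbC Uz).
  have e4 := wirtM false i (smooth_rd EC Uz) (smooth_rd GC Uz).
  rewrite -(mw_near false i nr (mrd_add (msm_mrd S1 Uz) (msm_mrd S2 Uz))).
  have e5 := wE false i z Uz.
  exact: (etrans e1 (etrans (congr2 +%R e2 e3)
    (conformal_sum _ _ _ _ (etrans e4 (congr1 (fun x => x * _ + _) e5)) e5))).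
have Ez : E z != 0.
  have := expR_gt0 (F z); rewrite -RC_gt0 -/(E z) => E0.
  by rewrite gt_eqF.
rewrite {1}/curv d2 (d1 false i z Uz) (d1 true j z Uz).
exact: (conformal_alg _ _ _ _ _ _ Ez Hu).
Qed.

End Conformal.

Section ConformalMetric.
Variables (R : realType) (n : nat) (M : complexManifold R n).
Notation V := 'rV[Cplx R]_n.
Implicit Types (c d : atlas M) (q : M) (z : V).
Variables (g : hermitianMetric M) (f : M -> R).
Hypothesis fC : forall c, smooth (cod c) (fun w => RC (f (param c w))).

Definition conformal_gram c z : 'M[Cplx R]_n := RC (expR (f (param c z))) *: g c z.

Lemma conformal_smooth c k l : smooth (cod c) (fun z => conformal_gram c z k l).
Proof.
have oU := @cod_open _ _ M c.
have H := smoothM oU (smooth_ucomp oU (@uCk_expR R) (fC c)) (gram_smooth g c k l).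
by apply: (smooth_eqf H); apply: funext => w; rewrite /conformal_gram scmxE.
Qed.

Lemma conformal_hermitian c z : cod c z ->
  forall k l, conformal_gram c z l k = (conformal_gram c z k l)^*.
Proof.
move=> zc k l; rewrite /conformal_gram !scmxE rmorphM.
by rewrite (gram_hermitian g zc k l) [X in _ = X * _]conjRC.
Qed.

Lemma conformal_posdef c z : cod c z ->
  forall v : 'rV[Cplx R]_n, v != 0 -> 0 < hform (conformal_gram c z) v.
Proof.
move=> zc v v0; rewrite /conformal_gram hformZ mulr_gt0 //.
  by rewrite RC_gt0 expR_gt0.
exact: (gram_posdef g zc).
Qed.

Lemma conformal_transition c d z : (coord c @` (dom c `&` dom d)) z ->
  forall k l : 'I_n, conformal_gram c z k l =
    \sum_(a < n) \sum_(b < n) conformal_gram d (coord d (param c z)) a b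
        * dz k (transition c d a) z * (dz l (transition c d b) z)^*.
Proof.
move=> zo k l; rewrite /conformal_gram scmxE (gram_transition g zo) mulr_sumr.
apply: eq_bigr => a _; rewrite mulr_sumr; apply: eq_bigr => b _.
have -> : param d (coord d (param c z)) = param c z.
  by rewrite coordK //; exact: overlap_param zo.
by rewrite scmxE !mulrA.
Qed.

Definition conformal : hermitianMetric M :=
  HermitianMetric conformal_smooth conformal_hermitian conformal_posdef conformal_transition.

(** The complex Hessian of [f], traced with [gt], is its Laplacian. *)
Lemma trcurv_conformal (gt : hermitianMetric M) c z : cod c z ->
  trcurv gt conformal c z = RC (expR (f (param c z))) *:
    (trcurv gt g c z - lap gt c (fun w => RC (f (param c w))) z *: g c z).
Proof.
move=> zc; have oU := @cod_open _ _ M c.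
have H k l := curv_conformal k l oU zc (gram_msm g c) (fC c) (gram_unit g zc).
rewrite /trcurv.
apply: etrans (eq_bigr _ (fun k _ => eq_bigr _ (fun l _ =>
  congr1 (fun x => ginv (gt c z) k l *: x) (H k l)))) _.
rewrite /lap scaler_suml -sumrB scaler_sumr; apply: eq_bigr => k _.
rewrite scaler_suml -sumrB scaler_sumr; apply: eq_bigr => l _.
by rewrite -[in RHS]scalerA -[in RHS]scalerBr !scalerA mulrC.
Qed.

End ConformalMetric.

Section Conclusion.
Variables (R : realType) (n : nat) (M : complexManifold R n).
Notation V := 'rV[Cplx R]_n.
Implicit Types (c d : atlas M) (q : M) (z : V).

Lemma bundle_curvE r (H : gram_family M r) c i j a b z :
  bundle_curv H c i j a b z = curv (H c) i j z a b.
Proof.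
have e1 : dz i (dzbar j (fun w => H c w a b)) z = mw false i (mw true j (H c)) z a b.
  rewrite mwE; have -> : (fun w => mw true j (H c) w a b) = wirt true j (fun w => H c w a b).
    by apply: funext => w; rewrite mwE.
  by [].
have e2 : (mw false i (H c) z *m invmx (H c z) *m mw true j (H c) z) a b =
   \sum_(s < r) \sum_(t < r) ginv (H c z) s t
      * dz i (fun w => H c w a t) z * dzbar j (fun w => H c w s b) z.
  rewrite mxE; apply: eq_bigr => s _; rewrite mxE mulr_suml; apply: eq_bigr => t _.
  by rewrite !mwE /ginv dzE dzbarE; congr (_ * _); rewrite mulrC.
by rewrite /bundle_curv e1 -e2 /curv [RHS]mxE opmxE.
Qed.

Lemma bundle_curv_sum r (H : gram_family M r) c z (v : V) (a : 'rV[Cplx R]_r) :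
  \sum_(i < n) \sum_(j < n) \sum_(s < r) \sum_(t < r)
     bundle_curv H c i j s t z * v 0 i * (v 0 j)^* * a 0 s * (a 0 t)^*
  = \sum_i \sum_j (v 0 i * (v 0 j)^*) * hform (curv (H c) i j z) a.
Proof.
apply: eq_bigr => i _; apply: eq_bigr => j _; rewrite /hform mulr_sumr.
apply: eq_bigr => s _; rewrite mulr_sumr; apply: eq_bigr => t _.
by rewrite bundle_curvE !mulrA; congr (_ * _ * _); rewrite [RHS]mulrC mulrA.
Qed.

Lemma adjm_trcurv (gt g : hermitianMetric M) c z : cod c z ->
  adjm (trcurv gt g c z) = trcurv gt g c z.
Proof.
move=> zc; have oU := @cod_open _ _ M c.
have cH k l : adjm (curv (g c) k l z) = curv (g c) l k z.
  exact: (adjm_curv k l oU zc (gram_msm g c) (fun w wc => gram_adjm g wc) (gram_unit g zc)).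
have gH k l : (ginv (gt c z) k l)^* = ginv (gt c z) l k.
  have [Ih _] := invmx_herm (gram_adjm gt zc) (gram_posdefP gt zc).
  by rewrite /ginv -[in RHS]Ih adjmE.
have adj_sum (F : 'I_n -> 'M[Cplx R]_n) : adjm (\sum_i F i) = \sum_i adjm (F i).
  apply/matrixP => a b; rewrite adjmE !summxE rmorph_sum.
  by apply: eq_bigr => i _; rewrite adjmE.
rewrite /trcurv adj_sum exchange_big; apply: eq_bigr => k _ /=.
rewrite adj_sum; apply: eq_bigr => l _.
have -> : adjm (ginv (gt c z) k l *: curv (g c) k l z)
    = (ginv (gt c z) k l)^* *: adjm (curv (g c) k l z).
  by apply/matrixP => a b; rewrite adjmE !scmxE rmorphM adjmE.
by rewrite gH cH.
Qed.

(** If the traced curvature is positive definite, so is that of every tensor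
    power, and hence some direction has positive curvature. *)
Lemma RC_positive_tensor (gt h : hermitianMetric M) k : (0 < k)%N ->
  (forall c z, cod c z -> posdef (trcurv gt h c z)) -> RC_positive (tensor_metric k h).
Proof.
move=> k0 hp q c cq a a0; have zc := cod_coord cq; set z := coord c q in zc *.
have oU := @cod_open _ _ M c.
have TE : tensor_metric k h c = fun w => tens (fun _ : 'I_k => h c w) by [].
have hu w : cod c w -> h c w \in unitmx by move=> wc; exact: gram_unit.
have TC : msm (cod c) (tensor_metric k h c).
  by rewrite TE; apply: (smooth_tens oU) => _; exact: gram_msm.
have TH w : cod c w -> adjm (tensor_metric k h c w) = tensor_metric k h c w.
  by move=> wc; rewrite TE adjm_tens; apply: eq_tens => _; exact: gram_adjm.
have Tu : tensor_metric k h c z \in unitmx by rewrite TE; apply: tens_unit => _; exact: hu.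
have cT i j := @curv_tens R n k _ (h c) i j z oU zc (gram_msm h c) (hu z zc).
have tr : \sum_i \sum_j ginv (gt c z) i j *: curv (tensor_metric k h c) i j z
    = \sum_s tens (upd (fun _ : 'I_k => h c z) s (trcurv gt h c z)).
  rewrite TE.
  apply: etrans (eq_bigr _ (fun i _ => eq_bigr _ (fun j _ =>
    congr1 (fun x => ginv (gt c z) i j *: x) (cT i j)))) _.
  rewrite [RHS](eq_bigr (fun s => \sum_i \sum_j ginv (gt c z) i j
      *: tens (upd (fun _ : 'I_k => h c z) s (curv (h c) i j z)))) => [|s _].
    rewrite [RHS]exchange_big; apply: eq_bigr => i _ /=.
    rewrite [RHS]exchange_big; apply: eq_bigr => j _ /=.
    by rewrite scaler_sumr.
  rewrite /trcurv tens_upd_sum; apply: eq_bigr => i _.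
  by rewrite tens_upd_sum; apply: eq_bigr => j _; rewrite tens_updZ.
have pos : posdef (\sum_i \sum_j ginv (gt c z) i j *: curv (tensor_metric k h c) i j z).
  rewrite tr; apply: tens_trace_posdef => //.
  - exact: gram_adjm.
  - exact: gram_posdefP.
  - exact: adjm_trcurv.
  - exact: hp.
have cH i j := adjm_curv i j oU zc TC TH Tu.
have [v [v0 vp]] := RC_of_trace (gram_adjm gt zc) (gram_posdefP gt zc) cH pos a0.
by exists v; split=> //; rewrite bundle_curv_sum.
Qed.

Lemma adjm_altmx p : adjm (altmx (Cplx R) p n) = (altmx (Cplx R) p n)^T.
Proof.
apply/matrixP => a b; rewrite adjmE [RHS]mxE ![altmx _ _ _ _ _]mxE /alt rmorph_sum.
by apply: eq_bigr => s _; rewrite rmorphM rmorph_sign rmorph_nat.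
Qed.

(** The exterior power is a parallel subbundle of the tensor power, embedded by
    antisymmetrization, so its curvature is the restriction of that of the tensor
    power: the direction that works for the image of [a] also works for [a]. *)
Lemma RC_positive_exterior (h : hermitianMetric M) p :
  RC_positive (tensor_metric p h) -> RC_positive (exterior_metric p h).
Proof.
move=> RCt q c cq a a0; have zc := cod_coord cq; set z := coord c q in zc *.
have oU := @cod_open _ _ M c.
set P := altmx (Cplx R) p n; set P' := p`!%:R^-1 *: P^T.
have TE : tensor_metric p h c = fun w => tens (fun _ : 'I_p => h c w) by [].
have EE : exterior_metric p h c = fun w => P *m tensor_metric p h c w *m P'.
  apply: funext => w; apply/matrixP => s t; rewrite TE [RHS]altmx_det.
  by rewrite /exterior_metric mxE.
have PP : P *m P' = 1%:M := altmx_inv _ _ _.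
have TC : msm (cod c) (tensor_metric p h c).
  by rewrite TE; apply: (smooth_tens oU) => _; exact: gram_msm.
have Tu : tensor_metric p h c z \in unitmx.
  by rewrite TE; apply: tens_unit => _; exact: gram_unit.
have cE i j : curv (exterior_metric p h c) i j z
    = P *m curv (tensor_metric p h c) i j z *m P'.
  rewrite EE; apply: (curv_subframe (Q := P') (Q' := P) i j oU zc TC Tu PP) => w wc.
    by rewrite TE; exact: altmx_proj.
  by rewrite TE /P'; exact: altmx_proj'.
have aP : a *m P != 0.
  by apply: contra a0 => /eqP aP; rewrite -(mulmx1 a) -PP mulmxA aP mul0mx.
have [v [v0 vp]] := RCt q c cq (a *m P) aP.
exists v; split=> //; move: vp; rewrite !bundle_curv_sum.
have fE i j : hform (curv (exterior_metric p h c) i j z) a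
    = p`!%:R^-1 * hform (curv (tensor_metric p h c) i j z) (a *m P).
  rewrite cE /P' -(adjm_altmx p) -/P -scalemxAr hformZ.
  by rewrite hform_congr.
have k0 : 0 < p`!%:R^-1 :> Cplx R by rewrite invr_gt0 ltr0n fact_gt0.
rewrite -(pmulr_rgt0 _ k0) mulr_sumr; congr (_ < _); apply: eq_bigr => i _.
rewrite mulr_sumr; apply: eq_bigr => j _.
by rewrite fE mulrCA.
Qed.

(** The matrix [tr R - mu g] is positive definite at [mu = 0] and [q0], hence for
    [(mu, q)] nearby by [posdef_near]. This is seen in one chart at [q0], and the
    tensoriality of both terms carries it to every other chart. *)
Lemma trcurv_lower_bound (gt g : hermitianMetric M) q0 :
  (forall c, dom c q0 -> posdef (trcurv gt g c (coord c q0))) ->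
  exists N : set M, exists mu : R, [/\ open N, N q0, 0 < mu &
    forall q d, N q -> dom d q -> forall v : V, v != 0 ->
      mu * Re (hform (g d (coord d q)) v) < Re (hform (trcurv gt g d (coord d q)) v)].
Proof.
move=> pos; have [c cq] := dom_cover q0; have zc := cod_coord cq.
set z0 := coord c q0 in zc; have oU := @cod_open _ _ M c.
pose A (p : R * V) : 'M[Cplx R]_n := trcurv gt g c p.2 - RC p.1 *: g c p.2.
have sT : msm (cod c) (trcurv gt g c).
  move=> a b.
  have H : smooth (cod c) (fun w => \sum_k \sum_l ginv (gt c w) k l * curv (g c) k l w a b).
    apply: (smooth_sum _ _ oU) => k; apply: (smooth_sum _ _ oU) => l.
    apply: (smoothM oU); first exact: (msm_inv oU (gram_msm gt c) (@gram_unit _ _ _ gt c)).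
    exact: (msm_curv k l oU (gram_msm g c) (@gram_unit _ _ _ g c)).
  apply: (smooth_eqf H); apply: funext => w; rewrite /trcurv summxE.
  by apply: eq_bigr => k _; rewrite summxE; apply: eq_bigr => l _; rewrite scmxE.
have snd_c (f : V -> Cplx R) : {for z0, continuous f} ->
    {for (0 : R, z0), continuous (fun p : R * V => f p.2)}.
  move=> fc B fB; have H := fc B fB.
  have sc : (fun p : R * V => p.2) @ (0 : R, z0) --> z0 by exact: cvg_snd.
  exact: (sc _ H).
have Ac i j : {for (0 : R, z0), continuous (fun p => A p i j)}.
  rewrite (_ : (fun p => A p i j) = fun p => trcurv gt g c p.2 i j + - (RC p.1 * g c p.2 i j)).
    apply: contD; first exact: snd_c (smooth_cont (sT i j) zc).
    apply: contN; apply: contM; last exact: snd_c (smooth_cont (gram_msm g c i j) zc).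
    by apply: cont_RC; exact: cvg_fst.
  by apply: funext => p; rewrite /A [LHS]mxE opmxE scmxE.
have A0 : A (0, z0) = trcurv gt g c z0 by rewrite /A RC0 scale0r subr0.
have Ah : adjm (A (0, z0)) = A (0, z0) by rewrite A0; exact: adjm_trcurv.
have Ap : posdef (A (0, z0)) by rewrite A0; exact: pos.
have [[P1 P2] [/= P1n P2n] PP] := posdef_near Ac Ah Ap.
have [mu mu0 muP] : exists2 mu : R, 0 < mu & P1 mu.
  move/nbhs_ballP: P1n => [e /= e0 eP]; exists (e / 2); first by rewrite divr_gt0.
  apply: eP; rewrite -ball_normE /= sub0r normrN gtr0_norm ?divr_gt0 //.
  by rewrite ltr_pdivrMr // ltr_pMr // ltr1n.
pose N := interior [set q | dom c q /\ P2 (coord c q)].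
have oN : open N by exact: open_interior.
have Nq0 : N q0.
  have H1 : nbhs q0 (dom c) := open_nbhs_nbhs (conj (@dom_open _ _ M c) cq).
  have H2 : nbhs q0 (coord c @^-1` P2) := @Defs.coord_continuous _ _ M c q0 cq _ P2n.
  exact: (@filterI _ (nbhs q0) _ _ _ H1 H2).
exists N, mu; split=> // q d Nq dq v v0.
have [cq' P2q] := interior_subset Nq.
have zo : overlap d c (coord d q) := overlap_coord dq cq'.
have tE : trans d c (coord d q) = coord c q by rewrite /trans coordK.
rewrite (trcurv_change gt g zo) -(gram_change g zo) tE !hform_congr.
set w := v *m jacmx d c (coord d q).
have Ju := jacmx_unit g zo.
have w0 : w != 0 by apply: contra v0 => /eqP wz; rewrite -(mulmxK Ju v) -/w wz mul0mx.
have := PP (mu, coord c q) (conj muP P2q) w w0; rewrite /A /= hformD.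
rewrite -scaleNr hformZ ReD -RCN ReM ReRC ImRC mul0r subr0 mulNr subr_gt0.
by [].
Qed.

End Conclusion.

Theorem corollary1p2 (R : realType) (n : nat) (M : complexManifold R n)
  (M_compact : compact [set: M]) (M_connected : connected [set: M])
  (g0 gt : hermitianMetric M)
  (tr_quasi_positive : quasi_positive (tr_chern_curv gt g0)) :
  exists h : hermitianMetric M,
    (forall k : nat, (1 <= k)%N -> RC_positive (tensor_metric k h)) /\
    (forall p : nat, (1 <= p <= n)%N -> RC_positive (exterior_metric p h)).
Proof.
(* [trcurv_lower_bound] gives [N] and [mu], and [strict_potential] the function
   [f] with [L < lam]. *)
have [nonneg [q0 pos0]] := tr_quasi_positive.
have [|N [mu [oN Nq0 mu0 bound]]] := @trcurv_lower_bound R n M gt g0 q0.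
  by move=> c cq v v0; rewrite -tr_chern_curvE; [exact: pos0|exact: cod_coord].
have [f [L [[fC Lc fL] Llam]]] :=
  strict_potential gt oN mu0 M_compact M_connected (ex_intro _ q0 Nq0).
pose h := conformal g0 fC.
have hp c z : cod c z -> posdef (trcurv gt h c z).
  move=> zc v v0; have zq := param_dom zc; have zK := paramK zc.
  rewrite (trcurv_conformal g0 fC gt zc) fL // hformZ; apply: mulr_gt0.
    by rewrite RC_gt0 expR_gt0.
  set q := param c z in zq zK *.
  have gp := gram_posdef g0 zc v0; move: (gp); rewrite ltcplx => /andP[_ gp'].
  rewrite -scaleNr hformD hformZ -RCN.
  rewrite ltcplx; apply/andP; split.
    rewrite ImD ImM ImRC mul0r addr0 (Im_hform _ (gram_adjm g0 zc)) mulr0 addr0.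
    by rewrite (Im_hform _ (adjm_trcurv gt g0 zc)).
  rewrite ReD ReM ReRC ImRC mul0r subr0 mulNr subr_gt0.
  have Lq := Llam q; rewrite /lam in Lq.
  (* On [N] the curvature exceeds [mu g0] and [L < mu]; off [N] it is
     semidefinite and [L < 0]. *)
  have [Nq|Nq] := pselect (N q).
    rewrite asboolT // in Lq; have := bound q c Nq zq v v0; rewrite zK.
    by apply: le_lt_trans; rewrite ler_wpM2r // ltW.
  rewrite asboolF // in Lq.
  have := nonneg q c zq v; rewrite zK tr_chern_curvE // lecplx => /andP[_ T0].
  by apply: lt_le_trans T0; rewrite nmulr_rlt0.
exists h; split=> [k k1|p /andP[p1 _]].
  exact: (RC_positive_tensor k1 hp).
exact: (RC_positive_exterior (RC_positive_tensor p1 hp)).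
Qed.
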